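(* Let $\vartheta_{\boldsymbol{P}}=(\vartheta,\boldsymbol{P})$ be a primitive and compatible random substitution on a finite alphabet $\mathcal{A}$, with Perron--Frobenius eigenvalue $\lambda$, normalised right Perron--Frobenius eigenvector $(R_a)_{a\in\mathcal{A}}$, associated subshift $X_\vartheta$ and frequency measure $\mu_{\boldsymbol{P}}$. 1. The limit $$\lim_{k\to\infty}\frac{1}{\lambda^k}\sum_{a\in\mathcal{A}}R_a\log(\#\vartheta^k(a))$$ exists and is equal to the topological entropy $h_{\mathrm{top}}(X_\vartheta)$. 2. The $L^q$-spectrum $\tau_{\mu_{\boldsymbol{P}}}$ is differentiable at $q=1$. Moreover, the limit $$\lim_{k\to\infty}\frac{1}{\lambda^k}\sum_{a\in\mathcal{A}}R_a\sum_{v\in\vartheta^k(a)}-\mathbb{P}[\vartheta_{\boldsymbol{P}}^k(a)=v]\log\big(\mathbb{P}[\vartheta_{\boldsymbol{P}}^k(a)=v]\big)$$ exists and is equal to $h_{\mu_{\boldsymbol{P}}}(X_\vartheta)=\dim_{\mathrm H}\mu_{\boldsymbol{P}}=\tau_{\mu_{\boldsymbol{P}}}'(1)$.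
   Context: Random substitutions. Let $\mathcal{A}$ be a finite alphabet and $\mathcal{A}^+$ the set of non-empty finite words over $\mathcal{A}$; $|v|$ is the length of $v$ and $|v|_u$ the number of (possibly overlapping) occurrences of $u$ as a subword of $v$. A random substitution $\vartheta_{\boldsymbol{P}}=(\vartheta,\boldsymbol{P})$ consists of a set-valued substitution $\vartheta$ assigning to each letter $a$ a non-empty finite set $\vartheta(a)\subset\mathcal{A}^+$, together with, for each letter $a$, a probability vector on $\vartheta(a)$ with all entries strictly positive; $\mathbb{P}[\vartheta_{\boldsymbol{P}}(a)=s]$ denotes the probability of $s\in\vartheta(a)$. It acts on words by replacing each letter independently and concatenating; $\vartheta_{\boldsymbol{P}}^k(u)$ is the $k$-th step of the Markov chain on $\mathcal{A}^+$ started at $u$ (fresh independent choices at each step), and $\vartheta^k(u)$ is the set of words $v$ with $\mathbb{P}[\vartheta_{\boldsymbol{P}}^k(u)=v]>0$. The substitution matrix is $M_{b,a}=\mathbb{E}[|\vartheta_{\boldsymbol{P}}(a)|_b]$. $\vartheta_{\boldsymbol{P}}$ is primitive if some power of $M$ has all entries positive and the Perron--Frobenius eigenvalue $\lambda$ of $M$ satisfies $\lambda>1$. $\boldsymbol{R}=(R_a)_{a\in\mathcal{A}}$ is the positive right eigenvector, $M\boldsymbol{R}=\lambda\boldsymbol{R}$, with $\sum_aR_a=1$. $\vartheta_{\boldsymbol{P}}$ is compatible if for all $a,b\in\mathcal{A}$ and $u,v\in\vartheta(a)$, $|u|_b=|v|_b$. A word is legal if it is a subword of some element of $\vartheta^k(a)$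 for some $k\in\mathbb{N}$, $a\in\mathcal{A}$; $\mathcal{L}_\vartheta^n$ is the set of legal words of length $n$. The subshift $X_\vartheta\subset\mathcal{A}^{\mathbb{Z}}$ is the set of bi-infinite sequences all of whose finite subwords are legal. For legal $v$, $[v]=\{x\in X_\vartheta:x_i=v_i,\ 1\le i\le|v|\}$. The frequency measure $\mu_{\boldsymbol{P}}$ is the unique shift-invariant Borel probability measure on $X_\vartheta$ with $\mu_{\boldsymbol{P}}([v])=\lim_{k\to\infty}\mathbb{E}[|\vartheta_{\boldsymbol{P}}^k(a)|_v]/\mathbb{E}[|\vartheta_{\boldsymbol{P}}^k(a)|]$ for every legal $v$ (the limit exists and does not depend on $a\in\mathcal{A}$, by primitivity). For $q\in\mathbb{R}$, the $L^q$-spectrum is $\tau_{\mu_{\boldsymbol{P}}}(q)=\liminf_{n\to\infty}-\frac1n\log\sum_{u\in\mathcal{L}_\vartheta^n}\mu_{\boldsymbol{P}}([u])^q$. Here $h_{\mathrm{top}}(X_\vartheta)=\lim_{n\to\infty}\frac1n\log\#\mathcal{L}_\vartheta^n$ is the topological entropy, and $h_{\mu_{\boldsymbol{P}}}(X_\vartheta)=\lim_{n\to\infty}\frac1n\sum_{u\in\mathcal{L}_\vartheta^n}-\mu_{\boldsymbol{P}}([u])\log\mu_{\boldsymbol{P}}([u])$ is the measure-theoretic entropy with respect to the shift. $\mathcal{A}^{\mathbb{Z}}$ carries the metric $d(x,y)=e^{-2N(x,y)-1}$ with $N(x,y)=\sup\{n\in\mathbb{Z}:x_j=y_j\text{ for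 all }|j|\le n\}$ (so $d(x,x)=0$), Hausdorff dimension $\dim_{\mathrm H}$ is with respect to this metric, and $\dim_{\mathrm H}\mu=\inf\{\dim_{\mathrm H}E:E\text{ Borel},\ \mu(E)>0\}$. *)

(* Defs.v *)
From HB Require Import structures.
From mathcomp Require Import all_boot all_order all_algebra finmap complex.
From mathcomp Require Import all_classical all_reals all_analysis.
Set Implicit Arguments.
Unset Strict Implicit.
Unset Printing Implicit Defensive.
Import Order.TTheory GRing.Theory Num.Theory.
Import numFieldNormedType.Exports.

Local Open Scope classical_set_scope.
Local Open Scope ring_scope.

(* A finite non-empty alphabet. The distinguished letter plays no role in the
   mathematics: the library builds sigma-algebras on pointed types only. *)
#[short(type="alphabetType")]
HB.structure Definition Alphabet := {A of Finite A & isPointed A}.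

(* [rs_prob a s] is P[theta(a) = s]. *)
Record random_substitution (R : realType) (A : finType) := RandomSubstitution {
  rs_set : A -> {fset seq A};
  rs_prob : A -> seq A -> R;
  rs_set_neq0 : forall a, rs_set a != fset0;
  rs_set_nonempty : forall a, [::] \notin rs_set a;
  rs_prob_gt0 : forall a s, s \in rs_set a -> 0 < rs_prob a s;
  rs_prob_out : forall a s, s \notin rs_set a -> rs_prob a s = 0;
  rs_prob_sum1 : forall a, \sum_(s <- rs_set a) rs_prob a s = 1 }.

(* |v|_u, counting overlapping occurrences. *)
Definition occ (A : eqType) (u v : seq A) : nat :=
  count (fun i => prefix u (drop i v)) (iota 0 (size v).+1).

Section RandomSubstitution.
Context (R : realType) (A : finType) (theta : random_substitution R A).

Fixpoint subst_word (u : seq A) : {fset seq A} :=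
  if u is a :: u' then
    [fset s ++ w | s in rs_set theta a, w in subst_word u']%fset
  else [fset [::]]%fset.

(* P[theta(a u') = v] is the sum of P[theta(a) = v1] P[theta(u') = v2] over the
   factorisations v = v1 v2. *)
Fixpoint subst_word_prob (u v : seq A) : R :=
  if u is a :: u' then
    \sum_(i < (size v).+1)
      rs_prob theta a (take i v) * subst_word_prob u' (drop i v)
  else (v == [::])%:R.

Fixpoint subst_iter (k : nat) (u : seq A) : {fset seq A} :=
  if k is k'.+1 then
    (\bigcup_(w <- subst_iter k' u) subst_word w)%fset
  else [fset u]%fset.

(* P[theta^k(u) = v]; [mem_subst_iter] below shows that [subst_iter k u] is the
   support of this law. *)
Fixpoint subst_iter_prob (k : nat) (u v : seq A) : R :=
  if k is k'.+1 then
    \sum_(w <- subst_iter k' u) subst_iter_prob k' u w * subst_word_prob w v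
  else (v == u)%:R.

Lemma subst_word_probE u v :
  (0 <= subst_word_prob u v) /\
  (v \in subst_word u) = (0 < subst_word_prob u v).
Proof.
have p_ge0 a s : 0 <= rs_prob theta a s.
  have [/(rs_prob_gt0 (r := theta))/ltW//|/(rs_prob_out (r := theta))->//] :=
    boolP (s \in rs_set theta a).
elim: u v => [|a u IH] v /=; first by rewrite inE; case: eqP; rewrite ?ltxx ?ltr01.
have t_ge0 (i : 'I_(size v).+1) :
    0 <= rs_prob theta a (take i v) * subst_word_prob u (drop i v).
  by rewrite mulr_ge0 ?p_ge0 ?(IH _).1.
split; first exact: sumr_ge0.
apply/imfset2P/idP => /= [[s sa [w wu ->]]|].
  have lt_s : (size s < (size (s ++ w)).+1)%N by rewrite size_cat ltnS leq_addr.
  rewrite lt_neqAle sumr_ge0 ?andbT => [|i _]; last first.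
    by rewrite mulr_ge0 ?p_ge0 ?(IH _).1.
  rewrite eq_sym psumr_eq0 => [|i _]; last by rewrite mulr_ge0 ?p_ge0 ?(IH _).1.
  apply/allPn; exists (Ordinal lt_s); first by rewrite mem_index_enum.
  rewrite /= take_size_cat// drop_size_cat// gt_eqF// mulr_gt0 -?(IH _).2//.
  exact: rs_prob_gt0.
rewrite lt_neqAle sumr_ge0 ?andbT// eq_sym psumr_eq0//.
case/allPn => i _; rewrite mulf_eq0 negb_or => /andP[p_neq0 w_neq0].
exists (take i v).
  by apply: contraNT p_neq0 => /(rs_prob_out (r := theta)) ->.
exists (drop i v); last by rewrite cat_take_drop.
by rewrite (IH _).2 lt_neqAle eq_sym w_neq0 (IH _).1.
Qed.

Lemma subst_iter_prob_ge0 k u v : 0 <= subst_iter_prob k u v.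
Proof.
elim: k v => [|k IH] v /=; first exact: ler0n.
by apply: sumr_ge0 => w _; rewrite mulr_ge0// (subst_word_probE _ _).1.
Qed.

Lemma mem_subst_iter k u v :
  (v \in subst_iter k u) = (0 < subst_iter_prob k u v).
Proof.
elim: k v => [|k IH] v /=; first by rewrite inE; case: eqP; rewrite ?ltxx ?ltr01.
have t_ge0 w : true -> 0 <= subst_iter_prob k u w * subst_word_prob w v.
  by rewrite mulr_ge0 ?subst_iter_prob_ge0 ?(subst_word_probE _ _).1.
rewrite lt_neqAle sumr_ge0 ?andbT// eq_sym psumr_eq0//.
apply/bigfcupP/allPn => -[w].
  rewrite andbT => wk vw; exists w => //.
  by rewrite gt_eqF// mulr_gt0 -?IH// -(subst_word_probE _ _).2.
move=> wk; rewrite mulf_eq0 negb_or => /andP[_ v_neq0].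
exists w; rewrite ?wk// (subst_word_probE _ _).2 lt_neqAle eq_sym v_neq0.
exact: (subst_word_probE _ _).1.
Qed.

Definition subst_iter_mean (k : nat) (u : seq A) (f : seq A -> nat) : R :=
  \sum_(w <- subst_iter k u) subst_iter_prob k u w * (f w)%:R.

(* Rows and columns are indexed by letters through the enumeration of [A];
   the entry in row b, column a is E[|theta(a)|_b]. *)
Definition subst_matrix : 'M[R]_#|A| :=
  \matrix_(i, j)
    \sum_(s <- rs_set theta (enum_val j))
      rs_prob theta (enum_val j) s * (occ [:: enum_val i] s)%:R.

(* The real eigenvalue dominating the modulus of every complex eigenvalue. *)
Definition is_perron_eigenvalue (n : nat) (M : 'M[R]_n) (lam : R) : Prop :=
  eigenvalue M lam /\
  forall z : R[i], eigenvalue (map_mx (real_complex R) M) z ->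
    `|z| <= real_complex R lam.

Definition subst_primitive : Prop :=
  (exists2 k : nat, (0 < k)%N & forall i j, 0 < (subst_matrix ^+ k) i j) /\
  (exists2 lam, is_perron_eigenvalue subst_matrix lam & 1 < lam).

Definition is_right_perron_vector (lam : R) (r : A -> R) : Prop :=
  [/\ forall a, 0 < r a,
      subst_matrix *m (\col_i r (enum_val i)) = lam *: (\col_i r (enum_val i)) &
      \sum_(a : A) r a = 1].

Definition subst_compatible : Prop :=
  forall a b u v, u \in rs_set theta a -> v \in rs_set theta a ->
    occ [:: b] u = occ [:: b] v.

Definition legal (u : seq A) : Prop :=
  exists k a v, v \in subst_iter k [:: a] /\ infix u v.

Definition legal_words (n : nat) : {set n.-tuple A} :=
  [set u : n.-tuple A | `[< legal u >]]%SET.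

Definition topological_entropy : R :=
  limn (fun n => n%:R^-1 * ln #|legal_words n|%:R).

End RandomSubstitution.

(* Bi-infinite sequences, as a metric space over [R]. *)
Definition fullshift (R : realType) (A : finType) : Type := int -> A.

Section FullShiftMetric.
Context (R : realType) (A : finType).

HB.instance Definition _ := Choice.copy (fullshift R A) (int -> A).

(* The set always contains the negative integers, so that the value is -1 when
   x and y differ at 0; it is unbounded exactly when x = y. *)
Definition agreement (x y : fullshift R A) : R :=
  sup [set n%:~R | n in [set n : int | forall j : int, `|j| <= n -> x j = y j]].

Definition fullshift_dist (x y : fullshift R A) : R :=
  if x == y then 0 else expR (- 2 * agreement x y - 1).

Lemma fullshift_distxx x : fullshift_dist x x = 0.
Proof. by rewrite /fullshift_dist eqxx. Qed.

Lemma fullshift_dist_positivity x y : fullshift_dist x y = 0 -> x = y.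
Proof.
rewrite /fullshift_dist; case: eqP => // _ /eqP.
by rewrite gt_eqF// expR_gt0.
Qed.

Lemma fullshift_dist_sym x y : fullshift_dist x y = fullshift_dist y x.
Proof.
rewrite /fullshift_dist eq_sym; case: eqP => // _.
suff -> : agreement x y = agreement y x by [].
rewrite /agreement; congr (sup [set _ | _ in _]); apply/seteqP.
by split=> n xy j jn; rewrite xy.
Qed.

Lemma agreement_has_sup (x y : fullshift R A) : x <> y ->
  has_sup [set (n%:~R : R) | n in
    [set n : int | forall j : int, `|j| <= n -> x j = y j]].
Proof.
move=> xy; split.
  by exists (-1)%:~R; exists (-1) => // j /(le_trans (normr_ge0 j)).
have [j xyj] : exists j, x j <> y j.
  by apply/existsNP => xy'; apply: xy; apply/funext.
exists `|j|%:~R => _ [n /= xyn <-].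
by rewrite ler_int leNgt; apply/negP => /ltW /xyn.
Qed.

Lemma fullshift_dist_triangle y x z :
  fullshift_dist x z <= fullshift_dist x y + fullshift_dist y z.
Proof.
have d_ge0 u v : 0 <= fullshift_dist u v.
  by rewrite /fullshift_dist; case: eqP => // _; exact: expR_ge0.
have [->|/eqP xz] := eqVneq x z; first by rewrite fullshift_distxx addr_ge0.
have [->|/eqP xy] := eqVneq x y; first by rewrite fullshift_distxx add0r.
have [->|/eqP yz] := eqVneq y z; first by rewrite fullshift_distxx addr0.
suff : Num.min (agreement x y) (agreement y z) <= agreement x z.
  rewrite ge_min => /orP[] le_N.
    apply: (@le_trans _ _ (fullshift_dist x y)); last by rewrite lerDl.
    rewrite /fullshift_dist; do 2 case: eqP => // _.
    by rewrite ler_expR lerD2r !mulNr lerN2 ler_pM2l.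
  apply: (@le_trans _ _ (fullshift_dist y z)); last by rewrite lerDr.
  rewrite /fullshift_dist; do 2 case: eqP => // _.
  by rewrite ler_expR lerD2r !mulNr lerN2 ler_pM2l.
apply/ler_addgt0Pr => e e0.
have [_ [n xyn <-] ltn] := sup_adherent e0 (agreement_has_sup xy).
have [_ [m yzm <-] ltm] := sup_adherent e0 (agreement_has_sup yz).
have xzk : (Num.min n m)%:~R <= agreement x z.
  apply: ub_le_sup; first exact: (agreement_has_sup xz).2.
  by exists (Num.min n m) => // j; rewrite le_min => /andP[jn jm]; rewrite xyn ?yzm.
rewrite ge_min; case: (leP n m) xzk => _ xzk; apply/orP.
  by left; rewrite -lerBlDr (le_trans (ltW ltn)).
by right; rewrite -lerBlDr (le_trans (ltW ltm)).
Qed.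

HB.instance Definition _ := isMetric.Build R (fullshift R A) fullshift_distxx
  fullshift_dist_positivity fullshift_dist_sym fullshift_dist_triangle.

End FullShiftMetric.

HB.instance Definition _ (R : realType) (A : alphabetType) :=
  isPointed.Build (fullshift R A) (fun=> point).

Section HausdorffDimension.
Context (R : realType) (T : metricType R).
Local Open Scope ereal_scope.

Definition diameter (U : set T) : \bar R :=
  ereal_sup [set (mdist x y)%:E | x in U & y in U].

(* The empty set contributes nothing, also for s = 0. *)
Definition diameter_power (s : R) (U : set T) : \bar R :=
  if U == set0 then 0 else diameter U `^ s.

Definition hausdorff_content (s delta : R) (E : set T) : \bar R :=
  ereal_inf [set \sum_(0 <= i <oo) diameter_power s (U i) |
    U in [set U : (set T)^nat |
      E `<=` \bigcup_i U i /\ forall i, diameter (U i) <= delta%:E]].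

Definition hausdorff_measure (s : R) (E : set T) : \bar R :=
  ereal_sup [set hausdorff_content s delta E | delta in [set delta | (0 < delta)%R]].

Definition hausdorff_dim (E : set T) : \bar R :=
  ereal_inf [set s%:E | s in [set s | (0 <= s)%R /\ hausdorff_measure s E = 0]].

Definition hausdorff_dim_measure (mu : set T -> \bar R) : \bar R :=
  ereal_inf [set hausdorff_dim E |
    E in [set E | <<s @open T >> E /\ 0 < mu E]].

End HausdorffDimension.

Definition borelType (T : topologicalType) := g_sigma_algebraType (@open T).

Section FrequencyMeasure.
Context (R : realType) (A : alphabetType) (theta : random_substitution R A).

Definition shift (x : fullshift R A) : fullshift R A := fun i => x (i + 1).

(* The word x_i ... x_(i + n - 1). *)
Definition window (x : fullshift R A) (i : int) (n : nat) : seq A :=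
  mkseq (fun j => x (i + j%:Z)) n.

Definition subshift : set (fullshift R A) :=
  [set x | forall i n, legal theta (window x i n)].

Definition cylinder (v : seq A) : set (fullshift R A) :=
  [set x | subshift x /\ window x 1 (size v) = v].

(* A Borel measure on the closed set X is regarded as a Borel measure on the
   full shift giving full mass to X. *)
Definition is_frequency_measure
    (mu : probability (borelType (fullshift R A)) R) : Prop :=
  [/\ mu subshift = 1%E,
      forall B : set (borelType (fullshift R A)), measurable B ->
        mu (shift @^-1` B) = mu B &
      forall v a, legal theta v ->
        (fun k => subst_iter_mean theta k [:: a] (occ v) /
                  subst_iter_mean theta k [:: a] size) @ \oo
        --> fine (mu (cylinder v))].

Variable mu : probability (borelType (fullshift R A)) R.

Definition Lq_spectrum (q : R) : \bar R :=
  limn_einf (fun n => (- (n%:R^-1 *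
    ln (\sum_(u in legal_words theta n) fine (mu (cylinder u)) `^ q)))%:E).

Definition measure_entropy : R :=
  limn (fun n => n%:R^-1 * \sum_(u in legal_words theta n)
    - (fine (mu (cylinder u)) * ln (fine (mu (cylinder u))))).

End FrequencyMeasure.

(* Main.v *)
(* For a finite law P let H_q(P) = log (sum P^q) / (1 - q) be its Renyi entropy
   (q >= 0, q <> 1), with H_1 the Shannon entropy and H_0 the logarithm of the
   size of the support. H_q is additive on independent words, does not increase
   under push-forward, and for a mixture of N laws it lies between the least of
   their entropies and the largest one plus log N.

   The law of a word of length n under the frequency measure is a mixture of the
   laws of windows of theta^k(v), with v legal of length about n / lam^k. Such a
   window determines the images of the letters of v that it contains, and it is
   determined by theta^k(v). By compatibility the letter frequencies of legal
   words are uniformly close to R, so with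
     rho_k(q) = lam^-k sum_a R_a H_q(theta^k(a))
   the accumulation points of H_q(mu_n) / n lie between rho_k(q) and
   rho_k(q) + lam^-k log #A, for every k. Hence both sequences converge to a
   common limit. The case q = 0, for a uniform mixture of windows, is the claim
   on the topological entropy. As tau(q) = (q - 1) lim H_q(mu_n) / n, letting q
   tend to 1 in the bracket gives tau'(1) = lim_k rho_k(1), and monotonicity of
   H_q in q identifies the limit with the measure-theoretic entropy. Chernoff
   bounds with q on either side of 1 and the Borel-Cantelli lemma turn tau'(1)
   into the exponential decay rate of the mass of typical cylinders, which is the
   Hausdorff dimension of mu for the given metric. *)
Require Import Defs.
From mathcomp Require Import all_boot all_order all_algebra finmap complex.
From mathcomp Require Import all_classical all_reals all_analysis.
From mathcomp Require Import ring lra zify.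
Set Implicit Arguments.
Unset Strict Implicit.
Unset Printing Implicit Defensive.
Import Order.TTheory GRing.Theory Num.Theory.
Import numFieldNormedType.Exports.
Local Open Scope classical_set_scope.
Local Open Scope ring_scope.

(** * Renyi entropies of finite laws *)

(** The width lam^-k log #A of the bracket does not depend on q. This permits fixing k first and
    then letting q tend to 1, where H_q of the finitely many laws theta^k(a) is continuous. The
    width is the logarithm of the number of components of the mixture: about n / lam^k letters give
    at most #A^(n / lam^k) words, and the starting positions add only a constant. The value q = 1
    never enters the mixture estimates; Shannon entropy is squeezed between the orders 1 + h and 1 -
    h, with h chosen for k before n tends to infinity. The measure is known only through limits of
    expected frequencies. Its mixture representation comes from reading theta^(K+k)(a) as theta^k
    applied to theta^K(a) and letting K tend to infinity. Compatibility makes lengths of images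
    deterministic, so that a position in theta^k(v) determines the letter of v in whose image it
    lies. Uniform letter frequencies come from the contraction of a stochastic matrix, a power of
    the substitution matrix conjugated by its Perron vector. *)

Section FiniteLaws.
Context {R : realType}.
Implicit Types (q : R).

(* The power with the convention 0 ^ q = 0 also for q = 0, so that the sum of
   the 0-th powers of a law counts its support. *)
Definition pw q (x : R) : R := if x == 0 then 0 else x `^ q.

Lemma pw0 q : pw q 0 = 0.
Proof. by rewrite /pw eqxx. Qed.

Lemma pw1 q : pw q 1 = 1.
Proof. by rewrite /pw oner_eq0 powR1. Qed.

Lemma pwE q (x : R) : 0 < x -> pw q x = expR (q * ln x).
Proof. by move=> x0; rewrite /pw gt_eqF// /powR gt_eqF. Qed.

Lemma pw_powR q (x : R) : q != 0 -> pw q x = x `^ q.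
Proof. by move=> q0; rewrite /pw; case: eqP => // ->; rewrite powR0. Qed.

Lemma pw_ge0 q (x : R) : 0 <= pw q x.
Proof. by rewrite /pw; case: eqP => // _; exact: powR_ge0. Qed.

Lemma pw_gt0 q (x : R) : 0 < x -> 0 < pw q x.
Proof. by move=> x0; rewrite pwE// expR_gt0. Qed.

Lemma pwM q (x y : R) : 0 <= x -> 0 <= y -> pw q (x * y) = pw q x * pw q y.
Proof.
move=> x0 y0; rewrite /pw mulf_eq0.
have [->|x_neq0] := eqVneq x 0; first by rewrite !mul0r.
have [->|y_neq0] := eqVneq y 0; first by rewrite !mulr0.
by rewrite powRM.
Qed.

(** Write z^q as z times z^(q - 1); the second factor increases with z when q >= 1. *)
Lemma pw_addl_le q (x y : R) : 1 <= q -> 0 <= x -> 0 <= y ->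
  pw q x + pw q y <= pw q (x + y).
Proof.
move=> q1; rewrite (le_eqVlt 0 x) (le_eqVlt 0 y).
move=> /predU1P[<-|x0]; first by rewrite pw0 !add0r.
move=> /predU1P[<-|y0]; first by rewrite pw0 !addr0.
have xy0 : 0 < x + y by rewrite addr_gt0.
have E (z : R) : 0 < z -> pw q z = z * expR ((q - 1) * ln z).
  by move=> z0; rewrite pwE// -{2}(lnK (x:=z))// -expRD; congr expR; ring.
rewrite !E// [X in _ <= X]mulrDl lerD// ler_pM2l// ler_expR ler_wpM2l ?subr_ge0//.
- by rewrite ler_ln ?posrE// lerDl ltW.
- by rewrite ler_ln ?posrE// lerDr ltW.
Qed.

Lemma pw_addl_ge q (x y : R) : 0 <= q <= 1 -> 0 <= x -> 0 <= y ->
  pw q (x + y) <= pw q x + pw q y.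
Proof.
move=> /andP[q0 q1]; rewrite (le_eqVlt 0 x) (le_eqVlt 0 y).
move=> /predU1P[<-|x0]; first by rewrite pw0 !add0r.
move=> /predU1P[<-|y0]; first by rewrite pw0 !addr0.
have xy0 : 0 < x + y by rewrite addr_gt0.
have E (z : R) : 0 < z -> pw q z = z * expR ((q - 1) * ln z).
  by move=> z0; rewrite pwE// -{2}(lnK (x:=z))// -expRD; congr expR; ring.
rewrite !E// [X in X <= _]mulrDl lerD// ler_pM2l// ler_expR ler_wnM2l ?subr_le0//.
- by rewrite ler_ln ?posrE// lerDl ltW.
- by rewrite ler_ln ?posrE// lerDr ltW.
Qed.

Lemma pw_sum_le q (I : Type) (r : seq I) (P : pred I) (f : I -> R) :
  1 <= q -> (forall i, 0 <= f i) ->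
  \sum_(i <- r | P i) pw q (f i) <= pw q (\sum_(i <- r | P i) f i).
Proof.
move=> q1 f0.
suff: 0 <= \sum_(i <- r | P i) f i /\
    \sum_(i <- r | P i) pw q (f i) <= pw q (\sum_(i <- r | P i) f i) by case.
apply: (big_rec2 (fun s1 s2 => 0 <= s2 /\ s1 <= pw q s2)); first by rewrite pw0.
move=> i s1 s2 _ [s20 s12]; split; first by rewrite addr_ge0.
by apply: le_trans (pw_addl_le q1 (f0 i) s20); rewrite lerD2l.
Qed.

Lemma pw_sum_ge q (I : Type) (r : seq I) (P : pred I) (f : I -> R) :
  0 <= q <= 1 -> (forall i, 0 <= f i) ->
  pw q (\sum_(i <- r | P i) f i) <= \sum_(i <- r | P i) pw q (f i).
Proof.
move=> q1 f0.
suff: 0 <= \sum_(i <- r | P i) f i /\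
    pw q (\sum_(i <- r | P i) f i) <= \sum_(i <- r | P i) pw q (f i) by case.
apply: (big_rec2 (fun s1 s2 => 0 <= s2 /\ pw q s2 <= s1)); first by rewrite pw0.
move=> i s1 s2 _ [s20 s12]; split; first by rewrite addr_ge0.
by apply: le_trans (pw_addl_ge q1 (f0 i) s20) _; rewrite lerD2l.
Qed.

(** * Bernoulli and Jensen inequalities for powers *)

Lemma ln_le_subr1 (x : R) : 0 < x -> ln x <= x - 1.
Proof. by move=> x0; have := @le_ln1Dx R (x - 1); rewrite subrKC; apply; lra. Qed.

Lemma affine_gt0 q (t : R) : 0 <= q <= 1 -> 0 < t -> 0 < 1 + q * (t - 1).
Proof.
move=> /andP[q0 q1] t0; have : 0 <= q * t by rewrite mulr_ge0// ltW.
have [q1'|q1'] := ltP q 1; first by rewrite mulrBr; lra.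
by have -> : q = 1; lra.
Qed.

(** Concavity of ln at the points t and 1 with weights q and 1 - q, whose mean is B: the tangent
    bound ln y <= y - 1 is applied at y = t / B and y = 1 / B, and the weighted right-hand sides
    cancel. *)
Lemma bernoulli_ln q (t : R) : 0 <= q <= 1 -> 0 < t -> q * ln t <= ln (1 + q * (t - 1)).
Proof.
move=> q01 t0; have B0 := affine_gt0 q01 t0; move: q01 => /andP[q0 q1].
set B := 1 + q * (t - 1) in B0 *.
have Bi0 : 0 < B^-1 by rewrite invr_gt0.
have l1 : ln (t / B) <= t / B - 1 by apply: ln_le_subr1; rewrite divr_gt0.
have l2 : ln B^-1 <= B^-1 - 1 by apply: ln_le_subr1.
have e : q * (t / B - 1) + (1 - q) * (B^-1 - 1) = 0.
  have BB : B * B^-1 = 1 by rewrite divff// gt_eqF.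
  have -> : q * (t / B - 1) + (1 - q) * (B^-1 - 1) = (q * t + 1 - q) * B^-1 - 1 by ring.
  by rewrite (_ : q * t + 1 - q = B) ?BB ?subrr// /B; ring.
have := lerD (ler_wpM2l q0 l1) (ler_wpM2l (_ : 0 <= 1 - q) l2).
rewrite e subr_ge0 => /(_ q1).
by rewrite ln_div ?posrE// lnV ?posrE//; nra.
Qed.

Lemma bernoulli_le q (t : R) : 0 <= q <= 1 -> 0 <= t -> pw q t <= 1 + q * (t - 1).
Proof.
move=> q01; rewrite le_eqVlt => /predU1P[<-|t0]; first by rewrite pw0; lra.
have := bernoulli_ln q01 t0; rewrite pwE// -ler_expR => /le_trans; apply.
by rewrite lnK// posrE affine_gt0.
Qed.

Lemma bernoulli_ge q (t : R) : 1 <= q -> 0 <= t -> 1 + q * (t - 1) <= pw q t.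
Proof.
move=> q1; rewrite le_eqVlt => /predU1P[<-|t0]; first by rewrite pw0; lra.
have [B0|B0] := leP (1 + q * (t - 1)) 0; first by apply: le_trans B0 (pw_ge0 _ _).
have q0 : 0 < q by lra.
(* The concave case with exponent 1 / q, applied to 1 + q (t - 1), gives the convex case. *)
have := @bernoulli_ln q^-1 _ _ B0.
rewrite invr_ge0 ltW//= invf_le1// q1 => /(_ isT).
rewrite (_ : 1 + q^-1 * _ = t); last first.
  have qq : q^-1 * q = 1 by rewrite mulVf// gt_eqF.
  by rewrite addrAC subrr add0r mulrA qq; ring.
rewrite -(ler_pM2l q0) mulrA mulfV ?gt_eqF// mul1r pwE// => H.
by rewrite -[leLHS]lnK ?posrE// ler_expR.
Qed.

(** The power lies above its tangent at the mean X: Bernoulli at x / X, scaled by X^q, bounds each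
    term, and the linear parts average out to 0. *)
Lemma pw_jensen_le q (I : finType) (w x : I -> R) : 1 <= q ->
  (forall i, 0 <= w i) -> \sum_i w i = 1 -> (forall i, 0 <= x i) ->
  pw q (\sum_i w i * x i) <= \sum_i w i * pw q (x i).
Proof.
move=> q1 w0 w1 x0; set X := \sum_i _.
have : 0 <= X by apply: sumr_ge0 => i _; rewrite mulr_ge0.
rewrite le_eqVlt => /predU1P[<-|X0].
  by rewrite pw0; apply: sumr_ge0 => i _; rewrite mulr_ge0 ?pw_ge0.
have -> : pw q X = \sum_i w i * (pw q X * (1 + q * (x i / X - 1))).
  have -> : \sum_i w i * (pw q X * (1 + q * (x i / X - 1))) =
      pw q X * (1 - q) * (\sum_i w i) + pw q X * q * X^-1 * (\sum_i w i * x i).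
    by rewrite !mulr_sumr -big_split/=; apply: eq_bigr => i _; ring.
  by rewrite w1 -/X -!mulrA mulVf ?gt_eqF//; ring.
apply: ler_sum => i _; rewrite ler_wpM2l//.
have {2}-> : x i = X * (x i / X) by rewrite mulrC divfK// gt_eqF.
have xX : 0 <= x i / X by rewrite divr_ge0// ltW.
by rewrite pwM ?(ltW X0)// ler_wpM2l ?pw_ge0// bernoulli_ge.
Qed.

Lemma pw_jensen_ge q (I : finType) (w x : I -> R) : 0 <= q <= 1 ->
  (forall i, 0 <= w i) -> \sum_i w i = 1 -> (forall i, 0 <= x i) ->
  \sum_i w i * pw q (x i) <= pw q (\sum_i w i * x i).
Proof.
move=> q1 w0 w1 x0; set X := \sum_i _ * x _.
have wx0 i : true -> 0 <= w i * x i by rewrite mulr_ge0.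
have : 0 <= X by apply: sumr_ge0.
rewrite le_eqVlt => /predU1P[/esym X0|X0].
  rewrite X0 pw0 big1// => i _.
  have /eqP := psumr_eq0P wx0 X0 (i := i) isT.
  by rewrite mulf_eq0 => /orP[]/eqP ->; rewrite ?mul0r ?pw0 ?mulr0.
have -> : pw q X = \sum_i w i * (pw q X * (1 + q * (x i / X - 1))).
  have -> : \sum_i w i * (pw q X * (1 + q * (x i / X - 1))) =
      pw q X * (1 - q) * (\sum_i w i) + pw q X * q * X^-1 * (\sum_i w i * x i).
    by rewrite !mulr_sumr -big_split/=; apply: eq_bigr => i _; ring.
  by rewrite w1 -/X -!mulrA mulVf ?gt_eqF//; ring.
apply: ler_sum => i _; rewrite ler_wpM2l//.
have {1}-> : x i = X * (x i / X) by rewrite mulrC divfK// gt_eqF.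
have xX : 0 <= x i / X by rewrite divr_ge0// ltW.
by rewrite pwM ?(ltW X0)// ler_wpM2l ?pw_ge0// bernoulli_le.
Qed.

(** At q = 1 the division by zero yields 0 and not the Shannon entropy, whence the condition
    [q != 1] in the estimates below. At q = 0 the convention of [pw] makes this the logarithm of the
    size of the support. *)
Definition renyi q (T : Type) (r : seq T) (P : T -> R) : R :=
  ln (\sum_(x <- r) pw q (P x)) / (1 - q).

Definition shannon (T : Type) (r : seq T) (P : T -> R) : R :=
  \sum_(x <- r) - (P x * ln (P x)).

Definition law_on (T : Type) (r : seq T) (P : T -> R) :=
  (forall a : T, 0 <= P a) /\ \sum_(x <- r) P x = 1.

Lemma law_le1 (T : eqType) (r : seq T) (P : T -> R) x :
  law_on r P -> x \in r -> P x <= 1.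
Proof.
move=> [P0 P1] xr; rewrite -P1 (perm_big _ (perm_to_rem xr)) big_cons lerDl.
exact: sumr_ge0.
Qed.

Lemma pw_sum_gt0 q (T : eqType) (r : seq T) (P : T -> R) :
  law_on r P -> 0 < \sum_(x <- r) pw q (P x).
Proof.
move=> [P0 P1]; rewrite lt_neqAle sumr_ge0 ?andbT; last by move=> *; exact: pw_ge0.
apply/eqP => /esym/eqP; rewrite psumr_eq0 => [/allP H|i _]; last exact: pw_ge0.
have : \sum_(x <- r) P x = 0.
  rewrite big_seq big1// => x /H/= /eqP Px; apply/eqP; apply: contra_eqT Px => Px.
  by rewrite gt_eqF// pw_gt0// lt_neqAle eq_sym Px P0.
by move/eqP; rewrite P1 oner_eq0.
Qed.

Lemma renyi_ge0 q (T : eqType) (r : seq T) (P : T -> R) : 0 <= q ->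
  law_on r P -> 0 <= renyi q r P.
Proof.
move=> q0 lP; have Z0 := pw_sum_gt0 q lP; rewrite /renyi.
have E x : 0 < P x -> pw q (P x) = P x * expR ((q - 1) * ln (P x)).
  by move=> z0; rewrite pwE// -{2}(lnK (x:=P x))// -expRD; congr expR; ring.
have [q1|q1|->] := ltgtP q 1; last by rewrite subrr invr0 mulr0.
- apply: divr_ge0; last by rewrite subr_ge0 ltW.
  apply: ln_ge0; rewrite -lP.2 big_seq [leRHS]big_seq ler_sum// => x xr.
  have := lP.1 x; rewrite le_eqVlt => /predU1P[<-|x0]; first by rewrite pw0.
  rewrite E// ler_peMr ?(ltW x0)// -[leLHS]expR0 ler_expR mulr_le0// ?subr_le0 ?(ltW q1)//.
  by rewrite ln_le0// (law_le1 lP).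
- apply: mulr_le0; last by rewrite invr_le0 subr_le0 ltW.
  apply: ln_le0; rewrite -lP.2 big_seq [leRHS]big_seq ler_sum// => x xr.
  have := lP.1 x; rewrite le_eqVlt => /predU1P[<-|x0]; first by rewrite pw0.
  rewrite E// ler_piMr ?(ltW x0)// -[leRHS]expR0 ler_expR mulr_ge0_le0// ?subr_ge0 ?(ltW q1)//.
  by rewrite ln_le0// (law_le1 lP).
Qed.

(** Merging atoms lowers the sum of powers when q < 1 and raises it when q > 1; the sign of 1 - q
    makes both cases decrease the entropy. *)
Lemma renyi_push q (T : eqType) (r : seq T) (J : finType) (g : T -> J) (P : T -> R) :
  0 <= q -> q != 1 -> law_on r P ->
  renyi q (index_enum J) (fun j => \sum_(x <- r | g x == j) P x) <= renyi q r P.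
Proof.
move=> q0 q1 lP; have Z0 := pw_sum_gt0 q lP.
have lg : law_on (index_enum J) (fun j => \sum_(x <- r | g x == j) P x).
  split=> [j|]; first by apply: sumr_ge0 => *; exact: lP.1.
  by rewrite -lP.2 [RHS](partition_big g xpredT).
have Zg0 := pw_sum_gt0 q lg.
rewrite /renyi; move: (Z0) Zg0; rewrite (partition_big g xpredT)//= => Z0' Zg0.
have [q1'|q1'|qE] := ltgtP q 1; last by rewrite qE eqxx in q1.
- rewrite ler_pM2r ?invr_gt0 ?subr_gt0// ler_ln ?posrE// ler_sum// => j _.
  by apply: pw_sum_ge; [rewrite q0 ltW | exact: lP.1].
- rewrite ler_nM2r ?invr_lt0 ?subr_lt0// ler_ln ?posrE// ler_sum// => j _.
  by apply: pw_sum_le; [rewrite ltW | exact: lP.1].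
Qed.

Section Mixture.
Variables (T : eqType) (r : seq T) (I : finType) (w : I -> R) (P : I -> T -> R).
Hypotheses (w0 : forall i, 0 <= w i) (w1 : \sum_i w i = 1).
Hypotheses (P0 : forall i x, 0 <= P i x) (P1 : forall i, 0 < w i -> law_on r (P i)).

(** Only components of positive weight are assumed to be laws: in the application an index may pair
    a word with a position at which no full window fits. *)
Lemma mixture_law : law_on r (fun x => \sum_i w i * P i x).
Proof.
split=> [x|]; first by apply: sumr_ge0 => i _; rewrite mulr_ge0.
rewrite exchange_big/= -w1; apply: eq_bigr => i _; rewrite -mulr_sumr.
have := w0 i; rewrite le_eqVlt => /predU1P[<-|/P1 [_ ->]]; by rewrite ?mul0r ?mulr1.
Qed.

(** Jensen at each point x shows that the sum of powers of the mixture compares with the average of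
    those of the components, in the direction fixed by the sign of 1 - q. *)
Lemma renyi_mixture_ge q lo : 0 <= q -> q != 1 ->
  (forall i, 0 < w i -> lo <= renyi q r (P i)) ->
  lo <= renyi q r (fun x => \sum_i w i * P i x).
Proof.
move=> q0 q1 Plo; have Z0 := pw_sum_gt0 q mixture_law.
have Zi i : 0 < w i -> 0 < \sum_(x <- r) pw q (P i x) by move/P1/(pw_sum_gt0 q).
have [q1'|q1'|qE] := ltgtP q 1; last by rewrite qE eqxx in q1.
- have c0 : 0 < 1 - q by rewrite subr_gt0.
  rewrite /renyi ler_pdivlMr// -ler_expR lnK ?posrE//.
  apply: (@le_trans _ _ (\sum_i w i * \sum_(x <- r) pw q (P i x))).
    rewrite -[leLHS]mul1r -[X in X * _ <= _]w1 mulr_suml ler_sum// => i _.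
    have := w0 i; rewrite le_eqVlt => /predU1P[<-|wi]; first by rewrite !mul0r.
    rewrite ler_pM2l// -[leRHS]lnK ?posrE ?Zi// ler_expR -ler_pdivlMr//.
    exact: Plo.
  under eq_bigr do rewrite mulr_sumr.
  rewrite exchange_big/= ler_sum// => x _; apply: pw_jensen_ge => //.
  by rewrite q0 ltW.
- have c0 : 1 - q < 0 by rewrite subr_lt0.
  rewrite /renyi ler_ndivlMr// -ler_expR lnK ?posrE//.
  apply: (@le_trans _ _ (\sum_i w i * \sum_(x <- r) pw q (P i x))); last first.
    rewrite -[leRHS]mul1r -[X in _ <= X * _]w1 mulr_suml ler_sum// => i _.
    have := w0 i; rewrite le_eqVlt => /predU1P[<-|wi]; first by rewrite !mul0r.
    rewrite ler_pM2l// -[leLHS]lnK ?posrE ?Zi// ler_expR -ler_ndivlMr//.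
    exact: Plo.
  under [leRHS]eq_bigr do rewrite mulr_sumr.
  rewrite exchange_big/= ler_sum// => x _; apply: pw_jensen_le => //.
  exact: ltW.
Qed.

Lemma card_pw_weights : (0 < #|I|)%N.
Proof.
rewrite lt0n; apply/eqP => /card0_eq I0; have := w1; rewrite big1 => [/eqP|i].
  by rewrite eq_sym oner_eq0.
by have := I0 i; rewrite inE.
Qed.

(** Treating the components as if they had disjoint supports, the sum of powers compares with the
    sum of w_i^q times those of the P_i. Jensen with uniform weights bounds the sum of w_i^q by N^(1
    - q), from above for q < 1 and from below for q > 1; after dividing by 1 - q this contributes
    log N. *)
Lemma renyi_mixture_le q hi : 0 <= q -> q != 1 ->
  (forall i, 0 < w i -> renyi q r (P i) <= hi) ->
  renyi q r (fun x => \sum_i w i * P i x) <= hi + ln #|I|%:R.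
Proof.
move=> q0 q1 Phi; have Z0 := pw_sum_gt0 q mixture_law.
have Zi i : 0 < w i -> 0 < \sum_(x <- r) pw q (P i x) by move/P1/(pw_sum_gt0 q).
have N0 : 0 < #|I|%:R :> R by rewrite ltr0n card_pw_weights.
have u1 : \sum_(i : I) (#|I|%:R^-1 : R) = 1.
  by rewrite sumr_const -[LHS]mulr_natl mulfV// gt_eqF.
have uw : \sum_i #|I|%:R^-1 * w i = #|I|%:R^-1 by rewrite -mulr_sumr w1 mulr1.
have pN : pw q #|I|%:R^-1 = #|I|%:R^-1 * expR ((1 - q) * ln #|I|%:R).
  rewrite pwE ?invr_gt0// lnV ?posrE// -[X in _ = X * _]lnK ?posrE ?invr_gt0//.
  by rewrite -expRD lnV ?posrE//; congr expR; ring.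
have E hiq : expR ((hi + ln #|I|%:R) * hiq) = expR (hi * hiq) * expR (hiq * ln #|I|%:R).
  by rewrite -expRD; congr expR; ring.
have [q1'|q1'|qE] := ltgtP q 1; last by rewrite qE eqxx in q1.
- have c0 : 0 < 1 - q by rewrite subr_gt0.
  rewrite /renyi ler_pdivrMr// -ler_expR lnK ?posrE//.
  apply: (@le_trans _ _ (\sum_i pw q (w i) * \sum_(x <- r) pw q (P i x))).
    under [leRHS]eq_bigr do rewrite mulr_sumr.
    rewrite exchange_big/= ler_sum// => x _.
    under [leRHS]eq_bigr do rewrite -pwM//.
    by apply: pw_sum_ge => [|i]; [rewrite q0 ltW | rewrite mulr_ge0].
  apply: (@le_trans _ _ (\sum_i pw q (w i) * expR (hi * (1 - q)))).
    rewrite ler_sum// => i _.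
    have := w0 i; rewrite le_eqVlt => /predU1P[<-|wi]; first by rewrite pw0 !mul0r.
    rewrite ler_wpM2l ?pw_ge0//.
    by rewrite -[leLHS]lnK ?posrE ?Zi// ler_expR -ler_pdivrMr// Phi.
  rewrite -mulr_suml E mulrC ler_wpM2l ?expR_ge0//.
  have := @pw_jensen_ge q I (fun=> #|I|%:R^-1) w _ _ u1 w0.
  rewrite uw -mulr_sumr pN ler_pM2l ?invr_gt0//; apply; first by rewrite q0 ltW.
  by move=> _; rewrite invr_ge0 ltW.
- have c0 : 1 - q < 0 by rewrite subr_lt0.
  rewrite /renyi ler_ndivrMr// -ler_expR lnK ?posrE//.
  apply: (@le_trans _ _ (\sum_i pw q (w i) * \sum_(x <- r) pw q (P i x))); last first.
    under [leLHS]eq_bigr do rewrite mulr_sumr.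
    rewrite exchange_big/= ler_sum// => x _.
    under [leLHS]eq_bigr do rewrite -pwM//.
    by apply: pw_sum_le => [|i]; [rewrite ltW | rewrite mulr_ge0].
  apply: (@le_trans _ _ (\sum_i pw q (w i) * expR (hi * (1 - q)))); last first.
    rewrite ler_sum// => i _.
    have := w0 i; rewrite le_eqVlt => /predU1P[<-|wi]; first by rewrite pw0 !mul0r.
    rewrite ler_wpM2l ?pw_ge0//.
    by rewrite -[leRHS]lnK ?posrE ?Zi// ler_expR -ler_ndivrMr// Phi.
  rewrite -mulr_suml E mulrC ler_wpM2r ?expR_ge0//.
  have := @pw_jensen_le q I (fun=> #|I|%:R^-1) w _ _ u1 w0.
  rewrite uw -mulr_sumr pN ler_pM2l ?invr_gt0//; apply; first by rewrite ltW.
  by move=> _; rewrite invr_ge0 ltW.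
Qed.
End Mixture.

(** Jensen for the exponential at the mean c of (q - 1) ln P, by e^y >= 1 + y. As this holds for
    every q, dividing by 1 - q places the Shannon entropy between the Renyi entropies of orders
    above and below 1. *)
Lemma shannon_le_ln (T : eqType) (r : seq T) (P : T -> R) q : law_on r P ->
  (1 - q) * shannon r P <= ln (\sum_(x <- r) pw q (P x)).
Proof.
move=> lP; have Z0 := pw_sum_gt0 q lP; set c := (1 - q) * _.
rewrite -ler_expR lnK ?posrE// -[leRHS]mul1r.
rewrite -[X in X * _](_ : expR c * expR (- c) = 1); last by rewrite -expRD subrr expR0.
rewrite -mulrA ler_peMr ?expR_ge0// mulr_sumr.
have <- : \sum_(x <- r) (P x * (1 - c) - (1 - q) * (P x * ln (P x))) = 1.
  rewrite sumrB -mulr_suml lP.2 -mulr_sumr.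
  by rewrite /c /shannon sumrN; ring.
apply: ler_sum => x _; have := lP.1 x.
rewrite le_eqVlt => /predU1P[<-|x0]; first by rewrite pw0; lra.
rewrite pwE// -expRD.
have -> : - c + q * ln (P x) = ln (P x) + ((q - 1) * ln (P x) - c) by ring.
rewrite expRD lnK ?posrE//.
rewrite (_ : P x * (1 - c) - _ = P x * (1 + ((q - 1) * ln (P x) - c))); last by ring.
by rewrite ler_pM2l// expR_ge1Dx.
Qed.

Lemma renyi_le_shannon (T : eqType) (r : seq T) (P : T -> R) q : 1 < q ->
  law_on r P -> renyi q r P <= shannon r P.
Proof.
move=> q1 lP; rewrite /renyi ler_ndivrMr ?subr_lt0// mulrC.
exact: shannon_le_ln.
Qed.

Lemma shannon_le_renyi (T : eqType) (r : seq T) (P : T -> R) q : q < 1 ->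
  law_on r P -> shannon r P <= renyi q r P.
Proof.
move=> q1 lP; rewrite /renyi ler_pdivlMr ?subr_gt0// mulrC.
exact: shannon_le_ln.
Qed.

Lemma is_derive_pw_sum (T : Type) (r : seq T) (P : T -> R) (q : R) :
  (forall x, 0 <= P x) ->
  is_derive q 1 (fun s => \sum_(x <- r) pw s (P x))
    (\sum_(x <- r) ln (P x) * pw q (P x)).
Proof.
move=> P0; elim: r => [|x r IH].
  under eq_fun do rewrite big_nil; rewrite big_nil; exact: is_derive_cst.
under eq_fun do rewrite big_cons; rewrite big_cons.
apply: is_deriveD.
have := P0 x; rewrite le_eqVlt => /predU1P[<-|x0].
  under eq_fun do rewrite pw0; rewrite pw0 mulr0; exact: is_derive_cst.
under eq_fun do rewrite pwE//.
have -> : (fun q0 : R => expR (q0 * ln (P x))) = expR \o (fun q0 : R => q0 * ln (P x)) by [].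
rewrite mulrC; apply: is_derive1_comp; first by rewrite pwE//; exact: is_derive_expR.
have -> : *%R^~ (ln (P x)) = (ln (P x)) \*: (id : R -> R).
  by apply/funext => s; rewrite /= mulrC.
rewrite -[X in is_derive _ _ _ X]mulr1; exact: is_deriveZ.
Qed.

(** With F(s) the logarithm of the sum of P^s one has F(1) = 0, so the Renyi entropy of order 1 + h
    is minus the difference quotient of F at 1. *)
Lemma renyi_cvg_shannon (T : eqType) (r : seq T) (P : T -> R) : law_on r P ->
  renyi (1 + h) r P @[h --> (0 : R)^'] --> shannon r P.
Proof.
move=> lP; pose F (s : R) := ln (\sum_(x <- r) pw s (P x)).
have pw1E x : pw 1 (P x) = P x.
  by have := lP.1 x; rewrite pw_powR ?oner_neq0// => /powRr1.
have S1 : \sum_(x <- r) pw 1 (P x) = 1.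
  by rewrite -[RHS]lP.2; apply: eq_bigr => x _; rewrite pw1E.
have F1 : F 1 = 0 by rewrite /F S1 ln1.
have dF : is_derive (1 : R) 1 F (- shannon r P).
  have := is_derive_pw_sum r 1 lP.1.
  have -> : \sum_(x <- r) ln (P x) * pw 1 (P x) = - shannon r P.
    by rewrite /shannon sumrN opprK; apply: eq_bigr => x _; rewrite pw1E mulrC.
  move=> dS; rewrite -[X in is_derive _ _ _ X]mul1r.
  have -> : F = @ln R \o (fun s => \sum_(x <- r) pw s (P x)) by [].
  apply: is_derive1_comp; rewrite S1 -[X in is_derive _ _ _ X]invr1.
  exact: is_derive1_ln.
have := @ex_derive _ _ _ _ _ _ _ dF; have := @derive_val _ _ _ _ _ _ _ dF.
rewrite /derivable /derive => dE /cvgP/[!dE] cF.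
have -> : (fun h => renyi (1 + h) r P) = (fun h =>
    - (h^-1 *: ((F \o shift 1) (h *: (1 : R)) - F 1))).
  apply/funext => h; rewrite F1 subr0 /renyi opprD addNKr invrN mulrN.
  by rewrite /F /= -[_ *: _]/(_ * _) -[_ *: _]/(_ * _) mulr1 [_ + 1]addrC mulrC.
rewrite -[shannon _ _]opprK; exact: cvgN.
Qed.

End FiniteLaws.

(** * Expectations over random words *)

Lemma big_uniq_widen (R : nmodType) (T : eqType) (s s' : seq T) (F : T -> R) :
  uniq s -> uniq s' -> {subset s <= s'} ->
  (forall x, x \in s' -> x \notin s -> F x = 0) ->
  \sum_(x <- s') F x = \sum_(x <- s) F x.
Proof.
move=> us us' ss' F0; rewrite (bigID (mem s))/= [X in _ + X]big_seq_cond.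
rewrite [X in _ + X]big1 ?addr0; last by move=> x /andP[]; exact: F0.
rewrite -big_filter; apply: perm_big; apply: uniq_perm; rewrite ?filter_uniq//.
by move=> x; rewrite mem_filter andb_idr//; exact: ss'.
Qed.

Lemma big_seq_delta (R : pzSemiRingType) (T : eqType) (s : seq T) (P : T -> R) x :
  uniq s -> (x \notin s -> P x = 0) -> \sum_(y <- s) P y * (y == x)%:R = P x.
Proof.
move=> us Px; have [xs|/[dup] xs /Px ->] := boolP (x \in s).
  rewrite (bigD1_seq x)//= eqxx mulr1 big1 ?addr0// => y /negPf ->.
  by rewrite mulr0.
rewrite big_seq big1// => y ys; case: eqP => [yx|_]; last by rewrite mulr0.
by rewrite -yx ys in xs.
Qed.

Lemma occ_nil (A : eqType) (u : seq A) : occ u [::] = (u == [::]).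
Proof. by rewrite /occ /= addn0; case: u. Qed.

Lemma occ_cons (A : eqType) (u : seq A) a v :
  occ u (a :: v) = (prefix u (a :: v) + occ u v)%N.
Proof.
rewrite /occ [size (a :: v)]/= -[in LHS](addn1 (size v)) -addSn addnC iotaD count_cat.
by rewrite [iota 0 1]/= [count _ [:: 0%N]]/= addn0 (iotaDl 1 0) count_map.
Qed.

Lemma occ1 (A : eqType) (b : A) v : occ [:: b] v = count_mem b v.
Proof.
elim: v => [|a v IH]; first by rewrite occ_nil.
by rewrite occ_cons IH /= prefix0s andbT eq_sym.
Qed.

Lemma occ_leq_size (A : eqType) (u v : seq A) : (occ u v <= (size v).+1)%N.
Proof. by rewrite /occ (leq_trans (count_size _ _))// size_iota. Qed.

Lemma sum_count_mem (A : finType) (s : seq A) : (\sum_b count_mem b s = size s)%N.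
Proof.
elim: s => [|a s IH]; first by rewrite big1.
rewrite /= big_split/= IH (bigD1 a)//= eqxx big1 ?addn0// => b /negPf.
by rewrite eq_sym => ->.
Qed.

Section RandomWords.
Context {R : realType} {A : finType} (theta : random_substitution R A).
Implicit Types (u v w : seq A) (f g : seq A -> R).

Lemma subst_word_prob_out u v : v \notin subst_word theta u ->
  subst_word_prob theta u v = 0.
Proof.
rewrite (subst_word_probE _ _ _).2 lt_neqAle (subst_word_probE _ _ _).1 andbT.
by rewrite negbK => /eqP.
Qed.

Lemma subst_iter_prob_out k u v : v \notin subst_iter theta k u ->
  subst_iter_prob theta k u v = 0.
Proof.
rewrite mem_subst_iter lt_neqAle subst_iter_prob_ge0 andbT.
by rewrite negbK => /eqP.
Qed.

Definition subst_E u f : R :=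
  \sum_(v <- subst_word theta u) subst_word_prob theta u v * f v.

Definition iter_E (k : nat) u f : R :=
  \sum_(v <- subst_iter theta k u) subst_iter_prob theta k u v * f v.

(** The defining sum runs over cut positions of v; here it runs over the images s of the first
    letter, each of which is compatible with the cut at [size s] only. This form makes expectations
    recursive. *)
Lemma subst_word_prob_cons a u v : subst_word_prob theta (a :: u) v =
  \sum_(s <- rs_set theta a) rs_prob theta a s *
    subst_E u (fun w => (s ++ w == v)%:R).
Proof.
rewrite /=; have pE i : rs_prob theta a (take i v) =
    \sum_(s <- rs_set theta a) rs_prob theta a s * (s == take i v)%:R.
  by rewrite big_seq_delta// => /(rs_prob_out (r := theta)).
under eq_bigr do rewrite pE mulr_suml.
rewrite exchange_big/=; apply: eq_bigr => s _.
under eq_bigr do rewrite -mulrA.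
rewrite -mulr_sumr; congr (_ * _).
have [/prefixP[t vE]|nsv] := boolP (prefix s v).
  have lt_s : (size s < (size v).+1)%N by rewrite vE size_cat ltnS leq_addr.
  rewrite (bigD1 (Ordinal lt_s))//= big1 ?addr0 => [|i]; last first.
    rewrite -val_eqE/= => /negPf si; case: eqP => [sE|_]; last by rewrite mul0r.
    by move: si; rewrite sE size_take_min (minn_idPl _) ?eqxx// -ltnS.
  rewrite vE take_size_cat// drop_size_cat// eqxx mul1r /subst_E.
  under eq_bigr do rewrite eqseq_cat// eqxx/=.
  by rewrite big_seq_delta//; exact: subst_word_prob_out.
rewrite big1 => [|i _]; last first.
  case: eqP => [sE|_]; last by rewrite mul0r.
  by rewrite sE prefix_take in nsv.
rewrite /subst_E big1// => w _; case: eqP => [vE|_]; last by rewrite mulr0.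
by rewrite -vE prefix_prefix in nsv.
Qed.

Lemma subst_E_nil f : subst_E [::] f = f [::].
Proof. by rewrite /subst_E /= big_seq_fset1 eqxx mul1r. Qed.

Lemma subst_E_cons a u f : subst_E (a :: u) f =
  \sum_(s <- rs_set theta a) rs_prob theta a s * subst_E u (fun w => f (s ++ w)).
Proof.
rewrite {1}/subst_E; under eq_bigr do rewrite subst_word_prob_cons mulr_suml.
rewrite exchange_big/= big_seq [RHS]big_seq; apply: eq_bigr => s sa.
under eq_bigr do rewrite -mulrA.
rewrite -mulr_sumr; congr (_ * _).
rewrite /subst_E; under eq_bigr do rewrite mulr_suml.
rewrite exchange_big/= big_seq [RHS]big_seq; apply: eq_bigr => w wu.
under eq_bigr do rewrite -mulrA.
rewrite -mulr_sumr; congr (_ * _).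
under eq_bigr do rewrite mulrC eq_sym.
rewrite big_seq_delta ?fset_uniq// => /imfset2P[]; exists s => //; by exists w.
Qed.

Lemma subst_E_sum u (I : Type) (r : seq I) (F : I -> seq A -> R) :
  subst_E u (fun w => \sum_(i <- r) F i w) = \sum_(i <- r) subst_E u (F i).
Proof. by rewrite /subst_E; under eq_bigr do rewrite mulr_sumr; rewrite exchange_big. Qed.

Lemma subst_EZ u c f : subst_E u (fun w => c * f w) = c * subst_E u f.
Proof. by rewrite /subst_E mulr_sumr; apply: eq_bigr => w _; rewrite mulrCA. Qed.

Lemma eq_subst_E u f g : f =1 g -> subst_E u f = subst_E u g.
Proof. by move=> fg; apply: eq_bigr => w _; rewrite fg. Qed.

Lemma subst_E_cat u v f :
  subst_E (u ++ v) f = subst_E u (fun x => subst_E v (fun y => f (x ++ y))).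
Proof.
elim: u f => [|a u IH] f; first by rewrite subst_E_nil.
rewrite cat_cons !subst_E_cons; apply: eq_bigr => s _; rewrite IH; congr (_ * _).
by apply: eq_subst_E => x; apply: eq_subst_E => y; rewrite catA.
Qed.

Lemma subst_E_cst u c : subst_E u (fun=> c) = c.
Proof.
elim: u => [|a u IH]; first exact: subst_E_nil.
by rewrite subst_E_cons; under eq_bigr do rewrite IH; rewrite -mulr_suml rs_prob_sum1 mul1r.
Qed.

Lemma eq_iter_E k u f g : {in subst_iter theta k u, f =1 g} ->
  iter_E k u f = iter_E k u g.
Proof.
by move=> fg; rewrite /iter_E big_seq [RHS]big_seq; apply: eq_bigr => w /fg ->.
Qed.

Lemma iter_E0 u f : iter_E 0 u f = f u.
Proof. by rewrite /iter_E /= big_seq_fset1 eqxx mul1r. Qed.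

Lemma iter_ES k u f : iter_E k.+1 u f = iter_E k u (fun w => subst_E w f).
Proof.
rewrite {1}/iter_E /=; under eq_bigr do rewrite mulr_suml.
rewrite exchange_big/= /iter_E big_seq [RHS]big_seq; apply: eq_bigr => w wk.
under eq_bigr do rewrite -mulrA.
rewrite -mulr_sumr; congr (_ * _); apply: big_uniq_widen; rewrite ?fset_uniq//.
  by move=> v vw; apply/bigfcupP; exists w; rewrite ?wk.
by move=> v _ /subst_word_prob_out ->; rewrite mul0r.
Qed.

Lemma iter_E_sum k u (I : Type) (r : seq I) (P : pred I) (F : I -> seq A -> R) :
  iter_E k u (fun w => \sum_(i <- r | P i) F i w) = \sum_(i <- r | P i) iter_E k u (F i).
Proof. by rewrite /iter_E; under eq_bigr do rewrite mulr_sumr; rewrite exchange_big. Qed.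

Lemma iter_ED k u f g : iter_E k u (fun w => f w + g w) = iter_E k u f + iter_E k u g.
Proof. by rewrite /iter_E -big_split/=; apply: eq_bigr => w _; rewrite mulrDr. Qed.

Lemma iter_EZ k u c f : iter_E k u (fun w => c * f w) = c * iter_E k u f.
Proof. by rewrite /iter_E mulr_sumr; apply: eq_bigr => w _; rewrite mulrCA. Qed.

Lemma iter_E_cst k u c : iter_E k u (fun=> c) = c.
Proof.
elim: k => [|k IH]; first exact: iter_E0.
by rewrite iter_ES -[RHS]IH; apply: eq_iter_E => w _; rewrite subst_E_cst.
Qed.

Lemma iter_E_ge0 k u f : {in subst_iter theta k u, forall w, 0 <= f w} ->
  0 <= iter_E k u f.
Proof.
by move=> f0; rewrite /iter_E big_seq sumr_ge0// => w wk; rewrite mulr_ge0 ?f0 ?subst_iter_prob_ge0.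
Qed.

Lemma ler_iter_E k u f g : {in subst_iter theta k u, forall w, f w <= g w} ->
  iter_E k u f <= iter_E k u g.
Proof.
move=> fg; rewrite /iter_E big_seq [leRHS]big_seq ler_sum// => w wk.
by rewrite ler_wpM2l ?fg ?subst_iter_prob_ge0.
Qed.

(** Taking indicators for [f] turns identities between expectations into identities between sets of
    realisations; [mem_iter_add] and [mem_iter_cat] are obtained in this way. *)
Lemma iter_E_gt0P k u f : (forall w, 0 <= f w) ->
  (0 < iter_E k u f) <-> (exists2 w, w \in subst_iter theta k u & 0 < f w).
Proof.
move=> f0; have p0 := subst_iter_prob_ge0 theta k u.
have t0 w : true -> 0 <= subst_iter_prob theta k u w * f w by rewrite mulr_ge0.
rewrite /iter_E lt_neqAle sumr_ge0 ?andbT// eq_sym psumr_eq0//; split.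
  case/allPn => w wk; rewrite mulf_eq0 negb_or => /andP[_ fw].
  by exists w => //; rewrite lt_neqAle eq_sym fw f0.
case=> w wk fw; apply/allPn; exists w => //.
by rewrite gt_eqF// mulr_gt0// -mem_subst_iter.
Qed.

Lemma iter_E_add j k u f :
  iter_E (j + k) u f = iter_E j u (fun w => iter_E k w f).
Proof.
elim: k f => [|k IH] f.
  by rewrite addn0; apply: eq_iter_E => w _; rewrite iter_E0.
by rewrite addnS iter_ES IH; apply: eq_iter_E => w _; rewrite iter_ES.
Qed.

(** The images of u and v remain independent through all k steps, and this needs no control of their
    lengths. *)
Lemma iter_E_cat k u v f :
  iter_E k (u ++ v) f = iter_E k u (fun x => iter_E k v (fun y => f (x ++ y))).
Proof.
elim: k f => [|k IH] f; first by rewrite !iter_E0.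
rewrite iter_ES IH iter_ES; apply: eq_iter_E => x _.
(* The k-step expectation over v is unfolded into a sum, so that the one-step expectation over x can
   be moved inside. *)
rewrite -[RHS](@eq_subst_E x (fun z => \sum_(y <- subst_iter theta k v)
    subst_iter_prob theta k v y * subst_E y (fun z' => f (z ++ z')))).
  rewrite subst_E_sum; apply: eq_bigr => y _.
  by rewrite subst_EZ subst_E_cat.
by move=> z; rewrite iter_ES.
Qed.

Lemma iter_probE k u v : subst_iter_prob theta k u v = iter_E k u (fun w => (w == v)%:R).
Proof. by rewrite /iter_E big_seq_delta//; exact: subst_iter_prob_out. Qed.

Lemma iter_prob_law k u : law_on (subst_iter theta k u) (subst_iter_prob theta k u).
Proof.
split=> [w|]; first exact: subst_iter_prob_ge0.
by rewrite -[RHS](iter_E_cst k u 1) /iter_E; under [RHS]eq_bigr do rewrite mulr1.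
Qed.

Lemma mem_iter_add j k u v : v \in subst_iter theta (j + k) u <->
  (exists2 w, w \in subst_iter theta j u & v \in subst_iter theta k w).
Proof.
rewrite mem_subst_iter iter_probE iter_E_add.
rewrite iter_E_gt0P => [|w]; last by apply: iter_E_ge0 => w' _; exact: ler0n.
by split=> -[w wj H]; exists w => //; rewrite mem_subst_iter iter_probE in H *.
Qed.

Lemma mem_iter_cat k u v w : w \in subst_iter theta k (u ++ v) <->
  (exists x y, [/\ x \in subst_iter theta k u, y \in subst_iter theta k v & w = x ++ y]).
Proof.
rewrite mem_subst_iter iter_probE iter_E_cat.
rewrite iter_E_gt0P => [|x]; last by apply: iter_E_ge0 => y _; exact: ler0n.
split=> [[x xu]|[x [y [xu yv ->]]]].
  rewrite iter_E_gt0P => [[y yv]|y]; last exact: ler0n.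
  by rewrite ltr0n lt0b => /eqP <-; exists x, y.
exists x => //; apply/iter_E_gt0P => [y'|]; first exact: ler0n.
by exists y => //; rewrite eqxx ltr01.
Qed.

Lemma iter_neq0 k u : exists w, w \in subst_iter theta k u.
Proof.
have : 0 < iter_E k u (fun=> 1) by rewrite iter_E_cst ltr01.
by rewrite iter_E_gt0P => [[w wk _]|_]; [exists w|exact: ler01].
Qed.

Lemma subst_iter_meanE k u (f : seq A -> nat) :
  subst_iter_mean theta k u f = iter_E k u (fun w => (f w)%:R).
Proof. by []. Qed.

End RandomWords.

(** * Letter counts and windows in the compatible case *)

Section Compatible.
Context {R : realType} {A : finType} (theta : random_substitution R A).
Hypothesis compat : subst_compatible theta.
Implicit Types (u v w : seq A) (f g : seq A -> R).

(** An arbitrary representative: by compatibility its letter counts are those of every image of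
    a. *)
Definition some_image (a : A) : seq A := xchoose (fset0Pn _ (rs_set_neq0 theta a)).

Lemma some_imageP a : some_image a \in rs_set theta a.
Proof. exact: xchooseP. Qed.

(* The number of b's in any realisation of theta^k(u): see [mem_iter_count]. *)
Fixpoint iter_count (k : nat) (b : A) u : nat :=
  if k is k'.+1 then (\sum_c count_mem b (some_image c) * iter_count k' c u)%N
  else count_mem b u.

Definition iter_size k u : nat := (\sum_b iter_count k b u)%N.

Lemma iter_count_cat k b u v :
  iter_count k b (u ++ v) = (iter_count k b u + iter_count k b v)%N.
Proof.
elim: k b => [|k IH] b /=; first by rewrite count_cat.
by rewrite -big_split/=; apply: eq_bigr => c _; rewrite IH mulnDr.
Qed.

Lemma iter_count_nil k b : iter_count k b [::] = 0%N.
Proof. by elim: k b => [|k IH] b //=; rewrite big1// => c _; rewrite IH muln0. Qed.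

Lemma iter_size_cat k u v : iter_size k (u ++ v) = (iter_size k u + iter_size k v)%N.
Proof.
by rewrite /iter_size -big_split/=; apply: eq_bigr => b _; rewrite iter_count_cat.
Qed.

Lemma iter_size_nil k : iter_size k [::] = 0%N.
Proof. by rewrite /iter_size big1// => b _; rewrite iter_count_nil. Qed.

Lemma iter_size0 u : iter_size 0 u = size u.
Proof. exact: sum_count_mem. Qed.

Lemma subst_word_count u v b : v \in subst_word theta u ->
  count_mem b v = (\sum_c count_mem b (some_image c) * count_mem c u)%N.
Proof.
elim: u v => [|a u IH] v /=.
  by rewrite inE => /eqP ->; rewrite big1// => c _; rewrite muln0.
case/imfset2P => s /= sa [w wu ->].
rewrite count_cat (IH _ wu) -occ1 (compat b sa (some_imageP a)) occ1.
rewrite [in RHS](bigD1 a)//= eqxx mulnDr muln1 -addnA; congr addn.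
rewrite [in LHS](bigD1 a)//=; congr addn; apply: eq_bigr => c /negPf.
by rewrite eq_sym => ->.
Qed.

Lemma mem_iter_count k u v b : v \in subst_iter theta k u ->
  count_mem b v = iter_count k b u.
Proof.
elim: k v b => [|k IH] v b; first by rewrite /= inE => /eqP ->.
rewrite /= => /bigfcupP[w /andP[wk _] vw].
by rewrite (subst_word_count b vw); apply: eq_bigr => c _; rewrite (IH w).
Qed.

Lemma mem_iter_size k u v : v \in subst_iter theta k u -> size v = iter_size k u.
Proof.
move=> vk; rewrite -sum_count_mem; apply: eq_bigr => b _.
exact: mem_iter_count.
Qed.

Lemma iter_size_add j k u v : v \in subst_iter theta j u ->
  iter_size (j + k) u = iter_size k v.
Proof.
move=> vj; have [w wk] := iter_neq0 theta k v.
rewrite -(mem_iter_size wk) -(@mem_iter_size (j + k) u w)//.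
by apply/mem_iter_add; exists v.
Qed.

Lemma iter_count_add j k b u v : v \in subst_iter theta j u ->
  iter_count (j + k) b u = iter_count k b v.
Proof.
move=> vj; have [w wk] := iter_neq0 theta k v.
rewrite -(mem_iter_count b wk) -(@mem_iter_count (j + k) u w)//.
by apply/mem_iter_add; exists v.
Qed.

Lemma iter_count_letters k b u :
  iter_count k b u = (\sum_c count_mem c u * iter_count k b [:: c])%N.
Proof.
elim: u => [|a u IH]; first by rewrite iter_count_nil big1.
rewrite -cat1s iter_count_cat IH [in RHS](bigD1 a)//= eqxx mulnDl mul1n -addnA.
congr addn; rewrite [in LHS](bigD1 a)//=; congr addn; apply: eq_bigr => c /negPf.
by rewrite eq_sym => ->.
Qed.

Lemma iter_size_letters k u :
  iter_size k u = (\sum_c count_mem c u * iter_size k [:: c])%N.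
Proof.
rewrite /iter_size; under eq_bigr do rewrite iter_count_letters.
by rewrite exchange_big/=; apply: eq_bigr => c _; rewrite big_distrr.
Qed.

Lemma iter_count_addE j k b u :
  iter_count (j + k) b u = (\sum_c iter_count j c u * iter_count k b [:: c])%N.
Proof.
have [v vj] := iter_neq0 theta j u; rewrite (iter_count_add _ _ vj) iter_count_letters.
by apply: eq_bigr => c _; rewrite (mem_iter_count c vj).
Qed.

Lemma iter_size_addE j k u :
  iter_size (j + k) u = (\sum_c iter_count j c u * iter_size k [:: c])%N.
Proof.
have [v vj] := iter_neq0 theta j u; rewrite (iter_size_add _ vj) iter_size_letters.
by apply: eq_bigr => c _; rewrite (mem_iter_count c vj).
Qed.

Lemma subst_word_size_ge u v : v \in subst_word theta u -> (size u <= size v)%N.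
Proof.
elim: u v => [|a u IH] v //= /imfset2P[s /= sa [w wu ->]].
rewrite size_cat -add1n leq_add ?IH// lt0n size_eq0.
by apply: contraNneq (rs_set_nonempty theta a) => <-.
Qed.

Lemma iter_size_ge k u : (size u <= iter_size k u)%N.
Proof.
elim: k => [|k IH]; first by rewrite iter_size0.
have [v] := iter_neq0 theta k.+1 u; rewrite -addn1 => /[dup] vk.
move=> /mem_iter_add[w wk vw].
rewrite -(mem_iter_size vk) (leq_trans IH)// -(mem_iter_size wk).
move: vw => /=; rewrite big_seq_fset1; exact: subst_word_size_ge.
Qed.

Lemma iter_size_leS j k u : (j <= k)%N -> (iter_size j u <= iter_size k u)%N.
Proof.
move=> jk; have [v vj] := iter_neq0 theta j u.
rewrite -(subnKC jk) (iter_size_add _ vj) -(mem_iter_size vj).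
exact: iter_size_ge.
Qed.

(** * Additive functions on infixes of random images *)

Section AdditiveDeviation.
Variables (k : nat) (g : seq A -> R) (e L : R).
Hypotheses (gD : forall x y, g (x ++ y) = g x + g y).
Hypotheses (g_size : forall x, `|g x| <= (size x)%:R) (e0 : 0 <= e) (L0 : 0 <= L).
Hypothesis g_image : forall c y, y \in subst_iter theta k [:: c] ->
  (size y)%:R <= L /\ `|g y| <= e * (size y)%:R.

(** A prefix of z consists of full images of letters, where g is at most e times the length, and of
    one cut image, of length at most L. *)
Lemma prefix_deviation w z n : z \in subst_iter theta k w ->
  `|g (take n z)| <= e * (size (take n z))%:R + L.
Proof.
elim: w z n => [|c w IH] z n.
  move=> /mem_iter_size; rewrite iter_size_nil => /size0nil ->.
  by rewrite (le_trans (g_size _))//= mulr0 add0r.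
rewrite -cat1s => /mem_iter_cat[y [x [yc xw ->]]].
have [yL gy] := g_image yc; rewrite take_cat; case: ltnP => [ny|_].
  rewrite (le_trans (g_size _))//; have le_ny : (size (take n y))%:R <= L.
    by rewrite (le_trans _ yL)// ler_nat size_take_min geq_minr.
  by rewrite (le_trans le_ny)// lerDr mulr_ge0.
rewrite gD (le_trans (ler_normD _ _))// size_cat natrD mulrDr -addrA lerD//.
exact: IH.
Qed.

(** As for prefixes, now with a cut image at either end, whence 2 L. *)
Lemma infix_deviation w z i n : z \in subst_iter theta k w ->
  `|g (take n (drop i z))| <= e * (size (take n (drop i z)))%:R + (L + L).
Proof.
elim: w z i => [|c w IH] z i.
  move=> /mem_iter_size; rewrite iter_size_nil => /size0nil ->.
  by rewrite (le_trans (g_size _))//= mulr0 add0r addr_ge0.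
rewrite -cat1s => /mem_iter_cat[y [x [yc xw ->]]].
have [yL gy] := g_image yc; rewrite drop_cat; case: ltnP => [iy|_]; last exact: IH.
have dL m : (size (take m (drop i y)))%:R <= L.
  rewrite (le_trans _ yL)// ler_nat size_take_min size_drop.
  by rewrite (leq_trans (geq_minr _ _))// leq_subr.
have dL' : (size (drop i y))%:R <= L by rewrite (le_trans _ yL)// ler_nat size_drop leq_subr.
rewrite take_cat; case: ltnP => [ny|_].
  rewrite (le_trans (g_size _))// (le_trans (dL n))//.
  by rewrite -[leLHS]add0r lerD ?mulr_ge0// lerDl.
rewrite gD (le_trans (ler_normD _ _))// size_cat natrD mulrDr addrACA lerD//.
  by rewrite (le_trans (g_size _))// (le_trans dL')// lerDr mulr_ge0.
exact: prefix_deviation xw.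
Qed.

End AdditiveDeviation.

(** * Entropies of random images and of their windows *)

Definition letter_entropy q k a : R :=
  renyi q (subst_iter theta k [:: a]) (subst_iter_prob theta k [:: a]).

(** All realisations of theta^k(u) have the same length, so a concatenation can be cut in one way
    only. *)
Lemma iter_prob_cat k u v x y : size x = iter_size k u ->
  subst_iter_prob theta k (u ++ v) (x ++ y) =
  subst_iter_prob theta k u x * subst_iter_prob theta k v y.
Proof.
move=> sx; rewrite !iter_probE iter_E_cat mulrC -iter_EZ; apply: eq_iter_E => z zk.
rewrite -[RHS]mulrC -iter_EZ; apply: eq_iter_E => z' _.
by rewrite eqseq_cat ?(mem_iter_size zk)// -mulnb natrM.
Qed.

Lemma pw_sum_cat q k u v :
  \sum_(w <- subst_iter theta k (u ++ v)) pw q (subst_iter_prob theta k (u ++ v) w) =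
  (\sum_(x <- subst_iter theta k u) pw q (subst_iter_prob theta k u x)) *
  (\sum_(y <- subst_iter theta k v) pw q (subst_iter_prob theta k v y)).
Proof.
rewrite (perm_big [seq x ++ y | x <- subst_iter theta k u, y <- subst_iter theta k v]).
  rewrite big_allpairs_dep/= mulr_suml big_seq [RHS]big_seq; apply: eq_bigr => x xu.
  rewrite mulr_sumr; apply: eq_bigr => y _.
  by rewrite iter_prob_cat ?(mem_iter_size xu)// pwM ?subst_iter_prob_ge0.
apply: uniq_perm; rewrite ?fset_uniq//.
  apply: allpairs_uniq; rewrite ?fset_uniq// => -[x y] [x' y'] /=.
  move=> /allpairsP[[x1 y1] /= [x1u _ [-> ->]]] /allpairsP[[x2 y2] /= [x2u _ [-> ->]]].
  move=> /eqP; rewrite eqseq_cat ?(mem_iter_size x1u) ?(mem_iter_size x2u)//.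
  by move=> /andP[/eqP -> /eqP ->].
move=> w; apply/idP/allpairsP => [/mem_iter_cat[x [y [xu yv ->]]]|[[x y] /= [xu yv ->]]].
  by exists (x, y).
by apply/mem_iter_cat; exists x, y.
Qed.

Lemma renyi_iter q k u :
  renyi q (subst_iter theta k u) (subst_iter_prob theta k u) =
  \sum_b (count_mem b u)%:R * letter_entropy q k b.
Proof.
elim: u => [|a u IH].
  rewrite big1 => [|b _]; last by rewrite mul0r.
  have E f : iter_E theta k [::] f = f [::].
    elim: k f => [|k IH] f; first exact: iter_E0.
    by rewrite iter_ES IH subst_E_nil.
  have S w : (w \in subst_iter theta k [::]) = (w == [::]).
    by rewrite mem_subst_iter iter_probE E ltr0n lt0b eq_sym.
  rewrite /renyi (perm_big [:: [::]]) ?uniq_perm ?fset_uniq//=; last first.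
    by move=> w; rewrite S inE.
  by rewrite big_seq1 iter_probE E eqxx pw1 ln1 mul0r.
have la := pw_sum_gt0 q (iter_prob_law theta k [:: a]).
have lu := pw_sum_gt0 q (iter_prob_law theta k u).
rewrite -cat1s /renyi pw_sum_cat lnM ?posrE// mulrDl -!/(renyi _ _ _) IH.
rewrite -/(letter_entropy q k a).
transitivity (\sum_b (a == b)%:R * letter_entropy q k b +
    \sum_b (count_mem b u)%:R * letter_entropy q k b).
  congr (_ + _); rewrite (bigD1 a)//= eqxx mul1r big1 ?addr0// => b /negPf.
  by rewrite eq_sym => ->; rewrite mul0r.
by rewrite -big_split/=; apply: eq_bigr => b _; rewrite natrD mulrDl.
Qed.

Definition window_prob k v i n (u : seq A) : R :=
  iter_E theta k v (fun w => (take n (drop i w) == u)%:R).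

Lemma big_iter_tuple (F : R -> R) k u : F 0 = 0 ->
  \sum_(t : (iter_size k u).-tuple A) F (subst_iter_prob theta k u t) =
  \sum_(w <- subst_iter theta k u) F (subst_iter_prob theta k u w).
Proof.
move=> F0.
rewrite -(@big_uniq_widen _ _ (subst_iter theta k u)
    [seq val t | t : (iter_size k u).-tuple A]) ?fset_uniq//.
- by rewrite big_image.
- by rewrite map_inj_uniq ?enum_uniq//; exact: val_inj.
- move=> w wk; have sw : size w == iter_size k u by rewrite (mem_iter_size wk).
  by apply/mapP; exists (Tuple sw); rewrite ?mem_enum.
- by move=> w _ /subst_iter_prob_out ->.
Qed.

Section Window.
Variables (k i n : nat) (v : seq A).
Hypothesis wide : (i + n <= iter_size k v)%N.

Lemma window_size w : w \in subst_iter theta k v -> size (take n (drop i w)) = n.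
Proof.
move=> wk; rewrite size_takel// size_drop (mem_iter_size wk).
by rewrite leq_subRL ?(leq_trans (leq_addr _ _) wide).
Qed.

Lemma window_tuple : exists g : seq A -> n.-tuple A,
  {in subst_iter theta k v, forall w, val (g w) = take n (drop i w)}.
Proof.
have [w0 w0k] := iter_neq0 theta k v.
have s0 : size (take n (drop i w0)) == n by rewrite window_size.
exists (fun w => insubd (Tuple s0) (take n (drop i w))) => w wk.
by rewrite val_insubd window_size// eqxx.
Qed.

Lemma window_law : law_on (index_enum (n.-tuple A)) (fun t => window_prob k v i n t).
Proof.
split=> [t|]; first by apply: iter_E_ge0 => w _; exact: ler0n.
rewrite -iter_E_sum -[RHS](iter_E_cst theta k v 1); apply: eq_iter_E => w wk.
have [g gE] := window_tuple.
rewrite (bigD1 (g w))//= gE// eqxx big1 ?addr0// => t; rewrite -val_eqE gE//.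
by rewrite eq_sym => /negPf ->.
Qed.

(** The window is a function of theta^k(v), whose entropy is additive over the letters of v. *)
Lemma renyi_window_le q : 0 <= q -> q != 1 ->
  renyi q (index_enum (n.-tuple A)) (fun t => window_prob k v i n t) <=
  \sum_b (count_mem b v)%:R * letter_entropy q k b.
Proof.
move=> q0 q1; have [g gE] := window_tuple.
rewrite -renyi_iter; apply: le_trans (renyi_push g q0 q1 (iter_prob_law _ _ _)).
rewrite le_eqVlt; apply/orP; left; apply/eqP; congr (renyi _ _ _); apply/funext => t.
rewrite /window_prob /iter_E [RHS]big_mkcond/= big_seq [RHS]big_seq; apply: eq_bigr => w wk.
by rewrite -val_eqE/= gE//; case: eqP; rewrite (mulr1, mulr0).
Qed.

(** The image of v' lies inside the window at the deterministic offset [iter_size k x - i], so it is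
    a function of the window. *)
Lemma renyi_window_ge q x v' y : 0 <= q -> q != 1 -> v = x ++ v' ++ y ->
  (i <= iter_size k x)%N -> (iter_size k x + iter_size k v' <= i + n)%N ->
  \sum_b (count_mem b v')%:R * letter_entropy q k b <=
  renyi q (index_enum (n.-tuple A)) (fun t => window_prob k v i n t).
Proof.
move=> q0 q1 vE ix xn; rewrite -renyi_iter.
set L := iter_size k v'.
have [z0 z0k] := iter_neq0 theta k v'.
have s0 : size z0 == L by rewrite (mem_iter_size z0k).
have XL : (iter_size k x - i + L <= n)%N by rewrite addnBAC// leq_subLR.
pose g (t : n.-tuple A) : L.-tuple A :=
  insubd (Tuple s0) (take L (drop (iter_size k x - i) t)).
have gE (t : n.-tuple A) : val (g t) = take L (drop (iter_size k x - i) t).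
  rewrite val_insubd size_takel ?eqxx// size_drop size_tuple.
  by rewrite leq_subRL ?(leq_trans (leq_addr _ _) XL).
apply: le_trans (renyi_push g q0 q1 window_law).
rewrite /renyi -(@big_iter_tuple (pw q)) ?pw0// le_eqVlt; apply/orP; left; apply/eqP.
congr (ln _ / _); apply: eq_bigr => z _; congr (pw q _).
rewrite iter_probE -(iter_E_sum theta k v).
transitivity (iter_E theta k v (fun w => (take L (drop (iter_size k x) w) == z)%:R)).
  rewrite vE iter_E_cat.
  rewrite -[LHS](iter_E_cst theta k x); apply: eq_iter_E => a ax.
  rewrite iter_E_cat; apply: eq_iter_E => b bv'.
  rewrite -[LHS](iter_E_cst theta k y); apply: eq_iter_E => c cy.
  by rewrite -(mem_iter_size ax) drop_size_cat// take_size_cat// (mem_iter_size bv').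
apply: eq_iter_E => w wk; have [h hE] := window_tuple.
rewrite big_mkcond/= (bigD1 (h w))//= hE// eqxx big1 ?addr0 => [|t]; last first.
  by rewrite -val_eqE/= hE// eq_sym => /negPf ->; case: ifP.
rewrite -val_eqE gE hE//.
have -> : take L (drop (iter_size k x - i) (take n (drop i w))) =
    take L (drop (iter_size k x) w).
  have {1}-> : take n (drop i w) =
      take (n - (iter_size k x - i) + (iter_size k x - i)) (drop i w).
    by rewrite subnK// (leq_trans (leq_addr _ _) XL).
  rewrite -take_drop.
  rewrite take_takel; last by rewrite leq_subRL ?(leq_trans (leq_addr _ _) XL).
  by rewrite drop_drop subnK.
by case: eqP.
Qed.
End Window.

End Compatible.

(** * Perron-Frobenius and uniform letter frequencies *)

Lemma finite_lower_bound (R : realType) (I : finType) (f : I -> R) :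
  (forall i, 0 < f i) -> exists2 d, 0 < d & forall i, d <= f i.
Proof.
move=> f0; exists (\big[Num.min/1]_i f i); first exact: lt_bigmin.
by move=> i; apply: bigmin_le.
Qed.

(* One of the two halves of [a, b] contains z x0, so averaging with weights at
   least d shrinks the range of z by the factor 1 - d / 2. *)
Lemma doeblin_contraction (R : realType) (A : finType) (W : A -> A -> R) (d a b : R)
    (z : A -> R) (x0 : A) :
  0 <= d -> (forall x y, d <= W x y) -> (forall x, \sum_y W x y = 1) ->
  a <= b -> (forall x, a <= z x <= b) ->
  exists a' b', [/\ a <= a', a' <= b', b' <= b, b' - a' <= (1 - d / 2) * (b - a) &
    forall x, a' <= \sum_y W x y * z y <= b'].
Proof.
move=> d0 dW W1 ab zab; have W0 x y : 0 <= W x y by apply: le_trans (dW x y).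
have d1 : d <= 1.
  rewrite (le_trans (dW x0 x0))// -(W1 x0) (bigD1 x0)//= lerDl.
  exact: sumr_ge0.
pose D := d / 2 * (b - a).
have D0 : 0 <= D by rewrite /D !mulr_ge0// subr_ge0.
have Dba : D <= b - a by rewrite ler_piMl ?subr_ge0// ler_pdivrMr// mul1r (le_trans d1)// ler1n.
have DE : (1 - d / 2) * (b - a) = b - a - D by rewrite /D; ring.
have lb x : a + W x x0 * (z x0 - a) <= \sum_y W x y * z y.
  have -> : \sum_y W x y * z y = a + \sum_y W x y * (z y - a).
    rewrite -[X in X + _]mul1r -(W1 x) mulr_suml -big_split/=.
    by apply: eq_bigr => y _; ring.
  rewrite lerD2l (bigD1 x0)//= lerDl sumr_ge0// => y _.
  by rewrite mulr_ge0// subr_ge0; case/andP: (zab y).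
have ub x : \sum_y W x y * z y <= b - W x x0 * (b - z x0).
  have -> : \sum_y W x y * z y = b - \sum_y W x y * (b - z y).
    rewrite -[X in X - _]mul1r -(W1 x) mulr_suml -sumrB.
    by apply: eq_bigr => y _; ring.
  rewrite lerD2l lerN2 (bigD1 x0)//= lerDl sumr_ge0// => y _.
  by rewrite mulr_ge0// subr_ge0; case/andP: (zab y).
have [za zb] := andP (zab x0).
have lo x : 0 <= W x x0 * (z x0 - a) by rewrite mulr_ge0// subr_ge0.
have hi x : 0 <= W x x0 * (b - z x0) by rewrite mulr_ge0// subr_ge0.
have half_ge0 : 0 <= (b - a) / 2 by rewrite divr_ge0// subr_ge0.
have DE' : d * ((b - a) / 2) = D by rewrite /D; ring.
rewrite DE; have [half|half] := leP ((a + b) / 2) (z x0).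
  exists (a + D), b; split=> //; first by rewrite lerDl.
  - by rewrite addrC -lerBrDr.
  - by rewrite opprD addrA.
  move=> x; rewrite (le_trans _ (lb x)) ?(le_trans (ub x))//.
    by rewrite gerBl.
  rewrite lerD2l -DE' ler_pM// lerBrDr (le_trans _ half)//.
  by rewrite le_eqVlt; apply/orP; left; apply/eqP; field.
exists a, (b - D); split=> //.
- by rewrite lerBrDr addrC -lerBrDr.
- by rewrite gerBl.
- by rewrite addrAC.
move=> x; rewrite (le_trans _ (lb x)) ?(le_trans (ub x))//; last by rewrite lerDl.
rewrite lerD2l lerN2 -DE' ler_pM// lerBrDr addrC -lerBrDr (le_trans (ltW half))//.
by rewrite le_eqVlt; apply/orP; left; apply/eqP; field.
Qed.

Lemma expr_small (R : realType) (x e : R) : 0 <= x < 1 -> 0 < e -> exists n, x ^+ n < e.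
Proof.
move=> /andP[x0 x1] e0; have /cvgrPdist_lt/(_ e e0)[n _ nP] : (x ^+ n @[n --> \oo] --> 0).
  by apply: cvg_expr; rewrite ger0_norm.
by exists n; have := nP n (leqnn n); rewrite sub0r normrN ger0_norm// exprn_ge0.
Qed.

Lemma sum_enum_val (V : nmodType) (A : finType) (F : A -> V) :
  \sum_(i < #|A|) F (enum_val i) = \sum_c F c.
Proof. by rewrite -big_enum_val; apply: eq_bigl => c; rewrite inE. Qed.

Section Perron.
Context {R : realType} {A : finType} (theta : random_substitution R A).
Variables (lam : R) (r : A -> R).
Hypotheses (compat : subst_compatible theta) (prim : subst_primitive theta).
Hypotheses (lam_perron : is_perron_eigenvalue (subst_matrix theta) lam).
Hypotheses (r_perron : is_right_perron_vector theta lam r).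
Implicit Types (u v w : seq A).

Local Notation icount := (iter_count theta).
Local Notation isize := (iter_size theta).

Lemma r_gt0 a : 0 < r a. Proof. by case: r_perron. Qed.

Lemma r_sum1 : \sum_a r a = 1. Proof. by case: r_perron. Qed.

Lemma r_le1 a : r a <= 1.
Proof.
rewrite -r_sum1 (bigD1 a)//= lerDl sumr_ge0// => b _; exact/ltW/r_gt0.
Qed.

(** Primitivity provides some eigenvalue above 1, and the maximality of [lam] places it at least as
    high. *)
Lemma lam_gt1 : 1 < lam.
Proof.
have [_ [l0 [l0e _] l01]] := prim; have [_ lam_max] := lam_perron.
apply: (lt_le_trans l01); have := lam_max (complex.real_complex R l0).
have -> := eigenvalue_map (complex.real_complex R) (subst_matrix theta) l0.
move=> /(_ l0e); rewrite complex.normc_def /= expr0n addr0 complex.lecR.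
by rewrite sqrtr_sqr; apply: le_trans; exact: ler_norm.
Qed.

Lemma subst_matrixE i j : subst_matrix theta i j =
  (count_mem (enum_val i) (some_image theta (enum_val j)))%:R.
Proof.
rewrite mxE -[RHS]mul1r -[X in X * _](rs_prob_sum1 theta (enum_val j)) mulr_suml.
rewrite big_seq [RHS]big_seq; apply: eq_bigr => s sj.
by rewrite (compat _ sj (some_imageP theta _)) occ1.
Qed.

Lemma subst_matrixX k i j :
  (subst_matrix theta ^+ k) i j = (icount k (enum_val i) [:: enum_val j])%:R.
Proof.
elim: k i => [|k IH] i.
  rewrite expr0 mxE /= addn0; congr (_%:R).
  by rewrite (inj_eq enum_val_inj) eq_sym.
rewrite exprS mxE /= natr_sum -[RHS]sum_enum_val; apply: eq_bigr => l _.
by rewrite IH subst_matrixE natrM.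
Qed.

Lemma primitive_iter : exists2 k, (0 < k)%N & forall b c, (0 < icount k b [:: c])%N.
Proof.
have [[k k0 Mk] _] := prim; exists k => // b c.
by have := Mk (enum_rank b) (enum_rank c); rewrite subst_matrixX !enum_rankK ltr0n.
Qed.

Lemma iter_count_perron k b : \sum_c (icount k b [:: c])%:R * r c = lam ^+ k * r b.
Proof.
elim: k b => [|k IH] b.
  rewrite expr0 mul1r (bigD1 b)//= eqxx addn0 mul1r big1 ?addr0// => c /negPf /= ->.
  by rewrite mul0r.
have step : \sum_c (count_mem b (some_image theta c))%:R * r c = lam * r b.
  have [_ /matrixP/(_ (enum_rank b) 0) + _] := r_perron.
  rewrite !mxE enum_rankK => <-.
  rewrite -[LHS]sum_enum_val; apply: eq_bigr => j _.
  by rewrite subst_matrixE enum_rankK mxE.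
rewrite /=; under eq_bigr do rewrite natr_sum mulr_suml.
rewrite exchange_big/=; under eq_bigr do under eq_bigr do rewrite natrM -mulrA.
under eq_bigr do rewrite -mulr_sumr IH mulrCA.
by rewrite -mulr_sumr step exprSr; ring.
Qed.

Lemma iter_size_perron k : \sum_c r c * (isize k [:: c])%:R = lam ^+ k.
Proof.
rewrite -[RHS]mulr1 -[X in _ * X]r_sum1 mulr_sumr.
under [RHS]eq_bigr do rewrite -iter_count_perron.
rewrite exchange_big/=; apply: eq_bigr => c _.
by rewrite natr_sum mulr_sumr; apply: eq_bigr => b _; rewrite mulrC.
Qed.

(** The average of the lengths weighted by r is lam^k, so some letter c has a long image for a
    suitable k. After k0 initial steps every letter has produced c, and lengths never decrease
    afterwards. *)
Lemma iter_size_unbounded D : exists J, forall k b, (J <= k)%N -> (D <= isize k [:: b])%N.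
Proof.
have [k0 _ k0P] := primitive_iter.
have l0 : 0 < lam by apply: lt_trans lam_gt1; rewrite ltr01.
have [k] : exists k, lam^-1 ^+ k < D.+1%:R^-1.
  by apply: expr_small; rewrite ?invr_gt0// invr_ge0 ltW//= invf_lt1// lam_gt1.
rewrite exprVn ltf_pV2 ?posrE ?exprn_gt0// => Dk.
have [c Dc] : exists c, (D <= isize k [:: c])%N.
  apply/existsP; apply: contraLR Dk => /existsPn Dk; rewrite -leNgt -iter_size_perron.
  rewrite -[leRHS]mul1r -[X in _ <= X * _]r_sum1 mulr_suml ler_sum// => c _.
  rewrite ler_wpM2l ?(ltW (r_gt0 c))// ler_nat ltnW//.
  by have := Dk c; rewrite -ltnNge => /leq_trans; apply; exact: leqW.
exists (k0 + k)%N => k' b kk'; rewrite (leq_trans _ (iter_size_leS _ _ kk'))//.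
rewrite iter_size_addE// (bigD1 c)//= (leq_trans Dc)// (leq_trans _ (leq_addr _ _))//.
by rewrite leq_pmull.
Qed.

(** The power M^k0 of the substitution matrix, conjugated by r and divided by lam^k0, is a
    stochastic matrix W with positive entries. Iterating W on the normalised counts Z flattens them,
    which means that the counts become proportional to r. *)
Lemma letter_ratio (eps : R) : 0 < eps -> exists k, forall b c,
  `|(icount k b [:: c])%:R - r b * (isize k [:: c])%:R| <= eps * (isize k [:: c])%:R.
Proof.
move=> eps0; have [k0 _ k0P] := primitive_iter.
have l0 : 0 < lam by apply: lt_trans lam_gt1; rewrite ltr01.
have r0 b : r b != 0 by rewrite gt_eqF// r_gt0.
set Lam := lam ^+ k0; have Lam0 : 0 < Lam by rewrite exprn_gt0.
have Lam_neq0 : Lam != 0 by rewrite gt_eqF.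
pose W b e := (icount k0 b [:: e])%:R * r e / (r b * Lam).
have W0 b e : 0 < W b e by rewrite divr_gt0// mulr_gt0// ?r_gt0// ltr0n.
have W1 b : \sum_e W b e = 1.
  rewrite -mulr_suml iter_count_perron -/Lam mulrC [X in _ * X]mulrC mulVf//.
  by rewrite mulf_neq0.
have [d1 d1_gt0 d1P] := finite_lower_bound (fun p : A * A => W0 p.1 p.2).
have [d2 d2_gt0 d2P] := finite_lower_bound r_gt0.
(* A common lower bound for W and r; it confines the first Z to the interval from d to 1 / d, and
   later ones stay above d. *)
pose d := Num.min 1 (Num.min d1 d2).
have d0 : 0 < d by rewrite !lt_min ltr01 d1_gt0.
have d_le1 : d <= 1 by rewrite ge_min lexx.
have dW b e : d <= W b e by rewrite !ge_min (d1P (b, e)) orbT.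
have dr b : d <= r b by rewrite !ge_min d2P !orbT.
pose Z i c b := (icount (k0 * i.+1) b [:: c])%:R / (r b * Lam ^+ i.+1).
have ZS i c b : Z i.+1 c b = \sum_e W b e * Z i c e.
  rewrite /Z mulnS addnC iter_count_addE// natr_sum mulr_suml.
  apply: eq_bigr => e _; rewrite natrM /W [Lam ^+ i.+2]exprS; field.
  by rewrite !r0 Lam_neq0 expf_neq0.
have Zbd i c : exists a b, [/\ d <= a, a <= b, b - a <= (1 - d / 2) ^+ i * d^-1 &
    forall e, a <= Z i c e <= b].
  elim: i => [|i [a [b [da ab ba zab]]]].
    exists d, d^-1; split=> //.
    - by rewrite (le_trans d_le1)// invf_ge1.
    - by rewrite expr0 mul1r gerBl ltW.
    move=> e; have -> : Z 0 c e = W e c / r c.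
      by rewrite /Z /W muln1 expr1; field; rewrite !r0 Lam_neq0.
    rewrite ler_pdivlMr ?r_gt0// ler_pdivrMr ?r_gt0//; apply/andP; split.
      by rewrite (le_trans _ (dW e c))// ler_piMr ?(ltW d0)// r_le1.
    rewrite (@le_trans _ _ 1)//; last by rewrite mulrC ler_pdivlMr// mul1r.
    rewrite -(W1 e) (bigD1 c)//= lerDl sumr_ge0// => e' _; exact: ltW.
  have [a' [b' [aa' a'b' b'b w zab']]] :=
    doeblin_contraction c (ltW d0) dW W1 ab zab.
  exists a', b'; split=> //; first exact: le_trans aa'.
    rewrite (le_trans w)// exprS -mulrA ler_wpM2l// subr_ge0 ler_pdivrMr// mul1r.
    by rewrite (le_trans (dr c))// (le_trans (r_le1 c))// ler1n.
  by move=> e; rewrite ZS.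
(* The spread of Z is then below eps * d, and d bounds from below the mean S, to which the total
   length is proportional. *)
have [i iP] : exists i, (1 - d / 2) ^+ i < eps * d * d.
  by apply: expr_small; [lra | rewrite !mulr_gt0].
exists (k0 * i.+1)%N => b c.
have [a [b' [da ab' ba zab]]] := Zbd i c.
set T := Lam ^+ i.+1; have T0 : 0 < T by rewrite exprn_gt0.
have cE e : (icount (k0 * i.+1) e [:: c])%:R = T * (r e * Z i c e).
  by rewrite /Z -/T; field; rewrite r0 gt_eqF.
have sE : (isize (k0 * i.+1) [:: c])%:R = T * \sum_e r e * Z i c e.
  by rewrite /iter_size natr_sum mulr_sumr; apply: eq_bigr => e _.
set S := \sum_e r e * Z i c e in sE.
have aS : a <= S.
  rewrite -[leLHS]mul1r -[X in X * _ <= _]r_sum1 mulr_suml ler_sum// => e _.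
  by rewrite ler_wpM2l ?(ltW (r_gt0 e))//; case/andP: (zab e).
have Sb : S <= b'.
  rewrite -[leRHS]mul1r -[X in _ <= X * _]r_sum1 mulr_suml ler_sum// => e _.
  by rewrite ler_wpM2l ?(ltW (r_gt0 e))//; case/andP: (zab e).
rewrite cE sE [X in `|X|](_ : _ = T * (r b * (Z i c b - S))); last by ring.
rewrite normrM gtr0_norm// [leRHS]mulrCA ler_wpM2l ?(ltW T0)// normrM gtr0_norm ?r_gt0//.
have Zab : `|Z i c b - S| <= b' - a.
  by have [? ?] := andP (zab b); rewrite ler_norml; apply/andP; split; lra.
apply: (@le_trans _ _ (b' - a)).
  by rewrite (le_trans _ Zab)// ler_piMl// r_le1.
rewrite (le_trans ba)// (@le_trans _ _ (eps * d))//; last by rewrite ler_wpM2l ?(ltW eps0)// (le_trans da).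
by rewrite ler_pdivrMr// ltW.
Qed.

(** The word u may first appear after fewer than k steps. It is found again at a deeper level, where
    a long word starting with some c is produced, then [a] inside the image of c, and then u inside
    that of [a]. *)
Lemma legal_extend u k D : legal theta u -> exists w x y,
  [/\ legal theta w, x ++ u ++ y \in subst_iter theta k w & (D <= size y)%N].
Proof.
move=> [K [a [t [tK /infixP[x0 [y0 tE]]]]]].
have [k0 _ k0P] := primitive_iter.
have [J JD] := iter_size_unbounded D.+1.
have [v vJ] := iter_neq0 theta (J + k) [:: a].
(* One letter c to host [a], and D further letters that supply the context on the right. *)
have : (D.+1 <= size v)%N by rewrite (mem_iter_size _ vJ)// JD// leq_addr.
case: v vJ => // c v' vJ; rewrite ltnS => Dv'.
have [w2 w2k] := iter_neq0 theta k0 [:: c].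
have /splitPr aw2 : a \in w2.
  by rewrite -has_pred1 has_count (mem_iter_count _ _ w2k)// k0P.
case: aw2 w2k => p s w2k.
have [w3 w3k] := iter_neq0 theta k0 v'.
have [p' p'K] := iter_neq0 theta K p.
have [s' s'K] := iter_neq0 theta K (s ++ w3).
have deep : p' ++ t ++ s' \in subst_iter theta (J + k + k0 + K) [:: a].
  apply/mem_iter_add; exists (p ++ [:: a] ++ (s ++ w3)).
    apply/mem_iter_add; exists (c :: v') => //; rewrite -[c :: v']cat1s.
    by apply/mem_iter_cat; exists (p ++ a :: s), w3; rewrite -catA.
  by apply/mem_iter_cat; exists p', (t ++ s'); split=> //; apply/mem_iter_cat; exists t, s'.
(* Regrouping the steps isolates the last k of them; the word before those is the legal word w. *)
have : p' ++ t ++ s' \in subst_iter theta (J + k0 + K + k) [:: a].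
  by move: deep; congr (_ \in subst_iter _ _ _); lia.
move/mem_iter_add => [w wJ tw]; exists w, (p' ++ x0), (y0 ++ s'); split.
- by exists (J + k0 + K)%N, a, w; split=> //; exact: infix_refl.
- by move: tw; rewrite tE -!catA.
- rewrite size_cat (leq_trans Dv')// (leq_trans _ (leq_addl _ _))//.
  rewrite (mem_iter_size _ s'K)// (leq_trans _ (iter_size_ge _ _ _))// size_cat.
  by rewrite (leq_trans _ (leq_addl _ _))// (mem_iter_size _ w3k)// iter_size_ge.
Qed.

Lemma legal_infix u v : infix u v -> legal theta v -> legal theta u.
Proof.
by move=> uv [k [a [w [wk vw]]]]; exists k, a, w; split=> //; exact: infix_trans vw.
Qed.

Lemma legal_iter k w v : legal theta w -> v \in subst_iter theta k w -> legal theta v.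
Proof.
move=> [j [a [t [tj /infixP[x [y tE]]]]]] vk.
have [x' x'k] := iter_neq0 theta k x; have [y' y'k] := iter_neq0 theta k y.
exists (j + k)%N, a, (x' ++ v ++ y'); split; last by apply/infixP; exists x', y'.
apply/mem_iter_add; exists t => //; rewrite tE; apply/mem_iter_cat.
by exists x', (v ++ y'); split=> //; apply/mem_iter_cat; exists v, y'.
Qed.

(** Every legal word is an infix of some theta^k(w), hence a concatenation of images of letters up
    to two cut ends. The level k given by [letter_ratio] is fixed by eps alone, and so is C. *)
Lemma letter_frequency (eps : R) : 0 < eps -> exists2 C, 0 <= C &
  forall v, legal theta v -> forall b,
    `|(count_mem b v)%:R - r b * (size v)%:R| <= eps * (size v)%:R + C.
Proof.
move=> eps0; have [k kP] := letter_ratio eps0.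
pose L : R := \sum_c (isize k [:: c])%:R.
have L0 : 0 <= L by apply: sumr_ge0 => c _; exact: ler0n.
exists (L + L); first exact: addr_ge0.
move=> v /(legal_extend k 0)[w [x [y [_ xvy _]]]] b.
have := @infix_deviation _ _ theta compat k
  (fun v => (count_mem b v)%:R - r b * (size v)%:R) eps L _ _ (ltW eps0) L0 _
  w (x ++ v ++ y) (size x) (size v) xvy.
rewrite drop_size_cat// take_size_cat//; apply.
- by move=> u u'; rewrite count_cat size_cat !natrD; ring.
- move=> u; have cu : (count_mem b u)%:R <= (size u)%:R :> R by rewrite ler_nat count_size.
  have cu0 : 0 <= (count_mem b u)%:R :> R by [].
  have rb0 := ltW (r_gt0 b); have rb1 := r_le1 b.
  by rewrite ler_norml; nra.
- move=> c u uk; split; last by rewrite (mem_iter_count _ _ uk)// (mem_iter_size _ uk)//.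
  rewrite (mem_iter_size _ uk)// /L (bigD1 c)//= lerDl.
  by apply: sumr_ge0 => c' _; exact: ler0n.
Qed.

(** Used with the lengths and with the entropies of the images theta^k(b) for h. *)
Lemma weighted_frequency (h : A -> R) (eps : R) : 0 < eps -> exists2 C, 0 <= C &
  forall v, legal theta v ->
    `|\sum_b (count_mem b v)%:R * h b - (\sum_b r b * h b) * (size v)%:R| <=
      eps * (size v)%:R + C.
Proof.
move=> eps0; pose S := 1 + \sum_b `|h b|.
have S0 : 0 < S by rewrite ltr_pwDl// sumr_ge0.
have [C C0 CP] := letter_frequency (divr_gt0 eps0 S0).
exists (C * S); first by rewrite mulr_ge0// ltW.
move=> v lv.
have -> : \sum_b (count_mem b v)%:R * h b - (\sum_b r b * h b) * (size v)%:R =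
    \sum_b ((count_mem b v)%:R - r b * (size v)%:R) * h b.
  by rewrite mulr_suml -sumrB; apply: eq_bigr => b _; ring.
rewrite (le_trans (ler_norm_sum _ _ _))//.
apply: (@le_trans _ _ (\sum_b (eps / S * (size v)%:R + C) * `|h b|)).
  by apply: ler_sum => b _; rewrite normrM ler_wpM2r// CP.
rewrite -mulr_sumr.
have -> : eps * (size v)%:R + C * S = (eps / S * (size v)%:R + C) * S.
  by rewrite mulrDl; congr (_ + _); rewrite mulrAC divfK// gt_eqF.
rewrite ler_wpM2l//; last by rewrite /S lerDr.
by rewrite addr_ge0// mulr_ge0// divr_ge0// ltW.
Qed.

End Perron.

(** * Mixtures of windows *)

Section WindowMixtures.
Context {R : realType} {A : finType} (theta : random_substitution R A).
Variables (lam : R) (r : A -> R).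
Hypotheses (compat : subst_compatible theta) (prim : subst_primitive theta).
Hypotheses (lam_perron : is_perron_eigenvalue (subst_matrix theta) lam).
Hypotheses (r_perron : is_right_perron_vector theta lam r).
Implicit Types (u v w : seq A).

Local Notation isize := (iter_size theta).

Definition image_bound k : nat := (\sum_c isize k [:: c])%N.

Lemma iter_size_image_bound k c : (isize k [:: c] <= image_bound k)%N.
Proof. by rewrite /image_bound (bigD1 c)//= leq_addr. Qed.

Lemma iter_size_le_bound k w : (isize k w <= size w * image_bound k)%N.
Proof.
elim: w => [|c w IH]; first by rewrite iter_size_nil.
by rewrite -cat1s iter_size_cat mulSn leq_add// iter_size_image_bound.
Qed.

Lemma iter_size_take1 k v : (isize k (take 1 v) <= image_bound k)%N.
Proof.
case: v => [|c v]; first by rewrite iter_size_nil.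
by rewrite /= take0 iter_size_image_bound.
Qed.

(* Words of length [m] are long enough for the windows of length [n] starting
   in the image of their first letter to fit in their image under theta^k. *)
Definition wide k m n := forall v, legal theta v -> size v = m -> (n <= isize k (drop 1 v))%N.

Lemma wide_window k m n v i : wide k m n -> legal theta v -> size v = m ->
  (i < isize k (take 1 v))%N -> (i + n <= isize k v)%N.
Proof.
move=> wmn lv sv iv; rewrite -[v in isize k v](cat_take_drop 1) iter_size_cat.
by rewrite leq_add// ?wmn// ltnW.
Qed.

(** The starting positions in the first image depend on the first letter; [image_bound k] provides
    one finite index type for all words, and the second condition cuts it down. *)
Definition valid_window k m (j : m.-tuple A * 'I_(image_bound k)) :=
  legal theta j.1 /\ (j.2 < isize k (take 1 j.1))%N.

Definition window_mixture k m n (p : n.-tuple A -> R) :=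
  exists W : m.-tuple A * 'I_(image_bound k) -> R,
    [/\ forall j, 0 <= W j, \sum_j W j = 1, forall j, 0 < W j -> valid_window j &
        forall t, p t = \sum_j W j * window_prob theta k j.1 j.2 n t].

Lemma window_prob_ge0 k v i n u : 0 <= window_prob theta k v i n u.
Proof. by apply: iter_E_ge0 => w _; exact: ler0n. Qed.

(** There are at most #A^m words and [image_bound k] positions. The latter number does not grow with
    n, while m log #A is the source of the gap. *)
Lemma renyi_window_mixture_le k m n (p : n.-tuple A -> R) q hi : 0 <= q -> q != 1 ->
  wide k m n -> window_mixture k m p ->
  (forall v, legal theta v -> size v = m ->
    \sum_b (count_mem b v)%:R * letter_entropy theta q k b <= hi) ->
  renyi q (index_enum (n.-tuple A)) p <=
    hi + (m%:R * ln #|A|%:R + ln (image_bound k)%:R).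
Proof.
move=> q0 q1 wmn [W [W0 W1 Wv /funext ->]] vhi.
have N0 := card_pw_weights W1; move: (N0).
rewrite card_prod card_tuple card_ord muln_gt0 => /andP[A0 L0].
have -> : m%:R * ln #|A|%:R + ln (image_bound k)%:R =
    ln (#|{: m.-tuple A * 'I_(image_bound k)}|)%:R :> R.
  rewrite card_prod card_tuple card_ord natrM lnM ?posrE ?ltr0n//.
  have [->|m0] := posnP m; first by rewrite expn0 ln1 mul0r.
  by rewrite natrX lnXn ?mulr_natl// ltr0n; move: A0; rewrite expn_gt0 (gtn_eqF m0) orbF.
apply: renyi_mixture_le => // [j t|j /Wv [lj jj]|j /Wv [lj jj]].
- exact: window_prob_ge0.
- by apply: (window_law compat); exact: wide_window (size_tuple _) jj.
- apply: le_trans (renyi_window_le compat _ _ _) _ => //.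
    exact: wide_window (size_tuple _) jj.
  by apply: vhi => //; exact: size_tuple.
Qed.

Lemma renyi_window_mixture_ge k m l n (p : n.-tuple A -> R) q lo : 0 <= q -> q != 1 ->
  wide k m n -> window_mixture k m p -> (l < m)%N ->
  (forall v, legal theta v -> size v = l -> (isize k v + image_bound k <= n)%N) ->
  (forall v, legal theta v -> size v = l ->
    lo <= \sum_b (count_mem b v)%:R * letter_entropy theta q k b) ->
  lo <= renyi q (index_enum (n.-tuple A)) p.
Proof.
move=> q0 q1 wmn [W [W0 W1 Wv /funext ->]] lm narrow vlo.
apply: renyi_mixture_ge => // [j t|j /Wv [lj jj]|j /Wv [lj jj]].
- exact: window_prob_ge0.
- by apply: (window_law compat); exact: wide_window (size_tuple _) jj.
(* The first letter is skipped, since the window may start in the middle of its image; the next l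
   letters have their images inside the window. *)
set v := take l (drop 1 j.1).
have sv : size v = l.
  by rewrite /v size_takel// size_drop size_tuple; case: (m) lm => // m'; rewrite subn1.
have lv : legal theta v.
  exact: legal_infix (infix_trans (infix_take _ _) (infix_drop _ _)) lj.
apply: le_trans (vlo _ lv sv) _.
apply: (renyi_window_ge compat _ (x := take 1 j.1) (y := drop l (drop 1 j.1))) => //.
- exact: wide_window (size_tuple _) jj.
- by rewrite !cat_take_drop.
- exact: ltnW.
- rewrite addnC (leq_trans _ (leq_addl _ _))// (leq_trans _ (narrow _ lv sv))//.
  by rewrite leq_add2l iter_size_take1.
Qed.

Lemma near_linear (K e : R) : 0 < e -> \forall n \near \oo, K <= e * n%:R.
Proof.
move=> e0; near=> n; rewrite mulrC -ler_pdivrMr//.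
by near: n; exact: nbhs_infty_ger.
Unshelve. all: by end_near. Qed.

Definition mean_entropy q k : R :=
  (lam ^+ k)^-1 * \sum_a r a * letter_entropy theta q k a.

Lemma letter_entropy_ge0 q k a : 0 <= q -> 0 <= letter_entropy theta q k a.
Proof. by move=> q0; apply: renyi_ge0 => //; exact: iter_prob_law. Qed.

(* With x = lam^-k, a window of length n meets about x n images of letters. The
   word supplying the window has at most (x + eta) n letters and those whose
   images lie inside of it are at least (x - eta) n. *)
Lemma window_mixture_entropy q k (X : nat -> R) (eps : R) : 0 <= q -> q != 1 ->
  (forall m n, (0 < m)%N -> wide k m n -> exists2 p, window_mixture k m p &
    renyi q (index_enum (n.-tuple A)) p = X n) ->
  0 < eps -> \forall n \near \oo,
    (mean_entropy q k - eps) * n%:R <= X n <=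
    (mean_entropy q k + ln #|A|%:R / lam ^+ k + eps) * n%:R.
Proof.
move=> q0 q1 mix eps0.
have lam0 : 0 < lam by apply: lt_trans (lam_gt1 prim lam_perron); rewrite ltr01.
set Lam := lam ^+ k; have Lam0 : 0 < Lam by rewrite exprn_gt0.
pose x := Lam^-1; have x0 : 0 < x by rewrite invr_gt0.
set H := \sum_a r a * letter_entropy theta q k a.
have H0 : 0 <= H.
  by apply: sumr_ge0 => a _; rewrite mulr_ge0 ?letter_entropy_ge0// ltW// (r_gt0 r_perron).
set T : R := ln #|A|%:R.
have T0 : 0 <= T.
  by rewrite /T; case: #|A| => [|N]; [rewrite ln0|rewrite ln_ge0// ler1n].
(* The first bound keeps [al] positive, the second one makes the cost of replacing x n letters by (x
   + eta) n or (x - eta) n at most eps / 4 per letter of the window. *)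
pose eta := Num.min (x / 2) (eps / 4 / (H + T + 1)).
have HT0 : 0 < H + T + 1 by lra.
have eta0 : 0 < eta by rewrite lt_min !divr_gt0.
have etax : eta <= x / 2 by rewrite ge_min lexx.
have etaH : (H + T + 1) * eta <= eps / 4.
  by rewrite mulrC -ler_pdivlMr// ge_min lexx orbT.
pose al := x - eta; pose be := x + eta.
have al0 : 0 < al by rewrite /al; lra.
have be0 : 0 < be by rewrite /be; lra.
(* Changing the number of letters by eta n changes the length of the image by Lam * eta * n; the
   deviation of lengths allowed here consumes half of this margin. *)
pose de' := Lam * eta / 2 / be.
have de'0 : 0 < de' by rewrite !divr_gt0// mulr_gt0.
have de'be : de' * be = Lam * eta / 2 by rewrite divfK// gt_eqF.
have Lx : Lam * x = 1 by rewrite mulfV// gt_eqF.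
have Lal : Lam * al = 1 - Lam * eta by rewrite mulrBr Lx.
have Lbe : Lam * be = 1 + Lam * eta by rewrite mulrDr Lx.
have Leta : 0 < Lam * eta by rewrite mulr_gt0.
pose de := eps / (8 * x); have de0 : 0 < de by rewrite divr_gt0// mulr_gt0.
have dex : de * x = eps / 8 by rewrite /de; field; rewrite gt_eqF.
have [C1 C10 C1P] := weighted_frequency compat prim lam_perron r_perron
  (fun b => (isize k [:: b])%:R) de'0.
have [C2 C20 C2P] := weighted_frequency compat prim lam_perron r_perron
  (letter_entropy theta q k) de0.
rewrite (iter_size_perron compat r_perron) -/Lam in C1P; rewrite -/H in C2P.
have {}C1P v : legal theta v -> `|(isize k v)%:R - Lam * (size v)%:R| <= de' * (size v)%:R + C1.
  move=> /C1P; rewrite iter_size_letters natr_sum.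
  by under [in X in _ -> X]eq_bigr do rewrite natrM.
have cE : mean_entropy q k = H * x by rewrite /mean_entropy mulrC.
rewrite cE -/Lam -/x.
near=> n.
have n1 : C1 + (image_bound k)%:R <= Lam * eta / 2 * n%:R.
  by near: n; apply: near_linear; rewrite divr_gt0.
have n2 : H + C2 <= eps / 2 * n%:R by near: n; apply: near_linear; rewrite divr_gt0.
have n3 : 2 * (H + de + T) + C2 + ln (image_bound k)%:R <= eps / 2 * n%:R.
  by near: n; apply: near_linear; rewrite divr_gt0.
have N0 : 0 <= n%:R :> R by [].
(* Of the two units added to m, one rounds up and the other pays for the first letter, which [wide]
   drops. *)
pose l := Num.truncn (al * n%:R); pose m := (Num.truncn (be * n%:R)).+2.
have [l1 l2] : l%:R <= al * n%:R /\ al * n%:R < l%:R + 1.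
  by have := truncn_itv (mulr_ge0 (ltW al0) N0); rewrite -/l -natr1 => /andP.
have [m1 m2] : m%:R <= be * n%:R + 2 /\ be * n%:R + 1 < m%:R.
  have := truncn_itv (mulr_ge0 (ltW be0) N0); rewrite /m -!natr1 => /andP[? ?]; lra.
have lm : (l < m)%N.
  rewrite -(ltr_nat R) (le_lt_trans l1)// (le_lt_trans _ m2)//.
  have := mulr_ge0 (ltW eta0) N0; rewrite /al /be; lra.
have wmn : wide k m n.
  move=> v lv sv; have lv' : legal theta (drop 1 v).
    exact: legal_infix (infix_drop _ _) lv.
  have sd : (size (drop 1 v))%:R = m%:R - 1 :> R.
    by rewrite size_drop sv /m subn1 /= -[in RHS]natr1 addrK.
  have := C1P _ lv'; rewrite sd ler_norml => /andP[+ _].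
  rewrite -(ler_nat R) => H1.
  have : (Lam - de') * (be * n%:R) <= (Lam - de') * (m%:R - 1).
    apply: ler_wpM2l; last by lra.
    rewrite subr_ge0 -(ler_pM2r be0) de'be Lbe; lra.
  have -> : (Lam - de') * (be * n%:R) = (Lam * be - de' * be) * n%:R by ring.
  rewrite Lbe de'be.
  have := ler0n R (image_bound k); lra.
have nar v : legal theta v -> size v = l -> (isize k v + image_bound k <= n)%N.
  move=> lv sv; have := C1P _ lv; rewrite sv ler_norml => /andP[_ H1].
  rewrite -(ler_nat R) natrD.
  have : (Lam + de') * l%:R <= (Lam + de') * (al * n%:R).
    by rewrite ler_wpM2l// addr_ge0// ltW.
  have -> : (Lam + de') * (al * n%:R) = (Lam * al) * n%:R + de' * be * n%:R - 2 * (de' * (eta * n%:R)).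
    by rewrite /be /al; ring.
  rewrite Lal de'be.
  have := mulr_ge0 (ltW de'0) (mulr_ge0 (ltW eta0) N0).
  lra.
have [p pm <-] := mix m n isT wmn.
have vlo v : legal theta v -> size v = l -> (H * x - eps) * n%:R <=
    \sum_b (count_mem b v)%:R * letter_entropy theta q k b.
  move=> lv sv; have := C2P _ lv; rewrite sv ler_norml => /andP[H1 _].
  have e1 : H * (al * n%:R) <= H * (l%:R + 1) by rewrite ler_wpM2l// ltW.
  have e2 : de * l%:R <= de * (al * n%:R) by rewrite ler_wpM2l// ltW.
  have e3 : H * eta * n%:R <= eps / 4 * n%:R.
    rewrite ler_wpM2r// (le_trans _ etaH)// !mulrDl -addrA lerDl.
    by rewrite addr_ge0 ?mulr_ge0 ?(ltW eta0).
  have e4 : de * (al * n%:R) <= eps / 8 * n%:R.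
    by rewrite -dex -mulrA ler_wpM2l ?(ltW de0)// ler_wpM2r// /al gerBl ltW.
  have e5 : H * (al * n%:R) = H * x * n%:R - H * eta * n%:R by rewrite /al; ring.
  have e6 := mulr_ge0 (ltW eps0) N0.
  lra.
have vhi v : legal theta v -> size v = m -> \sum_b (count_mem b v)%:R *
    letter_entropy theta q k b <= H * m%:R + de * m%:R + C2.
  by move=> lv sv; have := C2P _ lv; rewrite sv ler_norml => /andP[_]; lra.
apply/andP; split.
  exact: (renyi_window_mixture_ge q0 q1 wmn pm lm nar vlo).
apply: le_trans (renyi_window_mixture_le q0 q1 wmn pm vhi) _; rewrite -/T.
have e1 : (H + de + T) * m%:R <= (H + de + T) * (be * n%:R + 2).
  by rewrite ler_wpM2l// !addr_ge0// ltW.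
have e2 : de * (be * n%:R) <= eps / 4 * n%:R.
  rewrite mulrA ler_wpM2r// /be mulrDr dex.
  have : de * eta <= de * (x / 2) by rewrite ler_wpM2l// ltW.
  by rewrite mulrA dex; lra.
have e3 : (H + T) * eta * n%:R <= eps / 4 * n%:R.
  by rewrite ler_wpM2r// (le_trans _ etaH)// [leRHS]mulrDl lerDl mul1r ltW.
have e4 : (H + T) * (be * n%:R) = H * x * n%:R + T * x * n%:R + (H + T) * eta * n%:R.
  by rewrite /be; ring.
lra.
Unshelve. all: by end_near. Qed.

End WindowMixtures.

(** * Renormalisation of the frequency measure *)

Lemma occ_cat (A : eqType) (u x y : seq A) : occ u (x ++ y) =
  (\sum_(i < size x) prefix u (drop i (x ++ y)) + occ u y)%N.
Proof.
elim: x => [|a x IH]; first by rewrite big_ord0.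
by rewrite cat_cons occ_cons IH big_ord_recl /= addnA.
Qed.

Lemma prefix_take_eq (A : eqType) (u x : seq A) : prefix u x = (take (size u) x == u).
Proof. by rewrite prefixE. Qed.

Lemma occ_eq0 (A : eqType) (u v : seq A) : ~~ infix u v -> occ u v = 0%N.
Proof.
move=> nuv; rewrite /occ; apply/eqP; rewrite -leqn0 leqNgt -has_count.
apply: contra nuv => /hasP[i _ uv].
exact: infix_trans (prefixW uv) (infix_drop _ _).
Qed.

Section Renormalisation.
Context {R : realType} {A : finType} (theta : random_substitution R A).
Variables (lam : R) (r : A -> R).
Hypotheses (compat : subst_compatible theta) (prim : subst_primitive theta).
Hypotheses (lam_perron : is_perron_eigenvalue (subst_matrix theta) lam).
Hypotheses (r_perron : is_right_perron_vector theta lam r).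
Implicit Types (u v w : seq A).

Local Notation isize := (iter_size theta).

(* Expected number of occurrences of u in theta^k(v) that start in the image of
   the first letter of v. *)
Definition first_windows k v u : R :=
  \sum_(i < isize k (take 1 v)) window_prob theta k v i (size u) u.

(** By [wide], an occurrence that starts in the image of c is already decided by the image of the
    first m letters. *)
Lemma iter_E_occ_cons k m u c w : wide theta k m (size u) -> legal theta (c :: w) ->
  (0 < m <= size (c :: w))%N ->
  iter_E theta k (c :: w) (fun z => (occ u z)%:R) =
  first_windows k (take m (c :: w)) u + iter_E theta k w (fun z => (occ u z)%:R).
Proof.
move=> wmu lcw /andP[m0 mw]; set v := take m (c :: w).
have v1 : take 1 v = [:: c] by rewrite /v; case: (m) m0 => //= m' _; rewrite take0.
have lv : legal theta v by exact: legal_infix (infix_take _ _) lcw.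
have sv : size v = m by rewrite size_takel.
transitivity (iter_E theta k (c :: w) (fun z =>
    \sum_(i < isize k [:: c]) (take (size u) (drop i z) == u)%:R) +
    iter_E theta k w (fun z => (occ u z)%:R)).
  rewrite -(cat1s c w) !iter_E_cat.
  transitivity (iter_E theta k [:: c] (fun x => iter_E theta k w (fun y =>
      \sum_(i < isize k [:: c]) (take (size u) (drop i (x ++ y)) == u)%:R) +
      iter_E theta k w (fun z => (occ u z)%:R))).
    apply: eq_iter_E => x xc; rewrite -iter_ED; apply: eq_iter_E => y _.
    rewrite occ_cat natrD natr_sum (mem_iter_size compat xc); congr (_ + _).
    by apply: eq_bigr => i _; rewrite prefix_take_eq.
  by rewrite iter_ED iter_E_cst.
congr (_ + _); rewrite /first_windows v1 -(cat_take_drop m (c :: w)) -/v.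
rewrite -iter_E_sum iter_E_cat; apply: eq_iter_E => x xv.
rewrite -[RHS](iter_E_cst theta k (drop m (c :: w))); apply: eq_iter_E => y _.
apply: eq_bigr => i _; congr ((_ == _)%:R).
have iu : (i + size u <= size x)%N.
  rewrite (mem_iter_size compat xv); apply: wide_window wmu lv sv _.
  by rewrite v1.
rewrite drop_cat; case: ltnP => [ix|xi].
  by rewrite takel_cat// size_drop leq_subRL ?(leq_trans (leq_addr _ _) iu).
(* A start at or beyond the end of x is only possible for the empty word. *)
have -> : size u = 0%N; last by rewrite !take0.
by apply/eqP; rewrite -leqn0 -(leq_add2l i) addn0 (leq_trans iu).
Qed.

(** Letters are peeled off until fewer than m remain. The image of this rest has at most m *
    [image_bound k] letters, and the additional unit is the occurrence of the empty word at the very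
    end. *)
Lemma iter_E_occ k m u w : wide theta k m (size u) -> (0 < m)%N -> legal theta w ->
  `|iter_E theta k w (fun z => (occ u z)%:R) -
    \sum_(v : m.-tuple A) (occ v w)%:R * first_windows k v u| <=
  (m * image_bound theta k).+1%:R.
Proof.
move=> wmu m0; elim: w => [|c w IH] lw.
  rewrite big1 ?subr0 => [|v _]; last first.
    by rewrite occ_eq0 ?mul0r//; apply/negP => /size_infix; rewrite size_tuple leqNgt m0.
  have E0 z : z \in subst_iter theta k [::] -> z = [::].
    by move=> /(mem_iter_size compat); rewrite iter_size_nil => /size0nil.
  rewrite ger0_norm; last by apply: iter_E_ge0 => z _; exact: ler0n.
  rewrite -[leRHS](iter_E_cst theta k [::]); apply: ler_iter_E => z /E0 ->.
  by rewrite ler_nat occ_nil; case: eqP.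
have [mw|mw] := leqP m (size (c :: w)); last first.
  rewrite big1 ?subr0 => [|v _]; last first.
    by rewrite occ_eq0 ?mul0r//; apply/negP => /size_infix; rewrite size_tuple leqNgt mw.
  rewrite ger0_norm; last by apply: iter_E_ge0 => z _; exact: ler0n.
  rewrite -[leRHS](iter_E_cst theta k (c :: w)); apply: ler_iter_E => z zk.
  rewrite ler_nat (leq_trans (occ_leq_size _ _))// ltnS (mem_iter_size compat zk).
  by rewrite (leq_trans (iter_size_le_bound _ _ _))// leq_mul2r ltnW ?orbT.
have lw' : legal theta w.
  exact: legal_infix (infix_cons _ _) lw.
rewrite (iter_E_occ_cons wmu lw) ?m0//.
have sm : size (take m (c :: w)) == m by rewrite size_takel.
have -> : \sum_(v : m.-tuple A) (occ v (c :: w))%:R * first_windows k v u =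
    first_windows k (take m (c :: w)) u +
    \sum_(v : m.-tuple A) (occ v w)%:R * first_windows k v u.
  have [cw cwE] : exists cw, cw = c :: w by exists (c :: w).
  have ocw v : occ v (c :: w) = (prefix v cw + occ v w)%N by rewrite occ_cons cwE.
  under eq_bigr do rewrite ocw natrD mulrDl.
  rewrite big_split/=; congr (_ + _); move: sm; rewrite -cwE => sm.
  rewrite (bigD1 (Tuple sm))//= prefix_take mul1r big1 ?addr0// => v.
  rewrite -val_eqE prefix_take_eq size_tuple /= eq_sym => /negPf ->.
  by rewrite mul0r.
by rewrite opprD addrACA subrr add0r IH.
Qed.

Section Frequency.
Variables (a : A) (p : seq A -> R).
Hypothesis p_freq : forall v, legal theta v ->
  (fun K => subst_iter_mean theta K [:: a] (occ v) /
            subst_iter_mean theta K [:: a] size) @ \oo --> p v.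
Hypothesis p_illegal : forall v, ~ legal theta v -> p v = 0.

Let freq K v := iter_E theta K [:: a] (fun z => (occ v z)%:R) / (isize K [:: a])%:R.

Let freq_cvg v : freq K v @[K --> \oo] --> p v.
Proof.
have sE K : subst_iter_mean theta K [:: a] size = (isize K [:: a])%:R :> R.
  rewrite -[RHS](iter_E_cst theta K [:: a]) subst_iter_meanE; apply: eq_iter_E => z zK.
  by rewrite (mem_iter_size compat zK).
have [lv|nlv] := pselect (legal theta v).
  rewrite (_ : freq^~ v = fun K => subst_iter_mean theta K [:: a] (occ v) /
            subst_iter_mean theta K [:: a] size); first exact: p_freq.
  by apply/funext => K; rewrite sE subst_iter_meanE.
rewrite p_illegal// (_ : freq^~ v = fun=> 0); first exact: cvg_cst.
apply/funext => K; rewrite /freq (@eq_iter_E _ _ _ _ _ _ (fun=> 0)) ?iter_E_cst ?mul0r//.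
move=> z zK; rewrite occ_eq0//; apply/negP => vz; apply: nlv.
by exists K, a, z.
Qed.

Let isize_inv_cvg : (isize K [:: a])%:R^-1 @[K --> \oo] --> (0 : R).
Proof.
apply/cvgrPdist_lt => e e0.
have [J JP] := iter_size_unbounded compat prim lam_perron r_perron (Num.truncn e^-1).+1.
exists J => // K /= /(JP _ a) eK; rewrite sub0r normrN ger0_norm ?invr_ge0//.
have s0 : 0 < (isize K [:: a])%:R :> R by rewrite ltr0n (leq_trans _ eK).
rewrite invf_plt ?posrE// (lt_le_trans (truncnS_gt _))//.
by rewrite ler_nat.
Qed.

Let iter_legal K z : z \in subst_iter theta K [:: a] -> legal theta z.
Proof. by move=> zK; exists K, a, z; split=> //; exact: infix_refl. Qed.

(** The length of theta^k(z) is a weighted letter count of z, whose mean per letter is lam^k by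
    [iter_size_perron]. *)
Let isize_ratio_cvg k :
  (isize (K + k) [:: a])%:R / (isize K [:: a])%:R @[K --> \oo] --> (lam ^+ k : R).
Proof.
apply/cvgrPdist_le => e e0.
have [C C0 CP] := weighted_frequency compat prim lam_perron r_perron
  (fun b => (isize k [:: b])%:R) (divr_gt0 e0 (ltr0n R 2)).
have C1 : 0 < e / 2 / (C + 1) by rewrite !divr_gt0// ltr_wpDl.
have /cvgrPdist_le/(_ _ C1) := isize_inv_cvg.
apply: filterS => K; rewrite sub0r normrN ger0_norm ?invr_ge0// => sK.
have s0 : 0 < (isize K [:: a])%:R :> R.
  by rewrite ltr0n (leq_trans _ (iter_size_ge _ _ _)).
have [z zK] := iter_neq0 theta K [:: a].
have := CP _ (iter_legal zK); rewrite (iter_size_perron compat r_perron).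
rewrite (iter_size_add compat _ zK) iter_size_letters natr_sum -(mem_iter_size compat zK).
under [in X in _ -> X]eq_bigr do rewrite natrM.
set S := \sum_b _; rewrite -(mem_iter_size compat zK) in s0 sK.
move=> H; rewrite distrC -(ler_pM2r s0) -[X in _ * X](gtr0_norm s0) -normrM mulrBl divfK ?gt_eqF//.
rewrite (le_trans H)//; suff : C <= e / 2 * (size z)%:R by lra.
rewrite -ler_pdivrMr//.
have := ler_wpM2l C0 sK; move/le_trans; apply.
rewrite mulrCA ler_piMr ?divr_ge0 ?(ltW e0)//.
by rewrite ler_pdivrMr ?ltr_wpDl// mul1r lerDl.
Qed.

(** Occurrences of u in theta^(K+k)(a) are counted through the words v of length m in theta^K(a).
    The error is bounded uniformly in K and disappears after division by the length of theta^K(a);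
    the factor lam^-k is the limiting ratio of lengths. *)
Lemma frequency_renormalise k m u : wide theta k m (size u) -> (0 < m)%N ->
  p u = (lam ^+ k)^-1 * \sum_(v : m.-tuple A) first_windows k v u * p v.
Proof.
move=> wmu m0; set C : R := (m * image_bound theta k).+1%:R.
have lam0 : 0 < lam by apply: lt_trans (lam_gt1 prim lam_perron); rewrite ltr01.
set S := fun K => \sum_(v : m.-tuple A) first_windows k v u * freq K v.
have s0 K : 0 < (isize K [:: a])%:R :> R.
  by rewrite ltr0n (leq_trans _ (iter_size_ge _ _ _)).
have close K : `|freq (K + k)%N u * ((isize (K + k) [:: a])%:R / (isize K [:: a])%:R) - S K|
    <= C * (isize K [:: a])%:R^-1.
  have -> : freq (K + k)%N u * ((isize (K + k) [:: a])%:R / (isize K [:: a])%:R) - S K =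
      (iter_E theta K [:: a] (fun z => iter_E theta k z (fun z => (occ u z)%:R) -
         \sum_(v : m.-tuple A) (occ v z)%:R * first_windows k v u)) /
      (isize K [:: a])%:R.
    rewrite /freq mulrA divfK ?gt_eqF// iter_E_add.
    rewrite (iter_ED _ _ _ _ (fun z => - _)) mulrDl; congr (_ + _).
    rewrite -[X in X / _](@eq_iter_E _ _ _ _ _ (fun z =>
       -1 * \sum_(v : m.-tuple A) (occ v z)%:R * first_windows k v u)); last first.
      by move=> z _; rewrite mulN1r.
    rewrite iter_EZ mulN1r mulNr; congr (- _); rewrite iter_E_sum mulr_suml /S.
    apply: eq_bigr => v _; rewrite /freq [LHS]mulrA -[in LHS]iter_EZ; congr (_ * _).
    by apply: eq_iter_E => z _; rewrite mulrC.
  rewrite normrM (ger0_norm (x := _^-1)) ?invr_ge0// ler_wpM2r ?invr_ge0//.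
  rewrite ler_norml -[- C](iter_E_cst theta K [:: a]) -[X in _ && (_ <= X)](iter_E_cst theta K [:: a]).
  by apply/andP; split; apply: ler_iter_E => z /iter_legal lz;
    have := iter_E_occ wmu m0 lz; rewrite ler_norml => /andP[].
have c1 : freq (K + k)%N u * ((isize (K + k) [:: a])%:R / (isize K [:: a])%:R) @[K --> \oo]
    --> p u * lam ^+ k.
  apply: cvgM; last exact: isize_ratio_cvg.
  by rewrite (cvg_shiftn k (freq^~ u)).
have c2 : S K @[K --> \oo] --> \sum_(v : m.-tuple A) first_windows k v u * p v.
  by apply: cvg_big => [|v _]; [exact: add_continuous|]; apply: cvgM; [exact: cvg_cst|exact: freq_cvg].
have c3 : C * (isize K [:: a])%:R^-1 @[K --> \oo] --> (0 : R).
  by rewrite -(mulr0 C); apply: cvgM; [exact: cvg_cst|exact: isize_inv_cvg].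
have /(cvg_unique (@Rhausdorff R) (cvgB c1 c2)) : (freq (K + k)%N u *
    ((isize (K + k) [:: a])%:R / (isize K [:: a])%:R) - S K) @[K --> \oo] --> (0 : R).
  by apply/norm_cvg0P; apply: squeeze_cvgr (cvg_cst 0) c3; near=> K; rewrite normr_ge0 close.
move/eqP; rewrite subr_eq0 => /eqP <-.
by rewrite mulrC mulfK// gt_eqF// exprn_gt0.
Unshelve. all: by end_near. Qed.

Lemma frequency_window_mixture k m n : (forall v, 0 <= p v) ->
  \sum_(t : n.-tuple A) p t = 1 -> (0 < m)%N -> wide theta k m n ->
  window_mixture theta k m (fun t : n.-tuple A => p t).
Proof.
move=> p0 p1 m0 wmn.
have lam0 : 0 < lam by apply: lt_trans (lam_gt1 prim lam_perron); rewrite ltr01.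
pose W (j : m.-tuple A * 'I_(image_bound theta k)) :=
  if (j.2 < isize k (take 1 j.1))%N then (lam ^+ k)^-1 * p j.1 else 0.
have W0 j : 0 <= W j.
  by rewrite /W; case: ifP => // _; rewrite mulr_ge0// invr_ge0 exprn_ge0// ltW.
have Wv j : 0 < W j -> valid_window j.
  rewrite /W /valid_window; case: ifP => [jj|]; last by rewrite ltxx.
  move=> pj; split=> //; apply: contrapT => nl; move: pj.
  by rewrite (p_illegal nl) mulr0 ltxx.
have pE (t : n.-tuple A) : p t = \sum_j W j * window_prob theta k j.1 j.2 n t.
  rewrite (@frequency_renormalise k m) ?size_tuple// mulr_sumr.
  rewrite -(pair_big xpredT xpredT (fun (v : m.-tuple A) i => W (v, i) * window_prob theta k v i n t))/=.
  apply: eq_bigr => v _; rewrite mulrCA mulrC /first_windows size_tuple.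
  rewrite (big_ord_widen _ (fun i => window_prob theta k v i n t) (iter_size_take1 theta k v)).
  rewrite mulr_sumr big_mkcond/=; apply: eq_bigr => i _.
  by rewrite /W /=; case: ifP => // _; rewrite mul0r.
exists W; split=> //.
(* The total weight follows by summing the representation over t: both p and each valid window law
   have mass 1. *)
rewrite -p1; under [RHS]eq_bigr do rewrite pE.
rewrite exchange_big/=; apply: eq_bigr => j _; rewrite -mulr_sumr.
have := W0 j; rewrite le_eqVlt => /predU1P[<-|/Wv[lj jj]]; first by rewrite mul0r.
rewrite (window_law compat _).2 ?mulr1//.
exact: wide_window (size_tuple _) jj.
Qed.

End Frequency.

(** The topological counterpart of [frequency_renormalise]: every legal word is a window that starts
    in the image of the first letter of a legal word of length m. *)
Lemma legal_window_iff k m n (t : n.-tuple A) : (0 < m)%N -> wide theta k m n ->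
  legal theta t <-> exists j : m.-tuple A * 'I_(image_bound theta k), valid_window j /\
    0 < window_prob theta k j.1 j.2 n t.
Proof.
move=> m0 wmn; split=> [lt|[j [[lj jj]]]]; last first.
  rewrite iter_E_gt0P => [[z zk]|z]; last exact: ler0n.
  rewrite ltr0n lt0b => /eqP <-; apply: legal_infix (legal_iter lj zk).
  by rewrite -{2}(cat_take_drop j.2 z) -{2}(cat_take_drop n (drop j.2 z)) infix_infix.
(* A right context longer than m * [image_bound k] cannot come from fewer than m letters. *)
have [w [x [y [lw xty Dy]]]] :=
  legal_extend compat prim lam_perron r_perron k (m * image_bound theta k).+1 lt.
have locate w' z pos : z \in subst_iter theta k w' -> (pos < size z)%N ->
    exists w1 c w2 z1 z2, [/\ w' = w1 ++ c :: w2, z = z1 ++ z2,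
      z2 \in subst_iter theta k (c :: w2) & (size z1 <= pos < size z1 + isize k [:: c])%N].
  elim: w' z pos => [|c w' IH] z pos.
    by move=> /(mem_iter_size compat); rewrite iter_size_nil => ->.
  rewrite -cat1s => /mem_iter_cat[x' [y' [x'c y'w ->]]].
  rewrite size_cat => pxy; have [px|xp] := ltnP pos (size x').
    exists [::], c, w', [::], (x' ++ y'); split=> //=.
      by rewrite -cat1s; apply/mem_iter_cat; exists x', y'.
    by rewrite add0n -(mem_iter_size compat x'c).
  have [|w1 [c' [w2 [z1 [z2 [-> -> z2k pz]]]]]] := IH y' (pos - size x')%N y'w.
    by rewrite ltn_subLR.
  exists (c :: w1), c', w2, (x' ++ z1), z2; split=> //; first by rewrite catA.
  by rewrite size_cat; move: pz xp; lia.
have [|w1 [c [w2 [z1 [z2 [wE zE z2k /andP[zx xz]]]]]]] := locate w _ (size x) xty.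
  rewrite !size_cat -[X in (X < _)%N]addn0 ltn_add2l addn_gt0.
  by rewrite (leq_ltn_trans _ Dy) ?orbT.
have mcw : (m <= size (c :: w2))%N.
  have L0 : (0 < image_bound theta k)%N.
    by rewrite (leq_trans _ (iter_size_image_bound theta k c))// (leq_trans _ (iter_size_ge _ _ _)).
  rewrite -(leq_pmul2r L0) (leq_trans _ (iter_size_le_bound theta k _))//.
  rewrite -(mem_iter_size compat z2k) -(leq_add2l (size z1)) -size_cat -zE !size_cat.
  by rewrite leq_add// (leq_trans (ltnW Dy))// leq_addl.
pose v := take m (c :: w2).
have sv : size v == m by rewrite size_takel.
have lv : legal theta v.
  apply: legal_infix lw; rewrite wE -(cat_take_drop m (c :: w2)); exact: infix_infix.
have v1 : take 1 v = [:: c] by rewrite /v; case: (m) m0 => //= m' _; rewrite take0.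
have ic : (size x - size z1 < isize k (take 1 v))%N by rewrite v1 ltn_subLR.
have iL : (size x - size z1 < image_bound theta k)%N.
  by rewrite (leq_trans ic)// iter_size_take1.
exists (Tuple sv, Ordinal iL); split=> //=.
have := z2k; rewrite -(cat_take_drop m (c :: w2)) -/v => /mem_iter_cat[x' [y' [x'v _ z2E]]].
apply/iter_E_gt0P => [z|]; first exact: ler0n.
exists x' => //; rewrite ltr0n lt0b; apply/eqP.
have iu : (size x - size z1 + n <= size x')%N.
  by rewrite (mem_iter_size compat x'v); apply: wide_window wmn lv (eqP sv) ic.
transitivity (take n (drop (size x) (x ++ t ++ y))); last first.
  by rewrite drop_size_cat// take_size_cat// size_tuple.
rewrite zE drop_cat ltnNge zx /= z2E drop_cat.
case: ltnP => [ix'|x'i]; first by rewrite takel_cat// size_drop leq_subRL ?(leq_trans (leq_addr _ _) iu).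
have -> : n = 0%N; last by rewrite !take0.
by apply/eqP; rewrite -leqn0 -(leq_add2l (size x - size z1)) addn0 (leq_trans iu).
Qed.

Lemma legal_word_exists (a : A) m : exists2 v, legal theta v & size v = m.
Proof.
have [J JP] := iter_size_unbounded compat prim lam_perron r_perron m.
have [z zJ] := iter_neq0 theta J [:: a].
exists (take m z); first by exists J, a, z; split=> //; exact: infix_take.
by rewrite size_takel// (mem_iter_size compat zJ) JP.
Qed.

(** For q = 0 only the support counts. Weights that are positive on all valid windows make it the
    set of all legal words. *)
Lemma uniform_window_mixture (a : A) k m n : (0 < m)%N -> wide theta k m n ->
  exists2 p, window_mixture theta k m p &
    renyi 0 (index_enum (n.-tuple A)) p = ln #|legal_words theta n|%:R.
Proof.
move=> m0 wmn.
pose Q (j : m.-tuple A * 'I_(image_bound theta k)) : bool := `[< valid_window j >].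
pose N := #|Q|.
have N0 : (0 < N)%N.
  have [v lv sv] := legal_word_exists a m.
  have i1 : (0 < isize k (take 1 v))%N.
    by case: v sv {lv} => [|c v] /= sv; [rewrite -sv in m0|rewrite take0 (leq_trans _ (iter_size_ge _ _ _))].
  have iL : (0 < image_bound theta k)%N by rewrite (leq_trans i1)// iter_size_take1.
  move/eqP: sv => sv; rewrite -/N; apply/card_gt0P; exists (Tuple sv, Ordinal iL).
  by rewrite unfold_in /Q; apply/asboolP.
pose W j : R := if Q j then N%:R^-1 else 0.
have W0 j : 0 <= W j by rewrite /W; case: ifP => // _; rewrite invr_ge0.
have Wv j : 0 < W j -> valid_window j.
  by rewrite /W; case: ifP => [/asboolP//|]; rewrite ltxx.
have W1 : \sum_j W j = 1.
  by rewrite -big_mkcond/= sumr_const -[LHS]mulr_natl mulfV// gt_eqF// ltr0n.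
pose p (t : n.-tuple A) := \sum_j W j * window_prob theta k j.1 j.2 n t.
exists p; first by exists W; split.
have p_gt0 t : (0 < p t) = (t \in legal_words theta n).
  rewrite inE; apply/idP/asboolP => [pt|/(legal_window_iff _ m0 wmn)[j [vj tj]]].
    apply/(legal_window_iff _ m0 wmn); apply: contrapT => /forallNP nt.
    move: pt; rewrite /p big1 ?ltxx// => j _.
    have := W0 j; rewrite le_eqVlt => /predU1P[<-|/Wv vj]; first by rewrite mul0r.
    have := window_prob_ge0 theta k j.1 j.2 n t; rewrite le_eqVlt => /predU1P[<-|tj].
      by rewrite mulr0.
    by case: (nt j).
  rewrite /p (bigD1 j)//= ltr_pwDl//; last first.
    by apply: sumr_ge0 => i _; rewrite mulr_ge0// window_prob_ge0.
  by rewrite mulr_gt0// /W ifT ?invr_gt0 ?ltr0n//; apply/asboolP.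
have pE t : pw 0 (p t) = (t \in legal_words theta n)%:R.
  rewrite -p_gt0; have p0 : 0 <= p t.
    by apply: sumr_ge0 => i _; rewrite mulr_ge0// window_prob_ge0.
  move: p0; rewrite le_eqVlt => /predU1P[<-|pt]; first by rewrite pw0 ltxx.
  by rewrite pwE// mul0r expR0 pt.
rewrite /renyi subr0 divr1; under eq_bigr do rewrite pE.
rewrite -sum1_card natr_sum [in RHS]big_mkcond; congr ln; apply: eq_bigr => t _.
by case: ifP.
Qed.

End Renormalisation.

(** * Entropy rates *)

(** Comparing the brackets of j and k at a common n gives rho_j <= rho_k + d_k. Hence l, the
    supremum of rho, lies in every bracket, and the brackets shrink. *)
Lemma bracketed_limit (R : realType) (x rho d : nat -> R) :
  d k @[k --> \oo] --> (0 : R) ->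
  (forall k e, 0 < e -> \forall n \near \oo, rho k - e <= x n <= rho k + d k + e) ->
  exists l, [/\ x n @[n --> \oo] --> l, rho k @[k --> \oo] --> l &
    forall k, rho k <= l <= rho k + d k].
Proof.
move=> d0 bd.
have rd j k : rho j <= rho k + d k.
  apply/ler_addgt0Pr => e e0; have e20 : 0 < e / 2 by rewrite divr_gt0.
  have [n [/andP[h1 _] /andP[_ h2]]] : exists n,
      rho j - e / 2 <= x n <= rho j + d j + e / 2 /\
      rho k - e / 2 <= x n <= rho k + d k + e / 2.
    have [N _ NP] := filterI (bd j _ e20) (bd k _ e20).
    by exists N; exact: NP (leqnn N).
  lra.
have sup_rho : has_sup (range rho).
  split; first by exists (rho 0%N), 0%N.
  by exists (rho 0%N + d 0%N) => _ [j _ <-]; exact: rd.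
pose l := sup (range rho).
have lbd k : rho k <= l <= rho k + d k.
  apply/andP; split; first by apply: (ub_le_sup sup_rho.2); exists k.
  by apply: ge_sup; [exact: sup_rho.1|move=> _ [j _ <-]; exact: rd].
exists l; split=> //.
- apply/cvgrPdist_le => e e0; have e20 : 0 < e / 2 by rewrite divr_gt0.
  have /cvgrPdist_le/(_ _ e20)[K _ KP] := d0.
  have := KP K (leqnn K); rewrite sub0r normrN => /ler_normlW dK.
  have := bd K _ e20; apply: filterS => n /andP[h1 h2].
  by have /andP[h3 h4] := lbd K; rewrite ler_norml; apply/andP; split; lra.
- apply/cvgrPdist_le => e e0; have /cvgrPdist_le/(_ _ e0) := d0.
  apply: filterS => k; rewrite sub0r normrN => /ler_normlW dk.
  by have /andP[h3 h4] := lbd k; rewrite ler_norml; apply/andP; split; lra.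
Qed.

Section EntropyLimits.
Context {R : realType} {A : finType} (theta : random_substitution R A).
Variables (lam : R) (r : A -> R).
Hypotheses (compat : subst_compatible theta) (prim : subst_primitive theta).
Hypotheses (lam_perron : is_perron_eigenvalue (subst_matrix theta) lam).
Hypotheses (r_perron : is_right_perron_vector theta lam r).
Variable (a0 : A).

Let gap k : R := ln #|A|%:R / lam ^+ k.

Let gap_cvg0 : gap k @[k --> \oo] --> (0 : R).
Proof.
rewrite -(mulr0 (ln #|A|%:R)); apply: cvgM; first exact: cvg_cst.
have l1 := lam_gt1 prim lam_perron; have l0 : 0 < lam by apply: lt_trans l1.
rewrite (_ : (fun k => (lam ^+ k)^-1) = (fun k => lam^-1 ^+ k)); last first.
  by apply/funext => k; rewrite exprVn.
by apply: cvg_expr; rewrite ger0_norm ?invr_ge0 ?(ltW l0)// invf_lt1.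
Qed.

Lemma window_mixture_bracket q (X : nat -> R) : 0 <= q -> q != 1 ->
  (forall k m n, (0 < m)%N -> wide theta k m n -> exists2 p, window_mixture theta k m p &
    renyi q (index_enum (n.-tuple A)) p = X n) ->
  forall k e, 0 < e -> \forall n \near \oo,
    mean_entropy theta lam r q k - e <= n%:R^-1 * X n <=
    mean_entropy theta lam r q k + gap k + e.
Proof.
move=> q0 q1 mix k e e0.
have := window_mixture_entropy compat prim lam_perron r_perron q0 q1 (mix k) e0.
apply: filterS2 (nbhs_infty_gt 0) => n n0.
have n0' : 0 < n%:R :> R by rewrite ltr0n.
by rewrite [n%:R^-1 * _]mulrC ler_pdivlMr// ler_pdivrMr.
Qed.

Lemma letter_entropy0 k a :
  letter_entropy theta 0 k a = ln (#|` subst_iter theta k [:: a]|)%:R.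
Proof.
rewrite /letter_entropy /renyi subr0 divr1; congr ln.
rewrite big_seq (eq_bigr (fun=> 1)) => [|w wk]; last first.
  by rewrite pwE -?mem_subst_iter// mul0r expR0.
by rewrite -big_seq big_const_seq count_predT iter_addr_0.
Qed.

Lemma topological_entropy_cvg :
  mean_entropy theta lam r 0 k @[k --> \oo] --> topological_entropy theta.
Proof.
have z1 : (0 : R) != 1 by rewrite eq_sym oner_eq0.
have [l [xl rl _]] := bracketed_limit gap_cvg0 (window_mixture_bracket (lexx 0) z1
  (fun k m n => @uniform_window_mixture _ _ _ _ _ compat prim lam_perron r_perron a0 k m n)).
suff -> : topological_entropy theta = l by [].
by apply: cvg_lim => //; exact: Rhausdorff.
Qed.

Variable p : seq A -> R.
Hypothesis p_freq : forall v, legal theta v ->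
  (fun K => subst_iter_mean theta K [:: a0] (occ v) /
            subst_iter_mean theta K [:: a0] size) @ \oo --> p v.
Hypothesis p_illegal : forall v, ~ legal theta v -> p v = 0.
Hypothesis p_law : forall n, law_on (index_enum (n.-tuple A)) (fun t : n.-tuple A => p t).
Hypothesis p_ge0 : forall v, 0 <= p v.

Definition word_renyi q n : R := renyi q (index_enum (n.-tuple A)) (fun t : n.-tuple A => p t).

Definition word_shannon n : R := shannon (index_enum (n.-tuple A)) (fun t : n.-tuple A => p t).

Lemma word_renyi_bracket q : 0 <= q -> q != 1 -> forall k e, 0 < e ->
  \forall n \near \oo, mean_entropy theta lam r q k - e <= n%:R^-1 * word_renyi q n <=
    mean_entropy theta lam r q k + gap k + e.
Proof.
move=> q0 q1; apply: window_mixture_bracket => // k m n m0 wmn.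
exists (fun t : n.-tuple A => p t) => //.
exact: (frequency_window_mixture compat prim lam_perron r_perron p_freq p_illegal
  p_ge0 (p_law n).2 m0 wmn).
Qed.

Definition renyi_rate q : R := limn (fun n => n%:R^-1 * word_renyi q n).

Lemma renyi_rateP q : 0 <= q -> q != 1 ->
  n%:R^-1 * word_renyi q n @[n --> \oo] --> renyi_rate q /\
  forall k, mean_entropy theta lam r q k <= renyi_rate q <=
    mean_entropy theta lam r q k + gap k.
Proof.
move=> q0 q1.
have [l [xl _ lb]] := bracketed_limit gap_cvg0 (word_renyi_bracket q0 q1).
by have -> : renyi_rate q = l by apply: cvg_lim => //; exact: Rhausdorff.
Qed.

Definition mean_shannon k : R := (lam ^+ k)^-1 *
  \sum_a r a * shannon (subst_iter theta k [:: a]) (subst_iter_prob theta k [:: a]).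

Lemma mean_entropy_cvg k :
  mean_entropy theta lam r (1 + h) k @[h --> (0 : R)^'] --> mean_shannon k.
Proof.
apply: cvgM; first exact: cvg_cst.
apply: cvg_big => [|a _]; first exact: add_continuous.
apply: cvgM; first exact: cvg_cst.
apply: renyi_cvg_shannon; exact: iter_prob_law.
Qed.

(** A single h serves both sides of 1, and h < 1 keeps the order 1 - h positive. *)
Lemma mean_entropy_near k e : 0 < e -> exists h, [/\ 0 < h, h < 1,
  `|mean_shannon k - mean_entropy theta lam r (1 + h) k| <= e &
  `|mean_shannon k - mean_entropy theta lam r (1 - h) k| <= e].
Proof.
move=> e0; have /cvgrPdist_le/(_ _ e0) := @mean_entropy_cvg k.
rewrite /dnbhs near_withinE => /nbhs_ballP[d /= d0 dP].
pose h := Num.min (d / 2) (1 / 2).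
have h0 : 0 < h by rewrite lt_min !divr_gt0.
have hd : h < d by rewrite gt_min ltr_pdivrMr// ltr_pMr// ltr1n.
exists h; split=> //.
- by rewrite gt_min [X in _ || X]ltr_pdivrMr// mul1r ltr1n orbT.
- by apply: dP; rewrite /ball /= ?sub0r ?normrN ?gtr0_norm// gt_eqF.
- by apply: dP; rewrite /ball /= ?sub0r ?opprK ?gtr0_norm// oppr_eq0 gt_eqF.
Qed.

(** The lower bound comes from the order 1 + h and the upper one from 1 - h, with h depending on k
    and e only. *)
Lemma word_shannon_bracket k e : 0 < e -> \forall n \near \oo,
  mean_shannon k - e <= n%:R^-1 * word_shannon n <= mean_shannon k + gap k + e.
Proof.
move=> e0; have e20 : 0 < e / 2 by rewrite divr_gt0.
have [h [h0 h1 hP hN]] := mean_entropy_near k e20.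
have q1 : 1 + h != 1 by rewrite gt_eqF// ltrDl.
have q2 : 1 - h != 1 by rewrite lt_eqF// gtrBl.
have q3 : 0 <= 1 + h by rewrite addr_ge0// ltW.
have q4 : 0 <= 1 - h by rewrite subr_ge0 ltW.
apply: filterS2 (word_renyi_bracket q3 q1 k e20) (word_renyi_bracket q4 q2 k e20).
move=> n /andP[n1 _] /andP[_ n2].
have s1 : n%:R^-1 * word_renyi (1 + h) n <= n%:R^-1 * word_shannon n.
  by rewrite ler_wpM2l ?invr_ge0//; apply: renyi_le_shannon (p_law n); rewrite ltrDl.
have s2 : n%:R^-1 * word_shannon n <= n%:R^-1 * word_renyi (1 - h) n.
  by rewrite ler_wpM2l ?invr_ge0//; apply: shannon_le_renyi (p_law n); rewrite gtrBl.
by move: hP hN; rewrite !ler_norml => /andP[? ?] /andP[? ?]; apply/andP; split; lra.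
Qed.

Definition entropy_rate : R := limn (fun n => n%:R^-1 * word_shannon n).

Lemma entropy_rateP :
  [/\ n%:R^-1 * word_shannon n @[n --> \oo] --> entropy_rate,
      mean_shannon k @[k --> \oo] --> entropy_rate &
      forall k, mean_shannon k <= entropy_rate <= mean_shannon k + gap k].
Proof.
have [l [xl rl lb]] := bracketed_limit gap_cvg0 word_shannon_bracket.
by have -> : entropy_rate = l by apply: cvg_lim => //; exact: Rhausdorff.
Qed.

(** The limits in h and k are exchanged thanks to the gap, which is the same for all orders: k is
    fixed with a small gap, and then the finite entropies at level k are continuous in h. *)
Lemma renyi_rate_cvg : renyi_rate (1 + h) @[h --> (0 : R)^'] --> entropy_rate.
Proof.
apply/cvgrPdist_le => e e0; have e20 : 0 < e / 2 by rewrite divr_gt0.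
have /cvgrPdist_le/(_ _ e20)[k _ kP] := gap_cvg0.
have := kP k (leqnn k); rewrite sub0r normrN => /ler_normlW gk.
have [_ _ /(_ k)/andP[e1 e2]] := entropy_rateP.
have /cvgrPdist_le/(_ _ e20) := @mean_entropy_cvg k.
move=> H; near=> h.
have h0 : h != 0 by near: h; exact: nbhs_dnbhs_neq.
have h1 : 0 <= 1 + h.
  suff : `|h| < 1 by rewrite ltr_norml => /andP[? ?]; lra.
  near: h; apply: dnbhs0_lt; exact: ltr01.
have q1 : 1 + h != 1 by rewrite -subr_eq0 addrC addKr.
have [_ /(_ k)/andP[r1 r2]] := renyi_rateP h1 q1.
have : `|mean_shannon k - mean_entropy theta lam r (1 + h) k| <= e / 2 by near: h.
by rewrite !ler_norml => /andP[? ?]; apply/andP; split; lra.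
Unshelve. all: by end_near. Qed.

(** Chernoff bound: on heavy words p is at most p^(1+h) e^(h n s), and the sum of p^(1+h) is e^(-h
    H) with H >= (s + e) n. *)
Lemma heavy_words_mass s : s < entropy_rate -> exists2 eta, 0 < eta &
  \forall n \near \oo,
    \sum_(t : n.-tuple A | expR (- (n%:R * s)) <= p t) p t <= expR (- (eta * n%:R)).
Proof.
(* Three quarters of the distance pay for the limit in k, the choice of h and the bracket in n; the
   last one is the exponent gained. *)
move=> sl; pose e := (entropy_rate - s) / 4.
have e0 : 0 < e by rewrite divr_gt0// subr_gt0.
have [_ /cvgrPdist_le/(_ _ e0)[k _ /(_ k (leqnn k))/= kP] _] := entropy_rateP.
have [h [h0 h1 hP _]] := mean_entropy_near k e0.
have q1 : 1 + h != 1 by rewrite gt_eqF// ltrDl.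
have q0 : 0 <= 1 + h by rewrite addr_ge0// ltW.
exists (h * e); first exact: mulr_gt0.
apply: filterS2 (word_renyi_bracket q0 q1 k e0) (nbhs_infty_gt 0) => n /andP[n1 _] n0.
have n0' : 0 < n%:R :> R by rewrite ltr0n.
have {}n1 : (s + e) * n%:R <= word_renyi (1 + h) n.
  rewrite -ler_pdivlMr// mulrC (le_trans _ n1)//.
  move: kP hP; rewrite !ler_norml => /andP[_ kP] /andP[_ hP].
  by move: e0; rewrite /e in kP hP *; lra.
have Z0 := pw_sum_gt0 (1 + h) (p_law n).
have Zle : \sum_(t : n.-tuple A) pw (1 + h) (p t) <= expR (- (h * ((s + e) * n%:R))).
  rewrite -[leLHS]lnK ?posrE// ler_expR.
  have := n1; rewrite /word_renyi /renyi opprD addNKr invrN mulrN lerNr.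
  by rewrite ler_pdivrMr// mulNr mulrC.
apply: (@le_trans _ _ (\sum_(t : n.-tuple A) pw (1 + h) (p t) * expR (h * (n%:R * s)))).
  rewrite big_mkcond/= ler_sum// => t _; case: ifP => [pt|_]; last first.
    by rewrite mulr_ge0 ?pw_ge0 ?expR_ge0.
  have pt0 : 0 < p t by apply: lt_le_trans pt; exact: expR_gt0.
  rewrite pwE// -expRD -[leLHS]lnK ?posrE// ler_expR.
  have : - (n%:R * s) <= ln (p t) by rewrite -ler_expR lnK.
  by move/(ler_wpM2l (ltW h0)); lra.
rewrite -mulr_suml (le_trans (ler_wpM2r (expR_ge0 _) Zle))// -expRD ler_expR.
by rewrite le_eqVlt; apply/orP; left; apply/eqP; ring.
Qed.

(** The same bound with the order 1 - h. Here the upper end of the bracket is used, so k must also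
    make the gap small. *)
Lemma light_words_mass s : entropy_rate < s -> exists2 eta, 0 < eta &
  \forall n \near \oo,
    \sum_(t : n.-tuple A | p t <= expR (- (n%:R * s))) p t <= expR (- (eta * n%:R)).
Proof.
move=> sl; pose e := (s - entropy_rate) / 4.
have e0 : 0 < e by rewrite divr_gt0// subr_gt0.
have [_ /cvgrPdist_le/(_ _ e0)[k1 _ k1P] rl] := entropy_rateP.
have /cvgrPdist_le/(_ _ e0)[k2 _ k2P] := gap_cvg0.
pose k := maxn k1 k2.
have /= kP := k1P k (leq_maxl _ _); have /= gP := k2P k (leq_maxr _ _).
have [h [h0 h1 _ hP]] := mean_entropy_near k e0.
have q1 : 1 - h != 1 by rewrite lt_eqF// gtrBl.
have q0 : 0 <= 1 - h by rewrite subr_ge0 ltW.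
have e40 : 0 < e / 4 by rewrite divr_gt0.
exists (h * (e / 2)); first by rewrite mulr_gt0// divr_gt0.
apply: filterS2 (word_renyi_bracket q0 q1 k e40) (nbhs_infty_gt 0) => n /andP[_ n1] n0.
have n0' : 0 < n%:R :> R by rewrite ltr0n.
have {}n1 : word_renyi (1 - h) n <= (s - e / 2) * n%:R.
  rewrite -ler_pdivrMr// mulrC (le_trans n1)//.
  move: kP hP gP; rewrite sub0r normrN !ler_norml => /andP[kP _] /andP[hP _] /andP[_ gP].
  by move: e0; rewrite /e in kP hP gP *; lra.
have Z0 := pw_sum_gt0 (1 - h) (p_law n).
have Zle : \sum_(t : n.-tuple A) pw (1 - h) (p t) <= expR (h * ((s - e / 2) * n%:R)).
  rewrite -[leLHS]lnK ?posrE// ler_expR.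
  have := n1; rewrite /word_renyi /renyi (_ : 1 - (1 - h) = h); last by ring.
  by rewrite ler_pdivrMr// mulrC.
apply: (@le_trans _ _ (\sum_(t : n.-tuple A) pw (1 - h) (p t) * expR (- (h * (n%:R * s))))).
  rewrite big_mkcond/= ler_sum// => t _; case: ifP => [pt|_]; last first.
    by rewrite mulr_ge0 ?pw_ge0 ?expR_ge0.
  have := p_ge0 t; rewrite le_eqVlt => /predU1P[<-|pt0]; first by rewrite pw0 mul0r.
  rewrite pwE// -expRD -[leLHS]lnK ?posrE// ler_expR.
  have : ln (p t) <= - (n%:R * s) by rewrite -ler_expR lnK.
  by move/(ler_wpM2l (ltW h0)); lra.
rewrite -mulr_suml (le_trans (ler_wpM2r (expR_ge0 _) Zle))// -expRD ler_expR.
by rewrite le_eqVlt; apply/orP; left; apply/eqP; ring.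
Qed.

End EntropyLimits.

(** * Cylinders of the full shift *)

Section FullShift.
Context {R : realType} {A : alphabetType}.
Local Notation X := (fullshift R A).
Implicit Types (x y : X).

(** Two points are within [scale N] exactly when they share the central word of length n = 2 N + 1,
    and [scale N] is e^(-n). Masses e^(-n s) of central cylinders are thus the powers s of this
    scale. *)
Definition scale (N : nat) : R := expR (- 2 * N%:R - 1).

Lemma mdist_le_scale x y N :
  mdist x y <= scale N <-> (forall j : int, `|j| <= N%:Z -> x j = y j).
Proof.
have -> : mdist x y = fullshift_dist x y by [].
rewrite /fullshift_dist /scale; have [->|/eqP xy] := eqVneq x y.
  by split=> // _; exact: expR_ge0.
rewrite ler_expR lerD2r !mulNr lerN2 ler_pM2l//; split=> [NA j jN|xyN].
  (* The agreement set consists of integers, so an element within 1 of a supremum that is at least N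
     is itself at least N. *)
  have [_ [n xyn <-] An] := sup_adherent ltr01 (agreement_has_sup xy).
  apply: xyn; rewrite (le_trans jN)// -ltzD1 -(ltr_int R) intrD.
  by rewrite -/(agreement x y) in An; move: NA An; rewrite -[N%:~R]/(N%:R); lra.
by apply: (ub_le_sup (agreement_has_sup xy).2); exists N%:Z.
Qed.

Lemma size_window x i n : size (window x i n) = n.
Proof. exact: size_mkseq. Qed.

Lemma eq_window x y i j n : (forall k : nat, (k < n)%N -> x (i + k%:Z) = y (j + k%:Z)) ->
  window x i n = window y j n.
Proof. by move=> xy; apply/eq_in_map => k; rewrite mem_iota => /xy. Qed.

Definition central x N : seq A := window x (- N%:Z) N.*2.+1.

Lemma size_central x N : size (central x N) = N.*2.+1.
Proof. exact: size_window. Qed.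

Lemma eq_centralP x y N :
  central x N = central y N <-> (forall j : int, `|j| <= N%:Z -> x j = y j).
Proof.
split=> [xyN j jN|xyN].
  have jE : j = - N%:Z + (absz (j + N%:Z))%:Z by lia.
  have jn : (absz (j + N%:Z)%R < N.*2.+1)%N by lia.
  have : nth (x 0) (central x N) (absz (j + N%:Z)) = nth (x 0) (central y N) (absz (j + N%:Z)).
    by rewrite xyN.
  by rewrite !nth_mkseq// -jE.
apply: eq_window => k kN; apply: xyN; lia.
Qed.

Lemma open_window (Q : seq A -> Prop) i n : open [set x : X | Q (window x i n)].
Proof.
rewrite openE => x /= Qx; apply/nbhs_ballP; exists (scale (`|i| + n)%N).
  exact: expR_gt0.
move=> y; rewrite ballEmdist /= => /ltW/mdist_le_scale xy.
rewrite (_ : window y i n = window x i n)//.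
by apply: eq_window => k kn; apply/esym/xy; lia.
Qed.

Lemma measurable_window (Q : seq A -> Prop) i n :
  measurable ([set x : X | Q (window x i n)] : set (borelType X)).
Proof. by apply: sub_sigma_algebra; exact: open_window. Qed.

Lemma measurable_subshift (theta : random_substitution R A) :
  measurable (subshift theta : set (borelType X)).
Proof.
rewrite -[X in measurable X]setCK; apply: measurableC; apply: sub_sigma_algebra.
rewrite (_ : ~` subshift theta =
  \bigcup_(p in [set: int * nat]) [set x : X | ~ legal theta (window x p.1 p.2)]).
  by apply: bigcup_open => p _; exact: (@open_window (fun w => ~ legal theta w) p.1 p.2).
apply/seteqP; split=> [x /existsNP[i /existsNP[n nl]]|x [[i n] _ nl] lx].
  by exists (i, n).
exact: nl (lx i n).
Qed.

Lemma window_shift x i n : window (Defs.shift x) i n = window x (i + 1) n.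
Proof. by apply: eq_window => k _; rewrite /Defs.shift addrAC. Qed.

End FullShift.

Lemma nneseries_le_bound (R : realType) (u : nat -> \bar R) (K : \bar R) N :
  (forall n, 0 <= u n)%E -> (forall k, \sum_(N <= n < k) u n <= K)%E ->
  (\sum_(N <= n <oo) u n <= K)%E.
Proof.
move=> u0 uK; apply: lime_le; first by apply: is_cvg_nneseries => n _ _; exact: u0.
by near=> k; exact: uK.
Unshelve. all: by end_near. Qed.

Lemma sum_geometric_le (R : realType) (z : R) N k : 0 <= z < 1 ->
  \sum_(N <= n < k) z ^+ n <= z ^+ N / (1 - z).
Proof.
move=> /andP[z0 z1]; have z1' : 0 < 1 - z by rewrite subr_gt0.
have [kN|Nk] := leqP k N; first by rewrite big_geq// divr_ge0 ?exprn_ge0// ltW.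
suff -> : \sum_(N <= n < k) z ^+ n = (z ^+ N - z ^+ k) / (1 - z).
  by rewrite ler_pM2r ?invr_gt0// gerBl exprn_ge0.
apply: (mulIf (x := 1 - z)); first by rewrite gt_eqF.
rewrite divfK ?gt_eqF// mulr_suml.
under eq_bigr do rewrite mulrBr mulr1 -exprSr.
by rewrite -opprB -telescope_sumr ?(ltnW Nk)// -sumrN; apply: eq_bigr => n _; rewrite opprB.
Qed.

Section FrequencyMeasure.
Context {R : realType} {A : alphabetType} (theta : random_substitution R A).
Local Notation X := (fullshift R A).
Variable mu : probability (borelType X) R.
Hypothesis mu_freq : is_frequency_measure theta mu.

Definition word_freq (v : seq A) : R := fine (mu (cylinder theta v)).

Definition windowset (v : seq A) i : set (borelType X) := [set x | window x i (size v) = v].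

Let mwin v i : measurable (windowset v i).
Proof. exact: (measurable_window (fun w => w = v)). Qed.

(** Shift invariance frees the position, and restricting to the subshift changes nothing as its
    complement is null. *)
Lemma mu_windowset v i : mu (windowset v i) = (word_freq v)%:E.
Proof.
have [muX inv _] := mu_freq.
have step j : mu (windowset v (j + 1)) = mu (windowset v j).
  rewrite -[RHS]inv//; congr (mu _); apply/seteqP.
  by split=> x; rewrite /windowset /= window_shift.
have base j : mu (windowset v j) = mu (windowset v 0).
  elim/int_rect: j => // n IH; first by rewrite -addn1 PoszD step.
  by rewrite -IH -step; congr (mu (windowset v _)); lia.
have mX : measurable (subshift theta : set (borelType X)) by exact: measurable_subshift.
have muXC : mu (~` subshift theta) = 0%E by rewrite probability_setC// muX subee.
rewrite base -(base 1) /word_freq fineK.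
  have -> : cylinder theta v = windowset v 1 `&` subshift theta.
    by apply/seteqP; split=> x [].
  have D0 : mu (windowset v 1 `\` (subshift theta : set (borelType X))) = 0%E.
    apply/eqP; rewrite eq_le measure_ge0 andbT -muXC le_measure ?inE//.
    - exact: measurableD.
    - exact: measurableC.
  rewrite (measureDI mu (mwin v 1) mX) -[RHS]add0e; congr (_ + _)%E; exact: D0.
apply: fin_num_measure; rewrite (_ : cylinder theta v = subshift theta `&` windowset v 1)//.
exact: measurableI.
Qed.

Lemma word_freq_ge0 v : 0 <= word_freq v.
Proof. exact: fine_ge0. Qed.

Lemma word_freq_illegal v : ~ legal theta v -> word_freq v = 0.
Proof.
move=> nl; rewrite /word_freq (_ : cylinder theta v = set0) ?measure0//.
apply/seteqP; split=> x // [lx vx]; apply: nl; rewrite -vx; exact: lx.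
Qed.

Lemma mu_window (Q : pred (seq A)) i n :
  mu [set x : X | Q (window x i n)] = (\sum_(t : n.-tuple A | Q t) word_freq t)%:E.
Proof.
pose F (t : n.-tuple A) : set (borelType X) := if Q t then windowset t i else set0.
have mF t : measurable (F t) by rewrite /F; case: ifP.
transitivity (mu (\bigcup_(t in [set: n.-tuple A]) F t)).
  congr (mu _); apply/seteqP; split=> [x /= Qx|x [t _]].
    have sx : size (window (x : X) i n) == n by apply/eqP; exact: size_window.
    by exists (Tuple sx) => //; rewrite /F /= Qx /windowset /= (eqP sx).
  rewrite /F; case: ifP => // Qt; rewrite /windowset /= size_tuple => ->.
  by [].
rewrite measure_fin_bigcup//.
- have -> : [set: n.-tuple A] = [set` (xpredT : pred (n.-tuple A))] by apply/seteqP; split.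
  rewrite -(bigfs _ (r := index_enum (n.-tuple A))) ?index_enum_uniq// => [|t _]; last by rewrite mem_index_enum.
  rewrite [in RHS]big_mkcond/= -sumEFin; apply: eq_bigr => t _.
  by rewrite /F; case: ifP => _; rewrite ?measure0// mu_windowset.
- exact: finite_finset.
- move=> t t' _ _ [x []]; rewrite /F; case: ifP => // _; case: ifP => // _.
  have wE (t0 : n.-tuple A) : windowset t0 i x -> window (x : X) i n = t0.
    by rewrite /windowset /= size_tuple.
  by move=> /wE tx /wE t'x; apply/val_inj; rewrite /= -tx -t'x.
Qed.

Lemma word_freq_law n : law_on (index_enum (n.-tuple A)) (fun t : n.-tuple A => word_freq t).
Proof.
split=> [t|]; first exact: word_freq_ge0.
have := mu_window xpredT 0 n; rewrite (_ : [set x | _] = setT).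
  by rewrite probability_setT => -[].
by apply/seteqP; split.
Qed.

Lemma word_freq_cvg v : legal theta v ->
  (fun K => subst_iter_mean theta K [:: point] (occ v) /
            subst_iter_mean theta K [:: point] size) @ \oo --> word_freq v.
Proof. by have [_ _ mu_cvg] := mu_freq; exact: mu_cvg. Qed.

(** A quantitative Borel-Cantelli lemma: the masses are dominated by the tail of a geometric
    series. *)
Lemma tail_union_mass (Bad : nat -> set (borelType X)) (z : R) N1 e : 0 <= z < 1 -> 0 < e ->
  (forall N, measurable (Bad N)) ->
  (forall N, (N1 <= N)%N -> mu (Bad N) <= (z ^+ N)%:E)%E ->
  exists2 N0, (N1 <= N0)%N & (mu (\bigcup_(N in [set N | (N0 <= N)%N]) Bad N) < e%:E)%E.
Proof.
move=> z01 e0 mB muB; have z1 : 0 < 1 - z by case/andP: z01; rewrite subr_gt0.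
have [n zn] := expr_small z01 (mulr_gt0 e0 z1).
pose N0 := maxn N1 n; exists N0; first exact: leq_maxl.
have zN0 : z ^+ N0 / (1 - z) < e.
  rewrite ltr_pdivrMr// (le_lt_trans _ zn)//.
  by case/andP: z01 => z0 /ltW z1'; rewrite ler_wiXn2l// leq_maxr.
apply: (@le_lt_trans _ _ (\sum_(N0 <= N <oo) mu (Bad N))%E).
  apply: measure_sigma_subadditive_tail => //.
    by apply: bigcup_measurable => N _; exact: mB.
  move=> x [N /= NN Bx]; exists N => //=; apply/negP; by rewrite -leqNgt.
apply: le_lt_trans (_ : (z ^+ N0 / (1 - z))%:E < e%:E)%E; last by rewrite lte_fin.
apply: nneseries_le_bound => [N|k]; first exact: measure_ge0.
rewrite (le_trans _ (_ : (\sum_(N0 <= N < k) z ^+ N)%:E <= _)%E) ?lee_fin ?sum_geometric_le//.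
rewrite -sumEFin big_nat [leRHS]big_nat lee_sum// => N /andP[NN _].
by apply: muB; rewrite (leq_trans _ NN)// leq_maxl.
Qed.

Lemma measurable_central (Q : seq A -> Prop) N :
  measurable ([set x : X | Q (central x N)] : set (borelType X)).
Proof. exact: measurable_window. Qed.

Lemma mu_central (Q : pred (seq A)) N :
  mu [set x : X | Q (central x N)] = (\sum_(t : (N.*2.+1).-tuple A | Q t) word_freq t)%:E.
Proof. exact: mu_window. Qed.

Lemma mu_central_eq (x : X) N :
  mu [set y : X | central y N = central x N] = (word_freq (central x N))%:E.
Proof.
rewrite -(mu_windowset _ (- N%:Z)); congr (mu _); rewrite /windowset.
by rewrite size_central.
Qed.

End FrequencyMeasure.

(** * Hausdorff dimension *)

Section Dimension.
Context {R : realType} {A : alphabetType} (theta : random_substitution R A).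
Local Notation X := (fullshift R A).
Variable mu : probability (borelType X) R.
Hypothesis mu_freq : is_frequency_measure theta mu.
Local Notation p := (word_freq theta mu).

Let geometric_decay (eta : R) : 0 < eta -> 0 <= expR (- eta) < 1.
Proof. by move=> e0; rewrite expR_ge0 -[ltRHS]expR0 ltr_expR oppr_lt0. Qed.

Let central_decay (Q : nat -> pred (seq A)) (eta : R) : 0 < eta ->
  (\forall n \near \oo, \sum_(t : n.-tuple A | Q n t) p t <= expR (- (eta * n%:R))) ->
  exists N1, forall N, (N1 <= N)%N ->
    (mu [set x : X | Q N.*2.+1 (central x N)] <= (expR (- eta) ^+ N)%:E)%E.
Proof.
move=> eta0 [n1 _ n1P]; exists n1 => N nN; rewrite (mu_central mu_freq) lee_fin.
apply: le_trans (n1P N.*2.+1 _) _.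
  by rewrite /= (leq_trans nN)// -addnn -addSn leq_addl.
rewrite -expRM_natl ler_expR mulrN lerN2 mulrC ler_wpM2l ?(ltW eta0)//.
by rewrite ler_nat -addnn -addSn leq_addl.
Qed.

Let decay_union (Q : nat -> pred (seq A)) (eta e : R) : 0 < eta -> 0 < e ->
  (\forall n \near \oo, \sum_(t : n.-tuple A | Q n t) p t <= expR (- (eta * n%:R))) ->
  exists N0, (mu (\bigcup_(N in [set N | (N0 <= N)%N])
    [set x : X | Q N.*2.+1 (central x N)]) < e%:E)%E.
Proof.
move=> eta0 e0 /(central_decay eta0)[N1 N1P].
have [N0 _ N0P] := @tail_union_mass _ _ mu
  (fun N => [set x : X | Q N.*2.+1 (central x N)]) _ _ e (geometric_decay eta0) e0
  (fun N => measurable_central (fun w => Q N.*2.+1 w) N) N1P.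
by exists N0.
Qed.

Lemma diameter_ge0 (U : set X) : U !=set0 -> (0 <= diameter U)%E.
Proof.
move=> [x Ux]; apply: ereal_sup_ubound; exists x => //; exists x => //.
by rewrite mdistxx.
Qed.

Lemma diameter_power_ge0 s (U : set X) : (0 <= diameter_power s U)%E.
Proof. by rewrite /diameter_power; case: ifP => // _; exact: poweR_ge0. Qed.

Lemma mdist_le_diameter (U : set X) x y : U x -> U y -> ((mdist x y)%:E <= diameter U)%E.
Proof. by move=> Ux Uy; apply: ereal_sup_ubound; exists x => //; exists y. Qed.

Lemma diameter_le (U : set X) (d : \bar R) :
  (forall x y, U x -> U y -> (mdist x y)%:E <= d)%E -> (diameter U <= d)%E.
Proof. by move=> Ud; apply: ge_ereal_sup => _ [x Ux [y Uy <-]]; exact: Ud. Qed.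

Lemma hausdorff_content_ge0 s d (E : set X) : (0 <= hausdorff_content s d E)%E.
Proof.
apply: le_ereal_inf_tmp => _ [U _ <-]; apply: nneseries_ge0 => i _ _.
exact: diameter_power_ge0.
Qed.

Lemma scale_small (e : R) : 0 < e -> exists N, scale N < e.
Proof.
move=> e0; have z01 : 0 <= (expR (- 2) : R) < 1 by apply: geometric_decay.
have [N NP] := expr_small z01 e0; exists N; apply: le_lt_trans NP.
rewrite -expRM_natl /scale ler_expR; lra.
Qed.

(* A set of diameter D > 0 fits in a central cylinder of scale comparable to D,
   and a set of diameter 0 in arbitrarily small ones. *)
Lemma cover_mass (U F : set X) s s' N0 : 0 <= s' -> s' < s ->
  (diameter U <= (scale N0)%:E)%E ->
  (forall x N, F x -> (N0 <= N)%N -> p (central x N) <= expR (- (N.*2.+1%:R * s))) ->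
  exists C : set (borelType X), [/\ measurable C, U `&` F `<=` C &
    (mu C <= (expR (2 * s))%:E * diameter_power s' U)%E].
Proof.
move=> s'0 s's Usmall Fp; have s0 : 0 < s by apply: le_lt_trans s's.
have [U0|/set0P/negP/negPn/eqP U0] := pselect ((U `&` F) !=set0); last first.
  by exists set0; split; rewrite ?U0 ?measure0 ?mule_ge0 ?lee_fin ?expR_ge0 ?diameter_power_ge0.
have [x [Ux Fx]] := U0.
have Un0 : U != set0 by apply/set0P; exists x.
have D0 : (0 <= diameter U)%E by apply: diameter_ge0; exists x.
have Dfin : diameter U \is a fin_num.
  by rewrite ge0_fin_numE// (le_lt_trans Usmall) ?ltry.
rewrite /diameter_power (negPf Un0).
move: D0 Usmall (@mdist_le_diameter U x); rewrite -(fineK Dfin); set D := fine _.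
rewrite !lee_fin poweR_EFin => D0 Dsmall xD.
have cyl N : D <= scale N -> U `<=` [set y | central y N = central x N].
  move=> DN y Uy; apply/esym/eq_centralP/mdist_le_scale; rewrite (le_trans _ DN)//.
  by rewrite -lee_fin; exact: xD.
have mcyl N : measurable ([set y : X | central y N = central x N] : set (borelType X)).
  exact: (measurable_central (fun w => w = central x N)).
have mucyl N : (N0 <= N)%N ->
    (mu [set y : X | central y N = central x N] <= (expR (- (N.*2.+1%:R * s)))%:E)%E.
  by move=> NN; rewrite (mu_central_eq mu_freq) lee_fin Fp.
have [Dpos|Dneg|DE] := ltgtP 0 D; last first.
- exists (\bigcap_(N in [set: nat]) [set y : X | central y N = central x N]); split.
  + by apply: bigcap_measurable => // N _; exact: mcyl.
  + by move=> y [Uy _] N _; apply: cyl => //; rewrite -DE expR_ge0.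
  have -> : mu (\bigcap_(N in [set: nat]) [set y : X | central y N = central x N]) = 0%E.
    apply/eqP; rewrite eq_le measure_ge0 andbT; apply/lee_addgt0Pr => e e0; rewrite add0e.
    have [N NP] := expr_small (geometric_decay s0) e0.
    apply: (@le_trans _ _ (mu [set y : X | central y (maxn N N0) = central x (maxn N N0)])).
      rewrite le_measure ?inE//; first by apply: bigcap_measurable => // M _; exact: mcyl.
      by move=> y; exact.
    rewrite (le_trans (mucyl _ (leq_maxr _ _)))// lee_fin (le_trans _ (ltW NP))//.
    rewrite -expRM_natl ler_expR mulrN lerN2 ler_wpM2r ?(ltW s0)// ler_nat.
    by rewrite (leq_trans (leq_maxl N N0))// -addnn -addSn leq_addl.
  by rewrite mule_ge0 ?lee_fin ?expR_ge0 ?powR_ge0.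
- by rewrite ltNge D0 in Dneg.
have exM : exists M, scale M < D by exact: scale_small.
(* Minimality gives [scale N.+1] < D <= [scale N]; the case of index 0 would contradict D <=
   [scale N0]. *)
case: (ex_minnP exM) => -[|N] MD Mmin.
  move: MD; rewrite ltNge (le_trans Dsmall)// /scale ler_expR.
  by rewrite lerD2r mulr0 mulNr oppr_le0 mulr_ge0.
have DN : D <= scale N.
  by rewrite leNgt; apply/negP => /Mmin; rewrite ltnn.
have NN : (N0 <= N)%N.
  rewrite -ltnS ltnNge; apply/negP => NN; move: MD; rewrite ltNge (le_trans Dsmall)//.
  by rewrite /scale ler_expR lerD2r !mulNr lerN2 ler_pM2l// ler_nat.
exists [set y : X | central y N = central x N]; split => //.
  by move=> y [Uy _]; exact: cyl.
rewrite (le_trans (mucyl N NN))// -EFinM lee_fin.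
have D1 : D <= 1.
  rewrite (le_trans DN)// /scale -[leRHS]expR0 ler_expR.
  by have := ler0n R N; lra.
(* The factor e^(2 s) is the ratio of the powers s of two consecutive scales, between which D
   lies. *)
rewrite (_ : - (N.*2.+1%:R * s) = 2 * s + s * (- 2 * N.+1%:R - 1)); last first.
  by rewrite -mul2n -!natr1 natrM; ring.
rewrite expRD ler_pM2l ?expR_gt0// /powR gt_eqF// ler_expR.
have lnD : - 2 * N.+1%:R - 1 < ln D by rewrite -ltr_expR lnK.
have lnD0 : ln D <= 0 by exact: ln_le0.
apply: (@le_trans _ _ (s * ln D)); first by rewrite ler_pM2l// ltW.
by rewrite ler_wnM2r// ltW.
Qed.

(** Mass distribution principle. Discarding the points with a heavy central word at some level past
    N0 leaves a set F of positive mass with uniformly small cylinders. If the s'-measure of E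
    vanished for some s' < s, a cover with arbitrarily small sum would force mu F to be smaller than
    itself. *)
Lemma hausdorff_dim_ge (E : set X) s eta : 0 < eta ->
  (\forall n \near \oo, \sum_(t : n.-tuple A | expR (- (n%:R * s)) <= p t) p t <=
    expR (- (eta * n%:R))) ->
  measurable (E : set (borelType X)) -> (0 < mu E)%E -> (s%:E <= hausdorff_dim E)%E.
Proof.
move=> eta0 heavy mE muE; apply: le_ereal_inf_tmp => _ [s' [s'0 HE] <-].
rewrite lee_fin leNgt; apply/negP => s's.
have muEfin : mu E \is a fin_num by exact: fin_num_measure.
have fE0 : 0 < fine (mu E) by rewrite fine_gt0// muE -ge0_fin_numE ?measure_ge0.
have [N0] := decay_union (Q := fun n w => expR (- (n%:R * s)) <= p w) eta0 fE0 heavy.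
set B := \bigcup_(N in _) _; rewrite fineK// => muB.
have mB : measurable (B : set (borelType X)).
  apply: bigcup_measurable => N _.
  exact: (measurable_central (fun w => expR (- (N.*2.+1%:R * s)) <= p w)).
pose F : set (borelType X) := E `\` B.
have mF : measurable F by exact: measurableD.
have muF : (0 < mu F)%E.
  rewrite lt0e measure_ge0 andbT; apply/eqP => F0; move: muB; rewrite ltNge => /negP; apply.
  have -> : mu E = (mu F + mu ((E : set (borelType X)) `&` B))%E by exact: measureDI.
  rewrite F0 add0e le_measure ?inE//.
  exact: measurableI.
have muFfin : mu F \is a fin_num by exact: fin_num_measure.
have fF0 : 0 < fine (mu F) by rewrite fine_gt0// muF -ge0_fin_numE ?measure_ge0.
(* The constant of [cover_mass] turns a cover of sum below e into a total mass below mu F. *)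
pose e := fine (mu F) / expR (2 * s).
have e0 : 0 < e by rewrite divr_gt0// expR_gt0.
have H0 : (hausdorff_content s' (scale N0) E <= 0)%E.
  rewrite -HE; apply: ereal_sup_ubound; exists (scale N0) => //=; exact: expR_gt0.
have {}H0 : hausdorff_content s' (scale N0) E = 0%E.
  by apply/eqP; rewrite eq_le H0 hausdorff_content_ge0.
have [|_ [U [EU Usmall] <-]] := @lb_ereal_inf_adherent _ [set (\sum_(0 <= i <oo) diameter_power s' (U i))%E |
    U in [set U : (set X)^nat |
      E `<=` \bigcup_i U i /\ forall i, (diameter (U i) <= (scale N0)%:E)%E]] e e0.
  by rewrite -/(hausdorff_content s' (scale N0) E) H0.
rewrite -/(hausdorff_content s' (scale N0) E) H0 add0e => Ue.
have Fp (x : X) N : F x -> (N0 <= N)%N -> p (central x N) <= expR (- (N.*2.+1%:R * s)).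
  by move=> [_ nB] NN; rewrite leNgt; apply/negP => /ltW h; apply: nB; exists N.
have [C CP] := choice (fun i => cover_mass s'0 s's (Usmall i) Fp).
have : (mu F <= \sum_(0 <= i <oo) mu (C i))%E.
  apply: measure_sigma_subadditive => // [i|x Fx]; first by have [] := CP i.
  have [i _ Ui] := EU x Fx.1; exists i => //.
  by have [_ + _] := CP i; apply.
apply/negP; rewrite -ltNge.
apply: (@le_lt_trans _ _ (\sum_(0 <= i <oo) ((expR (2 * s))%:E * diameter_power s' (U i)))%E).
  by apply: lee_nneseries => // i _; have [] := CP i.
rewrite nneseriesZl; last by move=> i _; exact: diameter_power_ge0.
rewrite -(fineK muFfin) -lte_pdivlMl ?expR_gt0// -EFinM mulrC.
exact: Ue.
Qed.

(** Points with no light central word past N0 are covered by at most e^(n s1) central cylinders of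
    diameter at most e^(-n), so their powers s sum to at most e^(-n (s - s1)). *)
Lemma hausdorff_dim_le s s1 eta : 0 < eta -> 0 <= s1 -> s1 < s ->
  (\forall n \near \oo, \sum_(t : n.-tuple A | p t <= expR (- (n%:R * s1))) p t <=
    expR (- (eta * n%:R))) ->
  exists E : set X, [/\ measurable (E : set (borelType X)), (0 < mu E)%E &
    (hausdorff_dim E <= s%:E)%E].
Proof.
move=> eta0 s10 s1s light.
have [N0] := decay_union (Q := fun n w => p w <= expR (- (n%:R * s1))) eta0 ltr01 light.
set B := \bigcup_(N in _) _ => muB.
have mB : measurable (B : set (borelType X)).
  apply: bigcup_measurable => N _.
  exact: (measurable_central (fun w => p w <= expR (- (N.*2.+1%:R * s1)))).
exists (~` B); split; first exact: measurableC.
  by rewrite probability_setC// sube_gt0.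
apply: ereal_inf_lbound; exists s => //; split; first by rewrite (le_trans s10)// ltW.
apply/eqP; rewrite eq_le; apply/andP; split; last first.
  apply: le_trans (hausdorff_content_ge0 s 1 (~` B)) _.
  by apply: ereal_sup_ubound; exists 1 => //=; exact: ltr01.
apply: ge_ereal_sup => _ [d /= d0 <-]; apply/lee_addgt0Pr => e e0; rewrite add0e.
have gap0 : 0 < s - s1 by rewrite subr_gt0.
have [N1 N1P] := scale_small d0.
have [N2 N2P] := expr_small (geometric_decay gap0) e0.
pose N := maxn N0 (maxn N1 N2); pose n := N.*2.+1.
have scaleE : scale N = expR (- n%:R) :> R.
  have nE : n%:R = 2 * N%:R + 1 :> R by rewrite /n -mul2n -natr1 natrM.
  by rewrite /scale nE; congr expR; ring.
have scale_d : scale N <= d.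
  rewrite (le_trans _ (ltW N1P))// /scale ler_expR lerD2r !mulNr lerN2 ler_pM2l// ler_nat.
  by rewrite leq_max leq_maxl orbT.
pose S := seq.filter (fun t : n.-tuple A => expR (- (n%:R * s1)) < p t) (index_enum _).
(* Each word of S has mass above e^(-n s1), and the total mass is 1. *)
have cardS : (size S)%:R <= expR (n%:R * s1).
  have : (size S)%:R * expR (- (n%:R * s1)) <= 1.
    rewrite -[leRHS](word_freq_law mu_freq n).2 [leRHS](bigID (fun t : n.-tuple A => expR (- (n%:R * s1)) < p t))/=.
    rewrite -[leLHS]addr0 lerD ?sumr_ge0// => [|t _]; last exact: word_freq_ge0.
    rewrite -big_filter -/S.
    have -> : (size S)%:R * expR (- (n%:R * s1)) = \sum_(t <- S) expR (- (n%:R * s1)).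
      by rewrite big_const_seq count_predT iter_addr_0 mulr_natl.
    by rewrite big_seq [leRHS]big_seq ler_sum// => t; rewrite mem_filter => /andP[/ltW].
  by rewrite expRN ler_pdivrMr ?expR_gt0// mul1r.
pose U i : set X := if (i < size S)%N then
  [set x : X | central x N = nth [::] [seq val t | t <- S] i] else set0.
have Ud i x y : U i x -> U i y -> mdist x y <= scale N.
  rewrite /U; case: ifP => // _ /= xi yi; apply/mdist_le_scale/eq_centralP.
  by rewrite xi yi.
apply: (@le_trans _ _ (\sum_(0 <= i <oo) diameter_power s (U i))%E).
  apply: ereal_inf_lbound; exists U => //; split.
    move=> x nBx; have sx : size (central x N) == n by rewrite size_central.
    have xS : central x N \in [seq val t | t <- S].
      apply/mapP; exists (Tuple sx) => //; rewrite mem_filter mem_index_enum andbT /=.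
      rewrite ltNge; apply/negP => h; apply: nBx; exists N => //=.
      exact: leq_maxl.
    exists (index (central x N) [seq val t | t <- S]) => //.
    by rewrite /U -(size_map val S) index_mem xS /= nth_index.
  move=> i; apply: diameter_le => x y Ux Uy; rewrite lee_fin (le_trans _ scale_d)//.
  exact: Ud Ux Uy.
have Uterm i : (diameter_power s (U i) <=
    (if (i < size S)%N then expR (- (n%:R * s)) else 0)%:E)%E.
  rewrite /diameter_power; case: eqP => [_|/eqP Ui].
    by rewrite lee_fin; case: ifP => // _; exact: expR_ge0.
  have iS : (i < size S)%N by move: Ui; rewrite /U; case: ifP => //; rewrite eqxx.
  rewrite iS; have D0 : (0 <= diameter (U i))%E by apply: diameter_ge0; apply/set0P.
  have Dle : (diameter (U i) <= (scale N)%:E)%E.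
    by apply: diameter_le => x y Ux Uy; rewrite lee_fin; exact: Ud Ux Uy.
  have s0 : 0 <= s by rewrite (le_trans s10)// ltW.
  have Dfin : diameter (U i) \is a fin_num by rewrite ge0_fin_numE// (le_lt_trans Dle) ?ltry.
  move: D0 Dle; rewrite -(fineK Dfin) poweR_EFin !lee_fin => D0 Dle.
  rewrite -mulNr expRM -scaleE; apply: ge0_ler_powR; rewrite ?nnegrE ?expR_ge0//.
apply: (@le_trans _ _ ((size S)%:R * expR (- (n%:R * s)))%:E).
  apply: nneseries_le_bound => [i|k]; first exact: diameter_power_ge0.
  rewrite (le_trans (lee_sum _ (fun i _ => Uterm i)))// sumEFin lee_fin.
  rewrite -big_mkcond/= big_const_seq iter_addr_0 -[leLHS]mulr_natl ler_wpM2r ?expR_ge0//.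
  rewrite ler_nat -size_filter -[leqRHS](size_iota 0).
  apply: uniq_leq_size; first by rewrite filter_uniq ?iota_uniq.
  by move=> i; rewrite mem_filter mem_iota /= => /andP[].
rewrite lee_fin; apply: (@le_trans _ _ (expR (n%:R * s1) * expR (- (n%:R * s)))).
  by rewrite ler_wpM2r ?expR_ge0.
rewrite -expRD (le_trans _ (ltW N2P))// -expRM_natl ler_expR.
rewrite -mulrBr -(opprB s s1) !mulrN lerN2 ler_wpM2r ?(ltW gap0)// ler_nat.
have nN : (N <= n)%N by rewrite /n -addnn -addSn leq_addl.
by rewrite (leq_trans _ nN)// !leq_max leqnn !orbT.
Qed.

End Dimension.

(** * The Lq-spectrum *)

Section Spectrum.
Context {R : realType} {A : alphabetType} (theta : random_substitution R A).
Variables (lam : R) (r : A -> R).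
Hypotheses (compat : subst_compatible theta) (prim : subst_primitive theta).
Hypotheses (lam_perron : is_perron_eigenvalue (subst_matrix theta) lam).
Hypotheses (r_perron : is_right_perron_vector theta lam r).
Variable mu : probability (borelType (fullshift R A)) R.
Hypothesis mu_freq : is_frequency_measure theta mu.

Local Notation p := (word_freq theta mu).
Local Notation h := (entropy_rate p).

Let p_freq := word_freq_cvg mu_freq.
Let p_illegal := @word_freq_illegal _ _ theta mu.
Let p_law := word_freq_law mu_freq.
Let p_ge0 := @word_freq_ge0 _ _ theta mu.

Lemma Lq_spectrum1 : Lq_spectrum theta mu 1 = 0%E.
Proof.
rewrite /Lq_spectrum (_ : (fun n => _) = fun=> 0%E).
  by rewrite (cvg_limn_einf_sup (cvg_cst _)).1.
apply/funext => n; have -> : \sum_(u in legal_words theta n) p u `^ 1 = 1.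
  rewrite -[RHS](p_law n).2 [RHS](bigID (mem (legal_words theta n)))/=.
  rewrite [X in _ + X]big1 ?addr0 => [|t]; last first.
    by rewrite inE => /asboolP/p_illegal.
  by apply: eq_bigr => t _; rewrite powRr1.
by rewrite ln1 mulr0 oppr0.
Qed.

Lemma Lq_spectrumE q : 0 < q -> q != 1 ->
  Lq_spectrum theta mu q = ((q - 1) * renyi_rate p q)%:E.
Proof.
move=> q0 q1; have [rq _] := renyi_rateP compat prim lam_perron r_perron p_freq
  p_illegal p_law p_ge0 (ltW q0) q1.
apply: (cvg_limn_einf_sup _).1; apply: cvg_EFin; first by near=> n.
rewrite (_ : _ \o _ = fun n => (q - 1) * (n%:R^-1 * word_renyi p q n)).
  by apply: cvgM => //; exact: cvg_cst.
apply/funext => n /=; rewrite /word_renyi /renyi.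
have -> : \sum_(u in legal_words theta n) p u `^ q = \sum_(t : n.-tuple A) pw q (p t).
  rewrite [RHS](bigID (mem (legal_words theta n)))/=.
  rewrite [X in _ + X]big1 ?addr0 => [|t]; last first.
    by rewrite inE => /asboolP/p_illegal ->; rewrite pw0.
  by apply: eq_bigr => t _; rewrite pw_powR// gt_eqF.
have : 1 - q != 0 by rewrite subr_eq0 eq_sym.
(* At n = 0 both sides vanish because the inverse of 0 is 0. *)
have [->|n0] := eqVneq (n%:R : R) 0; first by rewrite invr0 !mul0r mulr0 oppr0.
by move=> q1'; field; rewrite q1'.
Unshelve. all: by end_near. Qed.

Lemma Lq_spectrum_fin_near : \forall q \near (1 : R), Lq_spectrum theta mu q \is a fin_num.
Proof.
near=> q; have [->|q1] := eqVneq q 1; first by rewrite Lq_spectrum1.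
by rewrite Lq_spectrumE//; near: q; exact: lt_nbhsr ltr01.
Unshelve. all: by end_near. Qed.

(** Since the spectrum vanishes at 1, the quotient at t near 0 is exactly [renyi_rate] at 1 + t. *)
Lemma Lq_spectrum_difference_quotient :
  t^-1 *: (((fun q => fine (Lq_spectrum theta mu q)) \o +%R^~ 1) (t *: (1 : R)) -
    fine (Lq_spectrum theta mu 1)) @[t --> (0 : R)^'] --> h.
Proof.
have rc := renyi_rate_cvg compat prim lam_perron r_perron p_freq p_illegal p_law p_ge0.
apply: cvg_trans rc; apply: near_eq_cvg; near=> t.
have t0 : t != 0 by near: t; exact: nbhs_dnbhs_neq.
have t1 : `|t| < 1 by near: t; apply: dnbhs0_lt; exact: ltr01.
rewrite Lq_spectrum1 /= subr0 -[t *: 1]/(t * 1) mulr1 [t + 1]addrC Lq_spectrumE.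
- by rewrite (_ : 1 + t - 1 = t); [rewrite /= -[RHS]/(_ * _) mulKf|ring].
- by move: t1; rewrite ltr_norml => /andP[? ?]; lra.
- by rewrite -subr_eq0 (_ : 1 + t - 1 = t); [|ring].
Unshelve. all: by end_near. Qed.

Lemma measure_entropyE : measure_entropy theta mu = h.
Proof.
rewrite /measure_entropy /entropy_rate; congr (lim (_ @ \oo)); apply/funext => n.
congr (_ * _); rewrite /word_shannon /shannon [RHS](bigID (mem (legal_words theta n)))/=.
rewrite [X in _ + X]big1 ?addr0// => t.
by rewrite inE => /asboolP/p_illegal ->; rewrite mul0r oppr0.
Qed.

Lemma entropy_rate_ge0 : 0 <= h.
Proof.
have [_ _ /(_ 0%N)/andP[+ _]] := entropy_rateP compat prim lam_perron r_perron p_freq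
  p_illegal p_law p_ge0.
apply: le_trans; rewrite /mean_shannon expr0 invr1 mul1r; apply: sumr_ge0 => a _.
rewrite mulr_ge0 ?(ltW (r_gt0 r_perron a))//.
have l1 := iter_prob_law theta 0 [:: a].
rewrite /shannon big_seq; apply: sumr_ge0 => w wk; rewrite oppr_ge0 mulr_ge0_le0 ?l1.1//.
by rewrite ln_le0// (law_le1 l1).
Qed.

Lemma hausdorff_dim_frequency :
  hausdorff_dim_measure (mu : set (fullshift R A) -> \bar R) = h%:E.
Proof.
apply/eqP; rewrite eq_le; apply/andP; split.
  apply/lee_addgt0Pr => e e0; rewrite -EFinD.
  (* Light words are measured at a level strictly between the rate h and the exponent h + e of the
     cover. *)
  have e20 : h < h + e / 2 by rewrite ltrDl divr_gt0.
  have [eta eta0 light] := light_words_mass compat prim lam_perron r_perron p_freq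
    p_illegal p_law p_ge0 e20.
  have [||E [mE muE Es]] := @hausdorff_dim_le _ _ theta mu mu_freq (h + e) _ _ eta0 _ _ light.
  - by rewrite addr_ge0 ?entropy_rate_ge0// divr_ge0// ltW.
  - by rewrite ltrD2l ltr_pdivrMr// ltr_pMr// ltr1n.
  by apply: le_trans Es; apply: ereal_inf_lbound; exists E.
apply: le_ereal_inf_tmp => _ [E [mE muE] <-]; apply/lee_subgt0Pr => e e0.
have eh : h - e < h by rewrite gtrBl.
have [eta eta0 heavy] := heavy_words_mass compat prim lam_perron r_perron p_freq
  p_illegal p_law p_ge0 eh.
rewrite -EFinB; exact: (@hausdorff_dim_ge _ _ theta mu mu_freq E _ eta eta0 heavy mE muE).
Qed.

End Spectrum.

Unset Implicit Arguments.

Theorem corollaryC (R : realType) (A : alphabetType)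
    (theta : random_substitution R A) (lam : R) (r : A -> R)
    (theta_primitive : subst_primitive theta)
    (theta_compatible : subst_compatible theta)
    (lam_perron : is_perron_eigenvalue (subst_matrix theta) lam)
    (r_perron : is_right_perron_vector theta lam r) :
  ((fun k : nat => (lam ^+ k)^-1 *
      \sum_(a : A) r a * ln (#|` subst_iter theta k [:: a]|)%:R) @ \oo
     --> topological_entropy theta) /\
  (forall mu : probability (borelType (fullshift R A)) R,
    is_frequency_measure theta mu ->
    [/\ (\forall q \near (1 : R), Lq_spectrum theta mu q \is a fin_num),
        derivable (fun q : R => fine (Lq_spectrum theta mu q)) 1 1,
        (fun k : nat => (lam ^+ k)^-1 *
           \sum_(a : A) r a *
             \sum_(v <- subst_iter theta k [:: a])
               - (subst_iter_prob theta k [:: a] v *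
                  ln (subst_iter_prob theta k [:: a] v))) @ \oo
          --> measure_entropy theta mu,
        (measure_entropy theta mu)%:E =
          hausdorff_dim_measure (mu : set (fullshift R A) -> \bar R) &
        measure_entropy theta mu =
          derive1 (fun q : R => fine (Lq_spectrum theta mu q)) 1]).
Proof.
split.
  have := topological_entropy_cvg theta_compatible theta_primitive lam_perron r_perron point.
  suff -> : mean_entropy theta lam r 0 = (fun k : nat => (lam ^+ k)^-1 *
      \sum_(a : A) r a * ln (#|` subst_iter theta k [:: a]|)%:R) by [].
  apply/funext => k.
  by rewrite /mean_entropy; under eq_bigr do rewrite letter_entropy0.
move=> mu mu_freq.
have dq := Lq_spectrum_difference_quotient theta_compatible theta_primitive lam_perron
  r_perron mu_freq.
have [_ mc _] := entropy_rateP theta_compatible theta_primitive lam_perron r_perron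
  (word_freq_cvg mu_freq) (@word_freq_illegal _ _ theta mu) (word_freq_law mu_freq)
  (@word_freq_ge0 _ _ theta mu).
rewrite measure_entropyE; split.
- exact: (Lq_spectrum_fin_near theta_compatible theta_primitive lam_perron r_perron mu_freq).
- by apply/cvg_ex; exists (entropy_rate (word_freq theta mu)).
- exact: mc.
- by rewrite (hausdorff_dim_frequency theta_compatible theta_primitive lam_perron r_perron mu_freq).
- by rewrite derive1E; apply/esym/cvg_lim => //; exact: Rhausdorff.
Qed.
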